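(* Let $\omega=(\omega_x)_{x\in\mathbb{Z}}$ be a sequence of i.i.d. real random variables on a probability space $(\Omega,\mathcal{F},\mathbb{P})$ satisfying: $\omega_0\stackrel{\text{(law)}}{=}-\omega_0$, $\mathbb{E}(|\omega_0|^k)<+\infty$ for all $k\geq1$, and $\mathbb{E}(\omega_0^2)=1$. Let $(X_n)_{n\geq1}$ be i.i.d. random variables on another probability space $(\Omega',\mathcal{A},P)$, whose support is an aperiodic subset of $\mathbb{N}^*=\{1,2,\dots\}$, with $m:=E[X_1]<+\infty$ and $E[X_1^2]<+\infty$. Let $S_0=0$, $S_n=\sum_{k=1}^n X_k$, and $Z_n=\sum_{k=1}^n\omega_{S_k}$. Then for $\mathbb{P}$-almost every $\omega$, under $P$, $$\frac{Z_n-E[Z_n]}{\sqrt{n}}\xrightarrow[n\to\infty]{\text{(law)}}\mathcal{N}(0,1-1/m).$$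
   Context: $E$ denotes expectation with respect to $P$ (the law of the walk) with the scenery $\omega$ held fixed, so $E[Z_n]$ is a function of $\omega$. $(S_n)$ is a renewal process. *)

(* Defs.v *)
From HB Require Import structures.
From mathcomp Require Import all_boot all_order all_algebra.
From mathcomp Require Import all_classical all_reals all_analysis.
Set Implicit Arguments. Unset Strict Implicit. Unset Printing Implicit Defensive.
Import Order.TTheory GRing.Theory Num.Theory.
Import numFieldNormedType.Exports.
Local Open Scope classical_set_scope.
Local Open Scope ring_scope.

Definition mutually_independent_R {d} {Om : measurableType d} {R : realType}
  (P : probability Om R) (I : eqType) (Y : I -> Om -> R) : Prop :=
  forall (s : seq I) (B : I -> set R), uniq s ->
    (forall i, i \in s -> measurable (B i)) ->
    P (\bigcap_(i in [set` s]) (Y i @^-1` B i)) =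
      (\prod_(i <- s) P (Y i @^-1` B i))%E.

Definition iid_R {d} {Om : measurableType d} {R : realType}
  (P : probability Om R) (I : eqType) (Y : I -> Om -> R) (i0 : I) : Prop :=
  [/\ forall i, measurable_fun setT (Y i),
      mutually_independent_R P Y &
      forall i (B : set R), measurable B ->
        P (Y i @^-1` B) = P (Y i0 @^-1` B)].

(* Same notions for nat-valued random variables (discrete sigma-algebra on nat). *)
Definition mutually_independent_N {d} {Om : measurableType d} {R : realType}
  (P : probability Om R) (X : nat -> Om -> nat) : Prop :=
  forall (s : seq nat) (B : nat -> set nat), uniq s ->
    P (\bigcap_(i in [set` s]) (X i @^-1` B i)) =
      (\prod_(i <- s) P (X i @^-1` B i))%E.

Definition iid_N {d} {Om : measurableType d} {R : realType}
  (P : probability Om R) (X : nat -> Om -> nat) : Prop :=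
  [/\ forall i k, measurable (X i @^-1` [set k]),
      mutually_independent_N P X &
      forall i (B : set nat), P (X i @^-1` B) = P (X 0 @^-1` B)].

Definition support_N {d} {Om : measurableType d} {R : realType}
  (P : probability Om R) (Y : Om -> nat) : set nat :=
  [set k | (0 < P (Y @^-1` [set k]))%E].

Definition aperiodic (A : set nat) : Prop :=
  forall p : nat, (forall k, A k -> (p %| k)%N) -> p = 1%N.

(* Renewal process: S_0 = 0, S_n = X_1 + ... + X_n, where X_k is encoded as
   X (k-1) (the sequence X is indexed from 0). *)
Definition renewal (Om : Type) (X : nat -> Om -> nat) (n : nat) (w : Om) : nat :=
  (\sum_(k < n) X k w)%N.

Definition scenery_sum {R : realType} (Om Om' : Type) (omega : int -> Om -> R)
  (X : nat -> Om' -> nat) (n : nat) (om : Om) (w : Om') : R :=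
  \sum_(k < n) omega (Posz (renewal X k.+1 w)) om.

(* Convergence in law under P of the real random variables Y n to the
   centered Gaussian N(0, v), v >= 0, i.e. to the law of sqrt(v) * G with
   G ~ N(0,1) (this also covers v = 0, the Dirac mass at 0):
   E_P[f (Y n)] --> E[f (sqrt v * G)] for every bounded continuous f. *)
Definition cvg_law_to_gaussian {d} {Om : measurableType d} {R : realType}
  (P : probability Om R) (Y : nat -> Om -> R) (v : R) : Prop :=
  forall f : R -> R, continuous f -> (exists M : R, forall x, `|f x| <= M) ->
    (fun n => (\int[P]_w (f (Y n w))%:E)%E) @ \oo -->
      (\int[normal_prob 0 1]_x (f (Num.sqrt v * x))%:E)%E.

(* Main.v *)
(** The renewal points being distinct, [Z_n] is the sum of [xi_x * omega_x] over the sites [x]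
    up to [S_n], where [xi_x] indicates that [x] is a renewal point. Replacing [S_n] by [n m] costs
    [o(sqrt n)] in mean square, and replacing [xi_x] by [xi_x - 1/m] changes the sum by a function
    of the scenery alone, which the centering by [E[Z_n]] removes.

    Let [phi(t)] be the characteristic function, under [P], of the resulting sum divided by
    [sqrt n]. Averaging over the scenery first, the moments of [phi(t)] and [|phi(t)|^2] are those
    of the characteristic functions of the sum for one walk and of the difference of the sums for
    two independent walks. Both are close to Gaussian ones, since the [omega_x] are
    symmetric with unit variance, and the variances concentrate: this follows from the bound
    [sum_(x < N) (P(xi_x = 1) - 1/m)^2 = O(sqrt N)], proved by an energy argument that uses
    aperiodicity and two moments of the step. Hence [phi(t)] minus its Gaussian limit is small in
    mean square, and Borel-Cantelli along the times [(j+1)^48] gives almost sure convergence for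
    rational [t]; high moments of [omega_0] control the oscillation of [Z] between two such
    times. The convergence in law follows by approximating a bounded continuous
    function by polynomials in [sin (y / a)] and [cos (y / a)]. *)

Require Import Defs.
From HB Require Import structures.
From mathcomp Require Import all_boot all_order all_algebra.
From mathcomp Require Import all_classical all_reals all_analysis.
From mathcomp Require Import measurable_realfun.
From mathcomp Require Import ring lra zify.
Set Implicit Arguments.
Unset Strict Implicit.
Unset Printing Implicit Defensive.
Import Order.TTheory GRing.Theory Num.Theory.
Import numFieldNormedType.Exports.
Local Open Scope classical_set_scope.
Local Open Scope ring_scope.

(** * Expectations *)

(** Averaging over the scenery alone would give an annealed theorem. That [phi(t)] is nearly
    constant in the scenery is a statement about its second moment, and this is where two walks in
    the same scenery appear. Given the walks, the variance of the sum is about [n (1 - 1/m)] for one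
    walk; independent walks meet at about [N / m^2] of the first [N] sites, which makes it about
    twice as large for the difference of two. Hence the averages of [phi] and [|phi|^2] approach [c]
    and [c^2], with [c] the Gaussian value.

    The mean square error at [n = r^8] is [O(1/r)]. Taking [r = (j+1)^6] leaves room for a weight
    [(j+1)^4] in a summable series. The weight serves tightness: the characteristic function at the
    frequency [1/(j+1)], together with the fourth moment, bounds the second moment for almost every
    scenery, whereas a second moment bounded only in mean over the scenery would not do. Tightness
    is what allows frequencies restricted to rationals. *)

Definition Ex {d} {T : measurableType d} {R : realType} (P : probability T R)
  (f : T -> R) : R := fine (\int[P]_w (f w)%:E)%E.

Definition intble {d} {T : measurableType d} {R : realType}
  (P : probability T R) (f : T -> R) : Prop := P.-integrable setT (EFin \o f).

Section expectation.
Context d (T : measurableType d) (R : realType) (P : probability T R).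
Implicit Types f g : T -> R.

Lemma Ex_EFin f : intble P f -> (\int[P]_w (f w)%:E)%E = (Ex P f)%:E.
Proof. by move=> fi; rewrite /Ex fineK//; exact: integrable_fin_num. Qed.

Lemma eq_Ex f g : f =1 g -> Ex P f = Ex P g.
Proof. by move=> fg; congr fine; apply: eq_integral => x _; rewrite fg. Qed.

Lemma eq_intble f g : f =1 g -> intble P f -> intble P g.
Proof. by move=> /funext ->. Qed.

Lemma intble_measurable f : intble P f -> measurable_fun setT f.
Proof. by move=> /measurable_int /measurable_EFinP. Qed.

Lemma intbleD f g : intble P f -> intble P g -> intble P (fun w => f w + g w).
Proof. by move=> fi gi; exact: (integrableD measurableT fi gi). Qed.

Lemma intbleZ k f : intble P f -> intble P (fun w => k * f w).
Proof. by move=> fi; exact: (integrableZl measurableT k fi). Qed.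

Lemma intbleB f g : intble P f -> intble P g -> intble P (fun w => f w - g w).
Proof. by move=> fi gi; exact: (integrableB measurableT fi gi). Qed.

Lemma intble_sum I (s : seq I) (Q : pred I) (h : I -> T -> R) :
  (forall i, Q i -> intble P (h i)) ->
  intble P (fun w => \sum_(i <- s | Q i) h i w).
Proof.
move=> hi; have := integrable_sum measurableT (mu := P) s (h := fun i => EFin \o h i) hi.
by rewrite /intble; congr (integrable _ _ _); apply/funext => w /=; rewrite sumEFin.
Qed.

Lemma intble_bounded f M :
  measurable_fun setT f -> (forall w, `|f w| <= M) -> intble P f.
Proof.
move=> mf fM; apply: measurable_bounded_integrable => //.
  by rewrite (le_lt_trans (probability_le1 P measurableT))// ltry.
exists M; split; first exact: num_real.
by move=> y My w _; exact: le_trans (fM w) (ltW My).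
Qed.

Lemma intble_cst k : intble P (fun=> k).
Proof. by apply: (@intble_bounded _ `|k|) => //; exact: measurable_cst. Qed.

Lemma intble_le f g : measurable_fun setT f -> (forall w, `|f w| <= g w) ->
  intble P g -> intble P f.
Proof.
move=> mf fg; apply: le_integrable => //; first exact/measurable_EFinP.
by move=> w _ /=; rewrite lee_fin (le_trans (fg w))// ler_norm.
Qed.

Lemma intble_norm f : intble P f -> intble P (fun w => `|f w|).
Proof. exact: integrable_norm. Qed.

Lemma ExD f g : intble P f -> intble P g ->
  Ex P (fun w => f w + g w) = Ex P f + Ex P g.
Proof.
by move=> fi gi; rewrite /Ex; under eq_integral do rewrite EFinD;
  rewrite integralD_EFin// fineD//; exact: integrable_fin_num.
Qed.

Lemma ExZ k f : intble P f -> Ex P (fun w => k * f w) = k * Ex P f.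
Proof.
move=> fi; rewrite /Ex; under eq_integral do rewrite EFinM.
by rewrite integralZl// fineM//; exact: integrable_fin_num.
Qed.

Lemma ExB f g : intble P f -> intble P g ->
  Ex P (fun w => f w - g w) = Ex P f - Ex P g.
Proof.
move=> fi gi; rewrite -[- Ex P g]mulN1r -ExZ// -ExD//; last exact: intbleZ.
by apply: eq_Ex => w; rewrite mulN1r.
Qed.

Lemma Ex_cst k : Ex P (fun=> k) = k.
Proof.
by rewrite /Ex integral_cst//= probability_setT mule1.
Qed.

Lemma Ex_sum I (s : seq I) (Q : pred I) (h : I -> T -> R) :
  (forall i, Q i -> intble P (h i)) ->
  Ex P (fun w => \sum_(i <- s | Q i) h i w) = \sum_(i <- s | Q i) Ex P (h i).
Proof.
move=> hi; elim: s => [|i s IH].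
  by rewrite big_nil -[RHS](Ex_cst 0); apply: eq_Ex => w; rewrite big_nil.
rewrite big_cons -IH; case: ifPn => Qi.
  rewrite -(ExD (hi i Qi) (intble_sum s hi)).
  by apply: eq_Ex => w; rewrite big_cons Qi.
by apply: eq_Ex => w; rewrite big_cons (negbTE Qi).
Qed.

Lemma le_Ex f g : intble P f -> intble P g -> (forall w, f w <= g w) ->
  Ex P f <= Ex P g.
Proof.
move=> fi gi fg; rewrite -lee_fin -!Ex_EFin//.
by apply: le_integral => // w _; rewrite lee_fin.
Qed.

Lemma Ex_ge0 f : (forall w, 0 <= f w) -> 0 <= Ex P f.
Proof. by move=> f0; rewrite fine_ge0// integral_ge0// => w _; rewrite lee_fin. Qed.

Lemma norm_Ex_le f g : intble P f -> intble P g -> (forall w, `|f w| <= g w) ->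
  `|Ex P f| <= Ex P g.
Proof.
move=> fi gi fg; rewrite ler_norml -[- _]mulN1r -ExZ//; apply/andP; split;
  apply: le_Ex => //; first exact: intbleZ.
- by move=> w; have := fg w; rewrite ler_norml mulN1r => /andP[].
- by move=> w; have := fg w; rewrite ler_norml => /andP[].
Qed.

Lemma norm_Ex_bounded f M : measurable_fun setT f -> (forall w, `|f w| <= M) ->
  `|Ex P f| <= M.
Proof.
move=> mf fM; rewrite -[M]Ex_cst; apply: norm_Ex_le => //.
  exact: intble_bounded fM.
exact: intble_cst.
Qed.

Lemma Ex_indic (A : set T) : measurable A -> Ex P (\1_A) = fine (P A).
Proof. by move=> mA; rewrite /Ex integral_indic// setIT. Qed.

(** The bound is put on the extended integral because [fine] sends an infinite value to 0: a bound
    on [Ex P f] alone would not give integrability. *)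
Lemma ge0_intble f r : measurable_fun setT f -> (forall w, 0 <= f w) ->
  (\int[P]_w (f w)%:E <= r%:E)%E -> intble P f /\ Ex P f <= r.
Proof.
move=> mf f0 fr; have fi : intble P f.
  apply/integrableP; split; first exact/measurable_EFinP.
  rewrite (eq_integral (EFin \o f)); last by move=> w _ /=; rewrite ger0_norm.
  by rewrite (le_lt_trans fr)// ltry.
by split=> //; rewrite -lee_fin -Ex_EFin.
Qed.


End expectation.

(** * Joint laws and products of independent variables *)

Section joint_law.
Context d (T : measurableType d) (R : realType) (P : probability T R).
Variables U V : {mfun T >-> R}.

Let mUV : measurable_fun setT (fun w => (U w, V w)).
Proof. exact: measurable_fun_pair. Qed.

Let UV_mixin := isMeasurableFun.Build _ _ _ _ _ mUV.
Let UV : {mfun T >-> (R * R)%type} := HB.pack (fun w => (U w, V w)) UV_mixin.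

(** Both sides are finite measures in [E] that agree on rectangles, a family closed under
    intersection which generates the product sigma-algebra. In the application [c] is the
    probability of [C], and the conclusion is that [C] is independent of the pair. *)
Lemma joint_event_indep (C : set T) (c : R) (E : set (R * R)) :
  measurable C -> 0 <= c ->
  (forall A B : set R, measurable A -> measurable B ->
    P (U @^-1` A `&` V @^-1` B `&` C) = (c%:E * P (U @^-1` A `&` V @^-1` B))%E) ->
  measurable E -> P (UV @^-1` E `&` C) = (c%:E * P (UV @^-1` E))%E.
Proof.
move=> mC c0 hC mE.
pose m1' : {measure set (R * R) -> \bar R} :=
  pushforward (mrestr P mC) UV.
pose m2' : {measure set (R * R) -> \bar R} :=
  pushforward (mscale (NngNum c0) P) UV.
pose m1 := m1' mUV; pose m2 := m2' mUV.
pose G : set (set (R * R)) :=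
  [set X | exists A, measurable A /\ exists B, measurable B /\ X = A `*` B].
suff -> : P (UV @^-1` E `&` C) = m2 E by [].
rewrite -[LHS]/(m1 E).
apply: (measure_unique G (fun=> setT)) => //.
- rewrite measurable_prod_measurableType //; congr (<<s _ >>).
  rewrite predeqE; split => [[A mA [B mB <-]]|[A [mA [B [mB ->]]]]].
    by exists A; split => //; exists B.
  by exists A => //; exists B.
- move=> /= _ _ [X1 [mX1 [X2 [mX2 ->]]]] [Y1 [mY1 [Y2 [mY2 ->]]]].
  rewrite -setXI; exists (X1 `&` Y1); split; first exact: measurableI.
  by exists (X2 `&` Y2); split => //; exact: measurableI.
- by move=> _; exists setT; split => //; exists setT; split => //; rewrite setXTT.
- by rewrite bigcup_const.
- by move=> _ [A [mA [B [mB ->]]]]; exact: hC.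
- move=> _; rewrite /m1 /m1' /= /pushforward /mrestr preimage_setT setTI.
  by rewrite (le_lt_trans (probability_le1 P mC))// ltry.
Qed.

Hypothesis indepUV : forall A B : set R, measurable A -> measurable B ->
  P (U @^-1` A `&` V @^-1` B) = (P (U @^-1` A) * P (V @^-1` B))%E.

Lemma joint_law_product (E : set (R * R)) : measurable E ->
  (distribution P U \x distribution P V)%E E = P (UV @^-1` E).
Proof.
move=> mE.
rewrite (@product_measure_unique _ _ _ _ _ (distribution P U) (distribution P V)
  (distribution P UV))//.
Qed.

(** Under the product law, Tonelli makes [f x * g y] integrable and Fubini factors its integral;
    [joint_law_product] carries both facts to the pair. *)
Lemma intble_ExM_mfun (f g : R -> R) :
  measurable_fun setT f -> measurable_fun setT g ->
  intble P (f \o U) -> intble P (g \o V) ->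
  intble P (fun w => f (U w) * g (V w)) /\
  Ex P (fun w => f (U w) * g (V w)) = Ex P (f \o U) * Ex P (g \o V).
Proof.
move=> mf mg fi gi.
pose h (z : R * R) := (f z.1 * g z.2)%:E.
have mh : measurable_fun setT h.
  apply/measurable_EFinP/measurable_funM;
    exact/measurableT_comp.
have fi' : (distribution P U).-integrable setT (EFin \o f).
  by apply: integrable_pushforward => //; exact/measurable_EFinP.
have gi' : (distribution P V).-integrable setT (EFin \o g).
  by apply: integrable_pushforward => //; exact/measurable_EFinP.
have eqm A : measurable A -> A `<=` setT ->
    distribution P UV A = (distribution P U \x distribution P V)%E A.
  by move=> mA _; rewrite joint_law_product.
have hi : (distribution P U \x distribution P V)%E.-integrable setT h.
  apply/integrable12ltyP => //.
  rewrite (eq_integral (fun x => `|f x|%:E * \int[distribution P V]_y `|g y|%:E)%E).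
    rewrite ge0_integralZr//; last 2 first.
    - exact/measurable_EFinP/measurableT_comp.
    - by apply: integral_ge0 => y _; rewrite lee_fin.
    rewrite lte_mul_pinfty//.
    - by apply: integral_ge0 => y _; rewrite lee_fin.
    - have /integrableP[_ ltoo] := fi'; rewrite ge0_fin_numE//.
      by apply: integral_ge0 => y _; rewrite lee_fin.
    - by have /integrableP[] := gi'.
  move=> x _; rewrite -ge0_integralZl//.
  - by apply: eq_integral => y _; rewrite /h /= normrM EFinM.
  - exact/measurable_EFinP/measurableT_comp.
have hi' : (distribution P UV).-integrable setT h.
  have /integrableP[_ ltoo] := hi; apply/integrableP; split=> //.
  by rewrite (eq_measure_integral _ eqm).
have key : intble P (fun w => f (U w) * g (V w)).
  have /integrableP[_] := hi'.
  rewrite ge0_integral_pushforward//; last exact/measurableT_comp.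
  rewrite preimage_setT => ltoo; apply/integrableP; split => //.
  by apply/measurable_EFinP/measurable_funM; apply/measurableT_comp.
split=> //; apply: EFin_inj; rewrite EFinM -!Ex_EFin//.
transitivity (\int[distribution P UV]_z h z)%E.
  rewrite (@integral_pushforward _ _ _ _ _ UV mUV P setT h mh)//; exact: key.
rewrite (eq_measure_integral _ eqm) -integral12_prod_meas1//.
have gfin : (\int[distribution P V]_y (g y)%:E)%E = (Ex P (g \o V))%:E.
  by rewrite -(Ex_EFin gi) integral_pushforward//; exact/measurable_EFinP.
rewrite (eq_integral (fun x => (f x)%:E * (Ex P (g \o V))%:E)%E).
  rewrite integralZr// integral_pushforward//; first by rewrite (Ex_EFin gi).
  exact/measurable_EFinP.
by move=> x _; rewrite /h /= -gfin -integralZl.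
Qed.
End joint_law.

Section random_variables.
Context d (T : measurableType d) (R : realType) (P : probability T R).

Lemma preimage_measurable (U : T -> R) (A : set R) :
  measurable_fun setT U -> measurable A -> measurable (U @^-1` A).
Proof. by move=> mU mA; rewrite -[X in measurable X]setTI; exact: mU. Qed.

Lemma intble_ExM (U V : T -> R) (f g : R -> R) :
  measurable_fun setT U -> measurable_fun setT V ->
  (forall A B : set R, measurable A -> measurable B ->
    P (U @^-1` A `&` V @^-1` B) = (P (U @^-1` A) * P (V @^-1` B))%E) ->
  measurable_fun setT f -> measurable_fun setT g ->
  intble P (f \o U) -> intble P (g \o V) ->
  intble P (fun w => f (U w) * g (V w)) /\
  Ex P (fun w => f (U w) * g (V w)) = Ex P (f \o U) * Ex P (g \o V).
Proof.
move=> mU mV; pose U' := MeasurableFun.Pack (MeasurableFun.Class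
  (isMeasurableFun.Build _ _ _ _ _ mU)).
pose V' := MeasurableFun.Pack (MeasurableFun.Class
  (isMeasurableFun.Build _ _ _ _ _ mV)).
by move=> ind mf mg; exact: (@intble_ExM_mfun _ _ _ P U' V' ind f g mf mg).
Qed.

Lemma eq_law_Ex (U V : T -> R) (f : R -> R) :
  measurable_fun setT U -> measurable_fun setT V ->
  (forall B : set R, measurable B -> P (U @^-1` B) = P (V @^-1` B)) ->
  measurable_fun setT f -> intble P (f \o V) ->
  intble P (f \o U) /\ Ex P (f \o U) = Ex P (f \o V).
Proof.
move=> mU mV eUV mf fi; pose U' := MeasurableFun.Pack (MeasurableFun.Class
  (isMeasurableFun.Build _ _ _ _ _ mU)).
pose V' := MeasurableFun.Pack (MeasurableFun.Class
  (isMeasurableFun.Build _ _ _ _ _ mV)).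
have eqm A : measurable A -> A `<=` setT ->
    distribution P U' A = distribution P V' A by move=> mA _; exact: eUV.
have mf' : measurable_fun setT (EFin \o f) by exact/measurable_EFinP.
have key : intble P (f \o U).
  apply/integrableP; split; first exact/measurable_EFinP/measurableT_comp.
  have -> : (\int[P]_w `|(EFin \o (f \o U)) w| =
             \int[distribution P U']_x `|(f x)%:E|)%E.
    by rewrite (@ge0_integral_distribution _ _ _ _ _ P U')//; exact: measurableT_comp.
  rewrite (eq_measure_integral _ eqm).
  rewrite (@ge0_integral_distribution _ _ _ _ _ P V')//; last exact: measurableT_comp.
  by have /integrableP[] := fi.
split=> //; rewrite /Ex.
rewrite -(@integral_distribution _ _ _ _ _ P U' (EFin \o f))//.
rewrite -(@integral_distribution _ _ _ _ _ P V' (EFin \o f))//.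
by rewrite (eq_measure_integral _ eqm).
Qed.

End random_variables.

Lemma bigcap_cons (U : Type) (I : eqType) (i : I) (s : seq I) (F : I -> set U) :
  \bigcap_(j in [set` i :: s]) F j = F i `&` \bigcap_(j in [set` s]) F j.
Proof.
rewrite -bigcap_setU1; congr (bigcap _ _); apply/seteqP; split=> j /=.
  by rewrite inE => /orP[/eqP ->|js]; [left|right].
by rewrite inE => -[->|->]; rewrite ?eqxx ?orbT.
Qed.

Lemma bigcap_nil (U : Type) (I : eqType) (F : I -> set U) :
  \bigcap_(j in [set` [::] : seq I]) F j = setT.
Proof. by apply/seteqP; split. Qed.

(** * Independence of linear combinations *)

Section independent_family.
Context d (T : measurableType d) (R : realType) (P : probability T R).
Context (I : eqType) (Y : I -> T -> R).
Hypothesis mY : forall i, measurable_fun setT (Y i).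
Hypothesis indY : mutually_independent_R P Y.

(** Independence from all events of finitely many variables outside [s]. Independence from single
    variables would not survive the induction that adds one variable at a time to a linear
    combination. *)
Definition indep_of (s : seq I) (U : T -> R) : Prop :=
  forall (s' : seq I) (B : I -> set R) (A : set R), uniq s' ->
    (forall i, i \in s' -> i \notin s) -> (forall i, measurable (B i)) ->
    measurable A ->
    P (U @^-1` A `&` \bigcap_(i in [set` s']) (Y i @^-1` B i)) =
      (P (U @^-1` A) * P (\bigcap_(i in [set` s']) (Y i @^-1` B i)))%E.

Let mbig (s : seq I) (B : I -> set R) : (forall i, measurable (B i)) ->
  measurable (\bigcap_(i in [set` s]) (Y i @^-1` B i)).
Proof.
move=> mB; apply: fin_bigcap_measurable => // i _; exact: preimage_measurable.
Qed.

Lemma indep_of_pair s U i : indep_of s U -> i \notin s ->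
  forall A B : set R, measurable A -> measurable B ->
    P (U @^-1` A `&` Y i @^-1` B) = (P (U @^-1` A) * P (Y i @^-1` B))%E.
Proof.
move=> iU si A B mA mB; have := iU [:: i] (fun=> B) A isT.
rewrite bigcap_cons bigcap_nil setIT; apply => //.
by move=> j; rewrite inE => /eqP ->.
Qed.

(** The remaining variables enter through one event [C], so [joint_event_indep] reduces the claim to
    rectangles in [U] and [Y i], where the hypothesis on [U] applies with the list [i :: s']. *)
Lemma indep_of_add s U i b : measurable_fun setT U -> indep_of s U ->
  i \notin s -> indep_of (i :: s) (fun w => U w + b * Y i w).
Proof.
move=> mU iU si s' B A us' s's mB mA.
set C := \bigcap_(_ in _) _.
have mC : measurable C by exact: mbig.
have PC : P C = (fine (P C))%:E by rewrite fineK//; exact: fin_num_measure.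
have s'i : i \notin s' by apply/negP => /s's; rewrite inE eqxx.
pose E : set (R * R) := [set z | A (z.1 + b * z.2)].
have mE : measurable E.
  rewrite -[E]setTI; apply: (_ : measurable_fun setT (fun z : R * R => z.1 + b * z.2)) => //.
  by apply: measurable_funD => //; exact: measurable_funM.
pose U' := MeasurableFun.Pack (MeasurableFun.Class
  (isMeasurableFun.Build _ _ _ _ _ mU)).
pose V' := MeasurableFun.Pack (MeasurableFun.Class
  (isMeasurableFun.Build _ _ _ _ _ (mY i))).
rewrite muleC PC.
apply: (@joint_event_indep _ _ _ P U' V' C (fine (P C)) E) => //; first exact: fine_ge0.
move=> A1 B1 mA1 mB1; rewrite -PC (indep_of_pair iU si)//.
pose B' j := if j == i then B1 else B j.
have BB : \bigcap_(j in [set` i :: s']) (Y j @^-1` B' j) = Y i @^-1` B1 `&` C.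
  rewrite bigcap_cons /B' eqxx; congr (_ `&` _).
  apply: eq_bigcapr => j /= js'; case: eqP => // ji.
  by move: s'i; rewrite -ji js'.
have mB' j : measurable (B' j) by rewrite /B'; case: ifP.
have := iU (i :: s') B' A1; rewrite BB setIA => ->//; last 2 first.
- by rewrite /= s'i us'.
- move=> j; rewrite inE => /orP[/eqP -> //|/s's]; rewrite inE negb_or => /andP[] //.
suff -> : P (Y i @^-1` B1 `&` C) = (P (Y i @^-1` B1) * P C)%E.
  by rewrite muleA muleC.
rewrite -BB (@indY (i :: s') B')//=; last by rewrite s'i us'.
rewrite big_cons {1}/B' eqxx; congr (_ * _)%E.
rewrite /C (@indY s' B)//; apply: eq_big_seq => j js'; rewrite /B'; case: eqP => // ji.
by move: s'i; rewrite -ji js'.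
Qed.

Lemma measurable_lincomb (s : seq I) (b : I -> R) :
  measurable_fun setT (fun w => \sum_(i <- s) b i * Y i w).
Proof. by apply: measurable_sum => i; exact: measurable_funM. Qed.

Lemma indep_of_lincomb (s : seq I) (b : I -> R) : uniq s ->
  indep_of s (fun w => \sum_(i <- s) b i * Y i w).
Proof.
elim: s => [_|i s IH /= /andP[sNi us]].
  move=> s' B A _ _ mB mA.
  have [A0|A0] := pselect (A 0).
    have -> : (fun w => \sum_(i <- [::]) b i * Y i w) @^-1` A = setT.
      by apply/seteqP; split=> // w _ /=; rewrite big_nil.
    by rewrite setTI probability_setT mul1e.
  have -> : (fun w => \sum_(i <- [::]) b i * Y i w) @^-1` A = set0.
    by apply/seteqP; split=> // w /=; rewrite big_nil.
  by rewrite set0I measure0 mul0e.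
have := indep_of_add (b i) (measurable_lincomb s b) (IH us) sNi.
by congr (indep_of _ _); apply/funext => w; rewrite big_cons addrC.
Qed.

End independent_family.

(** * Elementary inequalities *)

Section elementary_bounds.
Context (R : realType).
Implicit Types x y a b : R.

Lemma nneg_derive_ge (f df : R -> R) :
  (forall x, is_derive x 1 f (df x)) -> (forall x, 0 <= x -> 0 <= df x) ->
  forall x, 0 <= x -> f 0 <= f x.
Proof.
move=> fdf df0 x; rewrite le_eqVlt => /orP[/eqP <-//|x0].
have cf : continuous f.
  move=> y; apply: differentiable_continuous; apply/derivable1_diffP.
  by have [] := fdf y.
have [c] := @MVT _ f df _ _ x0 (fun y _ => fdf y) (continuous_subspaceT cf).
rewrite in_itv /= => /andP[c0 _] fE; rewrite -subr_ge0 fE subr0.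
by rewrite mulr_ge0 ?(ltW x0)// df0// ltW.
Qed.

Lemma sin_le_id x : 0 <= x -> sin x <= x.
Proof.
move=> x0; rewrite -subr_ge0.
have := @nneg_derive_ge (fun x => x - sin x) (fun x => 1 - cos x).
by rewrite sin0 subr0; apply=> // y y0; rewrite subr_ge0 cos_le1.
Qed.

Lemma norm_sin_le x : `|sin x| <= `|x|.
Proof.
suff key y : 0 <= y -> `|sin y| <= y.
  have [x0|x0] := leP 0 x; first by rewrite [leRHS]ger0_norm ?key.
  by rewrite -normrN -sinN [leRHS]ltr0_norm// key// oppr_ge0 ltW.
move=> y0; rewrite ler_norml sin_le_id// andbT -subr_ge0 opprK.
have := @nneg_derive_ge (fun x => sin x + x) (fun x => cos x + 1).
by rewrite sin0 addr0; apply=> // z z0; have := cos_geN1 z; lra.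
Qed.

(** By the half-angle formula this is the square of [|sin (x/2)| <= |x/2|]. *)
Lemma cos_lower_bound x : 1 - x ^+ 2 / 2 <= cos x.
Proof.
have xE : x = (x / 2) *+ 2 by rewrite -mulr_natr mulfVK.
rewrite [in leRHS]xE cos_mulr2n cos2sin2.
have : sin (x / 2) ^+ 2 <= (x / 2) ^+ 2.
  by rewrite -(real_normK (num_real (sin _))) -[leRHS](real_normK (num_real _))
    lerXn2r ?nnegrE// norm_sin_le.
by rewrite -mulr_natr; nra.
Qed.

Lemma sin_lower_bound x : 0 <= x -> x - x ^+ 3 / 6 <= sin x.
Proof.
move=> x0; rewrite -subr_ge0.
have := @nneg_derive_ge (fun x => sin x - (x - x ^+ 3 / 6))
  (fun x => cos x - (1 - x ^+ 2 / 2)).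
rewrite sin0 expr0n /= mul0r !subr0; apply=> //.
  move=> y; have -> : (fun x => sin x - (x - x ^+ 3 / 6)) =
            (fun x => sin x - (x - 6^-1 *: (x ^+ 3 : R))).
    by apply/funext => z; rewrite [_ / 6]mulrC.
  apply: is_derive_eq; rewrite /GRing.scale /= -mulr_natr. by field.
by move=> y y0; rewrite subr_ge0 cos_lower_bound.
Qed.

Lemma cos_upper_bound x : cos x <= 1 - x ^+ 2 / 2 + x ^+ 4 / 24.
Proof.
suff key y : 0 <= y -> cos y <= 1 - y ^+ 2 / 2 + y ^+ 4 / 24.
  have := key `|x| (normr_ge0 x).
  by rewrite cos_norm (exprM _ 2 2) real_normK ?num_real// -exprM.
move=> y0; have [z z0 ->] : exists2 z, 0 <= z & y = z *+ 2.
  by exists (y / 2); [rewrite divr_ge0|rewrite mulr2n; lra].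
rewrite cos_mulr2n cos2sin2.
suff : z ^+ 2 - z ^+ 4 / 3 <= sin z ^+ 2.
  have -> : z *+ 2 = 2 * z by rewrite mulr2n; ring.
  rewrite ![(2 * z) ^+ _]exprMn [(1 - _) *+ 2]mulr2n.
  move: (sin z ^+ 2) (z ^+ 2) (z ^+ 4) => s q r.
  by lra.
have s0 := sin_lower_bound z0.
(* Squaring the cubic bound on [sin z] needs that bound nonnegative, which holds up to 2; beyond 2
   the left-hand side [z^2 (1 - z^2/3)] is negative. *)
have [z2|z2] := leP z 2.
  have h0 : 0 <= z - z ^+ 3 / 6.
    have -> : z - z ^+ 3 / 6 = z * (1 - z ^+ 2 / 6) by field.
    have : 0 <= (2 - z) * (2 + z) by apply: mulr_ge0; lra.
    by move=> h; apply: mulr_ge0 => //; lra.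
  have : (z - z ^+ 3 / 6) ^+ 2 <= sin z ^+ 2 by rewrite lerXn2r ?nnegrE// (le_trans h0).
  apply: le_trans; rewrite -subr_ge0.
  have -> : (z - z ^+ 3 / 6) ^+ 2 - (z ^+ 2 - z ^+ 4 / 3) = (z ^+ 3 / 6) ^+ 2 by field.
  exact: sqr_ge0.
apply: (@le_trans _ _ 0); last exact: sqr_ge0.
have -> : z ^+ 2 - z ^+ 4 / 3 = z ^+ 2 * (1 - z ^+ 2 / 3) by field.
have : 0 <= (z - 2) * (2 + z) by apply: mulr_ge0; lra.
by move=> h; apply: mulr_ge0_le0; [exact: sqr_ge0|lra].
Qed.

(** Because [expR a >= 1 + a] and [(1 + a) (1 - a + a^2) = 1 + a^3 >= 1]. *)
Lemma expRN_upper_bound a : 0 <= a -> expR (- a) <= 1 - a + a ^+ 2.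
Proof.
move=> a0; rewrite expRN; have a1 : 0 < 1 + a by lra.
apply: (@le_trans _ _ ((1 + a)^-1)).
  by rewrite lef_pV2 ?posrE ?expR_gt0// expR_ge1Dx.
rewrite -[leLHS]mul1r ler_pdivrMr//.
by have := mulr_ge0 a0 (sqr_ge0 a); nra.
Qed.

Lemma expRN_dist a b : 0 <= a -> 0 <= b ->
  `|expR (- a) - expR (- b)| <= `|a - b|.
Proof.
wlog ab : a b / a <= b.
  move=> H a0 b0; have [ab|/ltW ba] := leP a b; first exact: H.
  by rewrite distrC [leRHS]distrC H.
move=> a0 b0; rewrite [leRHS]distrC !ger0_norm ?subr_ge0 ?ler_expR ?lerN2//.
have -> : expR (- b) = expR (- a) * expR (- (b - a)) by rewrite -expRD; congr expR; lra.
have h1 := expR_ge1Dx (- (b - a)).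
have h2 : expR (- a) <= 1 by rewrite expR_le1; lra.
have h3 := expR_ge0 (- a).
have h4 : expR (- a) * (1 + - (b - a)) <= expR (- a) * expR (- (b - a)).
  by rewrite ler_wpM2l.
by have := mulr_ge0 (_ : 0 <= 1 - expR (- a)) (_ : 0 <= b - a); nra.
Qed.

(** Factors are exchanged one at a time; those left in place have modulus at most 1. *)
Lemma norm_prodB_le (I : Type) (s : seq I) (f g : I -> R) :
  (forall i, `|f i| <= 1) -> (forall i, `|g i| <= 1) ->
  `|\prod_(i <- s) f i - \prod_(i <- s) g i| <= \sum_(i <- s) `|f i - g i|.
Proof.
move=> f1 g1; elim: s => [|i s IH]; first by rewrite !big_nil subrr normr0.
rewrite !big_cons; set F := \prod_(_ <- _) _ in IH *.
set G := \prod_(_ <- _) g _ in IH *.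
have F1 : `|F| <= 1.
  rewrite /F normr_prod; elim: (s) => [|j t ht]; first by rewrite big_nil.
  by rewrite big_cons mulr_ile1// prodr_ge0.
have -> : f i * F - g i * G = (f i - g i) * F + g i * (F - G) by ring.
apply: le_trans (ler_normD _ _) _; rewrite !normrM lerD//.
  by rewrite -[leRHS]mulr1 ler_wpM2l.
by apply: le_trans IH; rewrite -[leRHS]mul1r ler_wpM2r.
Qed.

Lemma norm_cosB_le x y : `|cos x - cos y| <= `|x - y|.
Proof.
have -> : cos x - cos y = - (2 * sin ((x + y) / 2) * sin ((x - y) / 2)).
  have sum_to_prod u v : cos (u + v) - cos (u - v) = - (2 * sin u * sin v).
    by rewrite cosD cosB; ring.
  rewrite -sum_to_prod; congr (cos _ - cos _); lra.
rewrite normrN !normrM ger0_norm//.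
have h1 := sin_max ((x + y) / 2); have h2 := norm_sin_le ((x - y) / 2).
rewrite normrM [`|2^-1|]ger0_norm// in h2.
apply: (@le_trans _ _ (2 * (1 * (`|x - y| / 2)))); last by lra.
by rewrite -mulrA ler_wpM2l// ler_pM.
Qed.

Lemma norm_sinB_le x y : `|sin x - sin y| <= `|x - y|.
Proof.
have sE z : sin z = cos (z - pi / 2) by rewrite cosBpihalf.
by rewrite !sE (le_trans (norm_cosB_le _ _))// opprB addrA subrK.
Qed.

End elementary_bounds.

(** * Symmetric i.i.d. sceneries *)

Section symmetric_iid.
Context d (T : measurableType d) (R : realType) (P : probability T R).
Context (I : eqType) (Y : I -> T -> R) (i0 : I).
Hypothesis iidY : iid_R P Y i0.
Hypothesis symY : forall B : set R, measurable B ->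
  P (Y i0 @^-1` B) = P ((fun w => - Y i0 w) @^-1` B).
Hypothesis momY : forall k : nat, (1 <= k)%N ->
  P.-integrable setT (fun w => (`|Y i0 w| ^+ k)%:E).
Hypothesis varY : (\int[P]_w (Y i0 w ^+ 2)%:E = 1)%E.

Let mY i : measurable_fun setT (Y i).
Proof. by have [+ _ _] := iidY; exact. Qed.

Let indY : mutually_independent_R P Y.
Proof. by have [] := iidY. Qed.

Definition moment (k : nat) : R := Ex P (fun w => Y i0 w ^+ k).

Definition charf (b : R) : R := Ex P (fun w => cos (b * Y i0 w)).

Lemma Ex_identical i (f : R -> R) : measurable_fun setT f ->
  intble P (fun w => f (Y i0 w)) ->
  intble P (fun w => f (Y i w)) /\
  Ex P (fun w => f (Y i w)) = Ex P (fun w => f (Y i0 w)).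
Proof.
by have [_ _ eY] := iidY => mf fi; apply: (eq_law_Ex (mY i) (mY i0)) => //; exact: eY.
Qed.

Lemma Ex_odd i (f : R -> R) : measurable_fun setT f ->
  (forall x, f (- x) = - f x) ->
  intble P (fun w => f (Y i0 w)) -> Ex P (fun w => f (Y i w)) = 0.
Proof.
move=> mf fN fi; rewrite (Ex_identical i mf fi).2.
have mN : measurable_fun setT (fun w => - Y i0 w) by exact: measurable_funN.
have e : Ex P (fun w => f (- Y i0 w)) = Ex P (fun w => f (Y i0 w)).
  by apply: (eq_law_Ex mN (mY i0) _ mf fi).2 => B mB; rewrite symY.
have : Ex P (fun w => f (- Y i0 w)) = -1 * Ex P (fun w => f (Y i0 w)).
  by rewrite -ExZ//; apply: eq_Ex => w; rewrite fN mulN1r.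
by rewrite e; lra.
Qed.

Lemma intble_power i k : intble P (fun w => Y i w ^+ k).
Proof.
have mX : measurable_fun setT (fun x : R => x ^+ k) by exact: measurable_funX.
apply: (Ex_identical i mX _).1.
case: k mX => [|k] mX; first by rewrite (_ : (fun w => _) = (fun=> 1)) //; exact: intble_cst.
apply: (intble_le _ _ (momY (ltn0Sn k))).
  exact: measurable_funX.
by move=> w; rewrite normrX.
Qed.

Lemma Ex_power i k : Ex P (fun w => Y i w ^+ k) = moment k.
Proof.
apply: (@Ex_identical i (fun x => x ^+ k) _ _).2; first exact: measurable_funX.
exact: intble_power.
Qed.

Lemma moment_odd k : odd k -> moment k = 0.
Proof.
move=> ok; apply: (@Ex_odd i0 (fun x => x ^+ k)).
- exact: measurable_funX.
- by move=> x; rewrite exprNn -signr_odd ok expr1 mulN1r.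
- exact: intble_power.
Qed.

Lemma moment_even_ge0 k : 0 <= moment k.*2.
Proof. by apply: Ex_ge0 => w; rewrite -mul2n exprM exprn_ge0// sqr_ge0. Qed.

Lemma moment_ge0 k : 0 <= moment k.
Proof.
have [ok|ek] := boolP (odd k); first by rewrite moment_odd.
by rewrite -[k]odd_double_half (negbTE ek) moment_even_ge0.
Qed.

Lemma moment2 : moment 2 = 1.
Proof. by rewrite /moment /Ex varY. Qed.

Lemma measurable_cosM b : measurable_fun setT (fun x : R => cos (b * x)).
Proof.
apply: (measurableT_comp (continuous_measurable_fun (@continuous_cos R))).
exact: measurable_funM.
Qed.

Lemma measurable_sinM b : measurable_fun setT (fun x : R => sin (b * x)).
Proof.
apply: (measurableT_comp (continuous_measurable_fun (@continuous_sin R))).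
exact: measurable_funM.
Qed.

Lemma intble_cosM b (U : T -> R) : measurable_fun setT U ->
  intble P (fun w => cos (b * U w)).
Proof.
move=> mU; apply: (@intble_bounded _ _ _ _ _ 1).
  exact: (measurableT_comp (measurable_cosM b)).
by move=> w; rewrite cos_max.
Qed.

Lemma intble_sinM b (U : T -> R) : measurable_fun setT U ->
  intble P (fun w => sin (b * U w)).
Proof.
move=> mU; apply: (@intble_bounded _ _ _ _ _ 1).
  exact: (measurableT_comp (measurable_sinM b)).
by move=> w; rewrite sin_max.
Qed.

Lemma norm_charf_le1 b : `|charf b| <= 1.
Proof.
apply: norm_Ex_bounded; last by move=> w; exact: cos_max.
exact: (measurableT_comp (measurable_cosM b)).
Qed.

(** Both terms are [1 - b^2/2] up to a multiple of [b^4]: the cosine by its Taylor bounds and the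
    unit variance, the exponential by [expRN_upper_bound]. *)
Lemma charf_gauss b :
  `|charf b - expR (- (b ^+ 2 / 2))| <= (moment 4 + 1) * b ^+ 4.
Proof.
have i2 : intble P (fun w => 1 - b ^+ 2 / 2 * Y i0 w ^+ 2).
  by apply: intbleB; [exact: intble_cst|apply: intbleZ; exact: intble_power].
have i4 : intble P (fun w => b ^+ 4 / 24 * Y i0 w ^+ 4).
  by apply: intbleZ; exact: intble_power.
have h1 : `|charf b - (1 - b ^+ 2 / 2)| <= b ^+ 4 / 24 * moment 4.
  have -> : 1 - b ^+ 2 / 2 = Ex P (fun w => 1 - b ^+ 2 / 2 * Y i0 w ^+ 2).
    rewrite ExB ?Ex_cst ?ExZ -/(moment 2) ?moment2 ?mulr1//.
    - exact: intble_power.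
    - exact: intble_cst.
    - by apply: intbleZ; exact: intble_power.
  rewrite -ExB//; last exact: intble_cosM.
  rewrite -ExZ; last exact: intble_power.
  apply: norm_Ex_le => //; first by apply: intbleB => //; exact: intble_cosM.
  move=> w; have := cos_lower_bound (b * Y i0 w); have := cos_upper_bound (b * Y i0 w).
  rewrite !exprMn ler_norml => h2 h3; apply/andP; split; last by lra.
  by have : 0 <= b ^+ 4 * Y i0 w ^+ 4;
    [rewrite -exprMn (exprM _ 2 2) sqr_ge0|lra].
have b0 : 0 <= b ^+ 2 / 2 by rewrite divr_ge0// sqr_ge0.
have h2 := expRN_upper_bound b0; have h3 := expR_ge1Dx (- (b ^+ 2 / 2)).
have m4 := moment_ge0 4; have b4 : 0 <= b ^+ 4 by rewrite (exprM _ 2 2) sqr_ge0.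
have mb4 := mulr_ge0 m4 b4.
move: h1 h2 h3; rewrite exprMn -exprM !ler_norml => /andP[h1 h1'] h2 h3.
by apply/andP; split; nra.
Qed.

(** The characteristic function of a sum of independent variables, with cosine and sine carried
    together because the addition formula for each calls for both. The terms with
    [sin (b i * Y i w)] vanish by symmetry. *)
Lemma Ex_cos_sin_sum (s : seq I) (b : I -> R) : uniq s ->
  Ex P (fun w => cos (\sum_(i <- s) b i * Y i w)) = \prod_(i <- s) charf (b i) /\
  Ex P (fun w => sin (\sum_(i <- s) b i * Y i w)) = 0.
Proof.
elim: s => [_|i s IH /= /andP[sNi us]].
  rewrite big_nil; split.
    by rewrite -[RHS](Ex_cst P 1); apply: eq_Ex => w; rewrite big_nil cos0.
  by rewrite -[RHS](Ex_cst P 0); apply: eq_Ex => w; rewrite big_nil sin0.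
have [IHc IHs] := IH us.
set U := fun w => \sum_(i <- s) b i * Y i w.
have mU : measurable_fun setT U by exact: measurable_lincomb.
have ind := indep_of_pair (indep_of_lincomb mY indY b us) sNi.
have mc : measurable_fun setT (@cos R) by exact: (continuous_measurable_fun (@continuous_cos R)).
have ms : measurable_fun setT (@sin R) by exact: (continuous_measurable_fun (@continuous_sin R)).
have ic : intble P (cos \o U).
  by apply: (intble_bounded P (measurableT_comp mc mU)) => w; exact: cos_max.
have iS : intble P (sin \o U).
  by apply: (intble_bounded P (measurableT_comp ms mU)) => w; exact: sin_max.
have mcb := measurable_cosM (b i); have msb := measurable_sinM (b i).
have icb := intble_cosM (b i) (mY i); have isb := intble_sinM (b i) (mY i).
have [icc Ecc] := intble_ExM mU (mY i) ind mc mcb ic icb.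
have [iss Ess] := intble_ExM mU (mY i) ind ms msb iS isb.
have [ics Ecs] := intble_ExM mU (mY i) ind mc msb ic isb.
have [isc Esc] := intble_ExM mU (mY i) ind ms mcb iS icb.
have s0 : Ex P (fun w => sin (b i * Y i w)) = 0.
  apply: (@Ex_odd i (fun x => sin (b i * x))) => //.
    by move=> x; rewrite mulrN sinN.
  exact: intble_sinM.
have c0 : Ex P (fun w => cos (b i * Y i w)) = charf (b i).
  by apply: (@Ex_identical i (fun x => cos (b i * x)) _ _).2 => //; exact: intble_cosM.
split.
  rewrite big_cons -IHc mulrC -c0.
  rewrite (@eq_Ex _ _ _ _ _ (fun w => cos (U w) * cos (b i * Y i w) - sin (U w) * sin (b i * Y i w))).
    by rewrite ExB// Ecc Ess s0 mulr0 subr0.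
  by move=> w; rewrite big_cons addrC cosD.
rewrite (@eq_Ex _ _ _ _ _ (fun w => sin (U w) * cos (b i * Y i w) + cos (U w) * sin (b i * Y i w))).
  by rewrite ExD// Esc Ecs s0 mulr0 [Ex P _]IHs mul0r addr0.
by move=> w; rewrite big_cons addrC sinD.
Qed.

Lemma Ex_cos_sum_gauss (s : seq I) (b : I -> R) : uniq s ->
  `|Ex P (fun w => cos (\sum_(i <- s) b i * Y i w))
    - expR (- ((\sum_(i <- s) b i ^+ 2) / 2))|
  <= (moment 4 + 1) * \sum_(i <- s) b i ^+ 4.
Proof.
move=> us; rewrite (Ex_cos_sin_sum b us).1.
have -> : expR (- ((\sum_(i <- s) b i ^+ 2) / 2)) =
          \prod_(i <- s) expR (- (b i ^+ 2 / 2)).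
  by rewrite -expR_sum sumrN mulr_suml.
apply: le_trans (norm_prodB_le _ _ _) _.
- by move=> i; exact: norm_charf_le1.
- by move=> i; rewrite ger0_norm ?expR_ge0// expR_le1 oppr_le0 divr_ge0// sqr_ge0.
- by rewrite mulr_sumr; apply: ler_sum => i _; exact: charf_gauss.
Qed.

Lemma lincomb_power (s : seq I) (b : I -> R) k : uniq s ->
  intble P (fun w => (\sum_(i <- s) b i * Y i w) ^+ k).
Proof.
elim: s k => [k _|i s IH k /= /andP[sNi us]].
  rewrite (_ : (fun w => _) = (fun=> 0 ^+ k)); first exact: intble_cst.
  by apply/funext => w; rewrite big_nil.
set U := fun w => \sum_(i <- s) b i * Y i w.
have mU : measurable_fun setT U by exact: measurable_lincomb.
have ind := indep_of_pair (indep_of_lincomb mY indY b us) sNi.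
rewrite (_ : (fun w => _) = fun w => \sum_(j < k.+1)
    ('C(k, j)%:R * b i ^+ j) * (U w ^+ (k - j) * Y i w ^+ j)); last first.
  apply/funext => w; rewrite big_cons addrC exprDn; apply: eq_bigr => j _.
  by rewrite exprMn -mulr_natl; ring.
apply: intble_sum => j _; apply: intbleZ.
exact: (intble_ExM mU (mY i) ind (measurable_funX (k - j) (@measurable_id _ _ setT))
  (measurable_funX j (@measurable_id _ _ setT)) (IH (k - j)%N us) (intble_power i j)).1.
Qed.

Lemma Ex_lincomb_power_cons i (s : seq I) (b : I -> R) k : uniq s -> i \notin s ->
  Ex P (fun w => (\sum_(i <- i :: s) b i * Y i w) ^+ k) =
  \sum_(j < k.+1) ('C(k, j)%:R * b i ^+ j) *
    (Ex P (fun w => (\sum_(i <- s) b i * Y i w) ^+ (k - j)) * moment j).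
Proof.
move=> us sNi; set U := fun w => \sum_(i <- s) b i * Y i w.
have mU : measurable_fun setT U by exact: measurable_lincomb.
have ind := indep_of_pair (indep_of_lincomb mY indY b us) sNi.
have key j := intble_ExM mU (mY i) ind (measurable_funX (k - j) (@measurable_id _ _ setT))
  (measurable_funX j (@measurable_id _ _ setT))
  (lincomb_power b (k - j) us) (intble_power i j).
rewrite (@eq_Ex _ _ _ P _ (fun w => \sum_(j < k.+1)
    ('C(k, j)%:R * b i ^+ j) * (U w ^+ (k - j) * Y i w ^+ j))); last first.
  move=> w; rewrite big_cons addrC exprDn; apply: eq_bigr => j _.
  by rewrite exprMn -mulr_natl; ring.
rewrite Ex_sum; last by move=> j _; apply: intbleZ; exact: (key j).1.
apply: eq_bigr => j _; rewrite ExZ; last exact: (key j).1.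
by rewrite -(Ex_power i); congr (_ * _); exact: (key j).2.
Qed.

Lemma Ex_lincomb_sqr (s : seq I) (b : I -> R) : uniq s ->
  Ex P (fun w => (\sum_(i <- s) b i * Y i w) ^+ 2) = \sum_(i <- s) b i ^+ 2.
Proof.
elim: s => [_|i s IH /= /andP[sNi us]].
  rewrite big_nil (@eq_Ex _ _ _ P _ (fun=> 0)) ?Ex_cst//.
  by move=> w; rewrite big_nil expr0n.
rewrite Ex_lincomb_power_cons// big_cons !big_ord_recl big_ord0 /= /bump /=.
rewrite (@moment_odd 1)// moment2 IH// subnn.
rewrite (@eq_Ex _ _ _ P (fun w => _ ^+ 0) (fun=> 1)) ?Ex_cst//.
have -> : moment 0 = 1 by rewrite /moment (@eq_Ex _ _ _ P _ (fun=> 1)) ?Ex_cst.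
by rewrite bin0 binn; ring.
Qed.

(** When a variable joins the list, the binomial formula expands the power [2(p+1)]: odd moments
    vanish, the leading term is the same moment of the shorter list, and every other term has a
    lower power, hence is [O(N^p)] by induction. Each variable thus adds [O(N^p)]. All [q <= p] are
    kept in the statement because all the lower even powers occur. *)
Lemma lincomb_moment_le p : exists2 C : R, 0 <= C & forall (q : nat) (s : seq I) (b : I -> R),
  (q <= p)%N -> uniq s -> (forall i, `|b i| <= 1) ->
  Ex P (fun w => (\sum_(i <- s) b i * Y i w) ^+ q.*2) <= C * (size s)%:R ^+ q.
Proof.
elim: p => [|p [C C0 IH]].
  exists 1 => // q s b; rewrite leqn0 => /eqP -> us b1.
  by rewrite (@eq_Ex _ _ _ P _ (fun=> 1)) ?Ex_cst ?expr0 ?mulr1.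
pose D := C * \sum_(j < p.+1.*2.+1) 'C(p.+1.*2, j)%:R * moment j.
have D0 : 0 <= D.
  by rewrite mulr_ge0// sumr_ge0// => j _; rewrite mulr_ge0 ?moment_ge0.
exists (C + D); first exact: addr_ge0.
move=> q s b; rewrite leq_eqVlt => /orP[/eqP -> us b1|]; last first.
  rewrite ltnS => qp us b1; apply: le_trans (IH q s b qp us b1) _.
  by rewrite ler_wpM2r ?exprn_ge0// lerDl.
apply: (@le_trans _ _ (D * (size s)%:R ^+ p.+1)); last first.
  by rewrite ler_wpM2r ?exprn_ge0// lerDr.
elim: s us => [_|i s IHs /= /andP[sNi us]].
  rewrite (@eq_Ex _ _ _ P _ (fun=> 0)) ?Ex_cst ?expr0n ?mulr0//.
  by move=> w; rewrite big_nil doubleS exprS mul0r.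
rewrite Ex_lincomb_power_cons// big_ord_recl /= subn0 expr0 bin0 !mul1r.
have -> : moment 0 = 1 by rewrite /moment (@eq_Ex _ _ _ P _ (fun=> 1)) ?Ex_cst.
rewrite mulr1.
set N := size s.
have step : \sum_(j < p.+1.*2) 'C(p.+1.*2, bump 0 j)%:R * b i ^+ bump 0 j *
    (Ex P (fun w => (\sum_(i <- s) b i * Y i w) ^+ (p.+1.*2 - bump 0 j)) *
     moment (bump 0 j)) <= D * N.+1%:R ^+ p.
  have -> : D * N.+1%:R ^+ p = \sum_(j < p.+1.*2.+1)
      'C(p.+1.*2, j)%:R * (C * N.+1%:R ^+ p * moment j).
    by rewrite /D mulrAC mulr_sumr; apply: eq_bigr => j _; ring.
  rewrite [leRHS]big_ord_recl /= -[leLHS]add0r lerD//.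
    by rewrite !mulr_ge0 ?exprn_ge0 ?moment_ge0.
  apply: ler_sum => j _; rewrite /bump leq0n add1n.
  have [oj|] := boolP (odd j.+1); first by rewrite moment_odd// !mulr0.
  move=> ej; have := odd_double_half j.+1; rewrite (negbTE ej) add0n.
  have := ltn_ord j; set l := j.+1; set h := l./2 => lp hl.
  have h1 : (0 < h)%N by rewrite half_gt0; move: hl; rewrite /l; lia.
  have hp : (h <= p.+1)%N by move: lp; rewrite -hl; lia.
  rewrite -mulrA ler_wpM2l//.
  have bl0 : 0 <= b i ^+ l by rewrite -hl -mul2n exprM exprn_ge0// sqr_ge0.
  have bl1 : b i ^+ l <= 1 by rewrite -(ger0_norm bl0) normrX exprn_ile1.
  have -> : (p.+1.*2 - l)%N = (p.+1 - h).*2 by rewrite -hl doubleB.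
  rewrite mulrA ler_wpM2r ?moment_ge0//.
  have E0 : 0 <= Ex P (fun w => (\sum_(i <- s) b i * Y i w) ^+ (p.+1 - h).*2).
    by apply: Ex_ge0 => w; rewrite -mul2n exprM exprn_ge0// sqr_ge0.
  apply: (@le_trans _ _ (Ex P (fun w => (\sum_(i <- s) b i * Y i w) ^+ (p.+1 - h).*2))).
    by rewrite -[leRHS]mul1r ler_wpM2r.
  apply: le_trans (IH _ s b _ us b1) _; first by lia.
  rewrite ler_wpM2l// (@le_trans _ _ (N.+1%:R ^+ (p.+1 - h)))//.
    by rewrite lerXn2r ?nnegrE// ler_nat.
  by rewrite ler_weXn2l ?ler1n//; lia.
apply: le_trans (lerD (IHs us) step) _.
rewrite -mulrDr ler_wpM2l// [leRHS]exprS -natr1 mulrDl mul1r lerD2r -/N exprS.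
by rewrite ler_wpM2l// lerXn2r ?nnegrE// ?addr_ge0// lerDl.
Qed.

End symmetric_iid.

(** * Renewal sequences *)

Lemma sum_ord_le (R : numDomainType) (F : nat -> R) (a b : nat) :
  (forall k, 0 <= F k) -> (a <= b)%N -> \sum_(k < a) F k <= \sum_(k < b) F k.
Proof.
by move=> F0 ab; rewrite -(subnKC ab) big_split_ord /= lerDl sumr_ge0.
Qed.

(** Cauchy-Schwarz with weights, by induction on [n]: the new cross term is absorbed by
    [(S d - A)^2 >= 0], and when [S = 0] also [A = 0]. *)
Lemma sum_weighted_sqr_le (R : realFieldType) (n : nat) (r x : nat -> R) :
  (forall k, 0 <= r k) ->
  (\sum_(k < n) r k * x k) ^+ 2 <=
  (\sum_(k < n) r k) * \sum_(k < n) r k * x k ^+ 2.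
Proof.
move=> r0; elim: n => [|n IH]; first by rewrite !big_ord0 mulr0 expr0n.
rewrite !big_ord_recr /=; have := r0 n; move: IH.
have : 0 <= \sum_(k < n) r k by exact: sumr_ge0.
have : 0 <= \sum_(k < n) r k * x k ^+ 2.
  by apply: sumr_ge0 => k _; rewrite mulr_ge0// sqr_ge0.
move: (\sum_(k < n) r k * x k) (\sum_(k < n) r k) (\sum_(k < n) r k * x k ^+ 2).
move=> A S Q Q0 S0 AQ rn0; move: (r n) (x n) rn0 => a d a0.
have key : 2 * A * d <= S * d ^+ 2 + Q.
  move: S0; rewrite le_eqVlt => /orP[/eqP S0|S0].
    have : A ^+ 2 <= 0 by rewrite (le_trans AQ)// -S0 mul0r.
    rewrite -S0 mul0r add0r => A2; have /eqP -> : A == 0.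
      by rewrite -sqrf_eq0 eq_le A2 sqr_ge0.
    by rewrite mulr0 mul0r.
  rewrite -(ler_pM2l S0); have := sqr_ge0 (S * d - A).
  by rewrite -subr_ge0 => h; rewrite -subr_ge0; move: AQ h; nra.
have -> : (A + a * d) ^+ 2 = A ^+ 2 + a * (2 * A * d) + a ^+ 2 * d ^+ 2 by ring.
have -> : (S + a) * (Q + a * d ^+ 2) =
  S * Q + a * (S * d ^+ 2 + Q) + a ^+ 2 * d ^+ 2 by ring.
by rewrite lerD2r lerD// ler_wpM2l.
Qed.

Section renewal_sequence.
Context (R : realType) (f u : nat -> R) (m M2 : R).
Hypothesis f_ge0 : forall k, 0 <= f k.
Hypothesis u0 : u 0 = 1.
Hypothesis uS : forall n, u n.+1 = \sum_(k < n.+1) f k.+1 * u (n - k)%N.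
Hypothesis f_aperiodic : forall p : nat, (forall k, 0 < f k -> (p %| k)%N) -> p = 1%N.

(* For steps of law [f] and mean [m], [tail k] is the probability that a step exceeds [k] and
   [tail2 n] is the sum of [tail k] over [k > n]. *)
Definition tail (k : nat) : R := 1 - \sum_(j < k) f j.+1.
Definition tail2 (n : nat) : R := m - \sum_(k < n.+1) tail k.

Hypothesis tail_ge0 : forall k, 0 <= tail k.
Hypothesis tail2_ge0 : forall n, 0 <= tail2 n.
Hypothesis sum_tail : forall N, \sum_(k < N) k%:R * tail k <= M2.
Hypothesis sum_tail2 : forall N, \sum_(n < N) tail2 n <= M2.

Lemma tailS k : tail k.+1 = tail k - f k.+1.
Proof. by rewrite /tail big_ord_recr /= opprD addrA. Qed.

(** Summation by parts, [f k.+1] being the drop of [tail] from [k] to [k.+1]. It is used for [w = u]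
    in the renewal identity and for [w = u^2] in the energy bound. *)
Lemma tail_convS (w : nat -> R) n :
  \sum_(k < n.+2) tail k * w (n.+1 - k)%N =
  \sum_(k < n.+1) tail k * w (n - k)%N + w n.+1
  - \sum_(k < n.+1) f k.+1 * w (n - k)%N.
Proof.
rewrite big_ord_recl /= subn0 {1}/tail big_ord0 subr0 mul1r.
rewrite [in RHS]addrAC -sumrB addrC; congr (_ + _); apply: eq_bigr => k _.
by rewrite /bump leq0n add1n subSS tailS mulrBl.
Qed.

(** Each term is the probability that the last renewal up to [n] is at [n - k]: a visit there
    followed by a step longer than [k]. *)
Lemma renewal_tail n : \sum_(k < n.+1) tail k * u (n - k)%N = 1.
Proof.
elim: n => [|n IH]; last by rewrite tail_convS IH uS; lra.
by rewrite big_ord_recl big_ord0 /tail big_ord0 subr0 mul1r addr0 u0.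
Qed.

Lemma renewal_bounds n : 0 <= u n <= 1.
Proof.
elim/ltn_ind: n => -[|n] IH; first by rewrite u0 ler01 lexx.
rewrite uS; apply/andP; split.
  by apply: sumr_ge0 => k _; rewrite mulr_ge0//; have /andP[] := IH _ (leq_subr k n : (_ < n.+1)%N).
apply: (@le_trans _ _ (\sum_(k < n.+1) f k.+1)).
  apply: ler_sum => k _; rewrite -[leRHS]mulr1 ler_wpM2l//.
  by have /andP[] := IH _ (leq_subr k n : (_ < n.+1)%N).
by have := tail_ge0 n.+1; rewrite /tail; lra.
Qed.

Let u_ge0 n : 0 <= u n. Proof. by have /andP[] := renewal_bounds n. Qed.
Let u_le1 n : u n <= 1. Proof. by have /andP[] := renewal_bounds n. Qed.

(** The weighted sum [g] starts at 1, stays nonnegative and, by the renewal equation, loses at each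
    step at least the inner sum. *)
Lemma renewal_energy N :
  \sum_(n < N) \sum_(k < n.+1) f k.+1 * (u n.+1 - u (n - k)%N) ^+ 2 <= 1.
Proof.
pose g n := \sum_(k < n.+1) tail k * u (n - k)%N ^+ 2.
suff : \sum_(n < N) \sum_(k < n.+1) f k.+1 * (u n.+1 - u (n - k)%N) ^+ 2 <= 1 - g N.
  move/le_trans; apply; rewrite lerBlDr lerDl sumr_ge0// => k _.
  by rewrite mulr_ge0// sqr_ge0.
elim: N => [|N IH].
  by rewrite big_ord0 /g big_ord_recl big_ord0 /tail big_ord0 u0; lra.
rewrite big_ord_recr /=; have := tail_convS (fun n => u n ^+ 2) N.
rewrite -/(g N) -/(g N.+1) => gS.
have -> : \sum_(k < N.+1) f k.+1 * (u N.+1 - u (N - k)%N) ^+ 2 =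
  u N.+1 ^+ 2 * \sum_(k < N.+1) f k.+1 - 2 * u N.+1 * \sum_(k < N.+1) f k.+1 * u (N - k)%N
  + \sum_(k < N.+1) f k.+1 * u (N - k)%N ^+ 2.
  by rewrite !mulr_sumr -sumrB -big_split /=; apply: eq_bigr => k _; ring.
rewrite -uS; have F1 := tail_ge0 N.+1; rewrite /tail in F1.
have : u N.+1 ^+ 2 * \sum_(k < N.+1) f k.+1 <= u N.+1 ^+ 2.
  by rewrite -[leRHS]mulr1 ler_wpM2l ?sqr_ge0//; lra.
by move: IH gS; rewrite -mulrA -expr2; lra.
Qed.

(** The translate of [u] by [k], with [u] extended by 0 to negative indices, where truncated
    subtraction alone would give [u 0]. *)
Let v n k := if (k <= n)%N then u (n - k)%N else 0.

Lemma v_bounds n k : 0 <= v n k <= 1.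
Proof. by rewrite /v; case: ifP => _; rewrite ?u_ge0 ?u_le1 ?lexx ?ler01. Qed.

(* The shifts [k] for which [u - u(. - k)] is square summable contain the support of [f] and
   are closed under addition and subtraction, hence [1] is one of them by aperiodicity. *)
Let l2_shift k := exists D, forall N, \sum_(n < N) (u n - v n k) ^+ 2 <= D.

Lemma sum_shift_le (F : nat -> R) a N : (forall n, 0 <= F n) ->
  \sum_(n < N) (if (a <= n)%N then F (n - a)%N else 0) <= \sum_(n < N) F n.
Proof.
move=> F0; suff -> : \sum_(n < N) (if (a <= n)%N then F (n - a)%N else 0) =
    \sum_(n < N - a) F n.
  have [aN|aN] := leqP a N; last by rewrite (eqP (ltnW aN)) big_ord0 sumr_ge0.
  rewrite -[in leRHS](subnK aN) big_split_ord /= lerDl; exact: sumr_ge0.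
elim: N => [|N IH]; first by rewrite sub0n !big_ord0.
rewrite big_ord_recr /= IH; case: leqP => aN; last by rewrite addr0 !(eqP aN) (eqP (ltnW aN)).
by rewrite subSn// big_ord_recr.
Qed.

Lemma diff_sqr_le1 n k : (u n - v n k) ^+ 2 <= 1.
Proof.
have := u_ge0 n; have := u_le1 n; have /andP[] := v_bounds n k.
move: (u n) (v n k) => x y *.
rewrite -(expr1n _ 2) -[leLHS]real_normK ?num_real// lerXn2r ?nnegrE//.
by rewrite ler_norml; apply/andP; split; lra.
Qed.

Lemma sqrD_le2 (a b : R) : (a + b) ^+ 2 <= 2 * a ^+ 2 + 2 * b ^+ 2.
Proof. by have := sqr_ge0 (a - b); nra. Qed.

Lemma l2_shift_support k : 0 < f k.+1 -> l2_shift k.+1.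
Proof.
(* The bound counts 1 for the index 0, at most 1 for each of the next [k] indices, which the shift
   makes negative, and for the rest the energy, in which [f k.+1] weighs this very increment. *)
move=> fk; exists (1 + (k%:R + (f k.+1)^-1)) => -[|N].
  by rewrite big_ord0 !addr_ge0// invr_ge0 ltW.
rewrite big_ord_recl lerD//=; first exact: diff_sqr_le1.
have step n : (u (bump 0 n) - v (bump 0 n) k.+1) ^+ 2 <=
  (n < k)%:R + (f k.+1)^-1 * \sum_(j < n.+1) f j.+1 * (u n.+1 - u (n - j)%N) ^+ 2.
  have T0 (j : 'I_n.+1) : 0 <= f j.+1 * (u n.+1 - u (n - j)%N) ^+ 2.
    by rewrite mulr_ge0// sqr_ge0.
  have [nk|kn] := ltnP n k.
    apply: le_trans (diff_sqr_le1 _ _) _; rewrite lerDl mulr_ge0 ?invr_ge0//.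
    exact: sumr_ge0.
  rewrite add0r mulrC ler_pdivlMr// /bump leq0n add1n /v ltnS kn subSS mulrC.
  by rewrite (bigD1 (Ordinal (kn : (k < n.+1)%N)))//= lerDl sumr_ge0.
apply: (@le_trans _ _ (\sum_(n < N) ((n < k)%:R + (f k.+1)^-1 *
    \sum_(j < n.+1) f j.+1 * (u n.+1 - u (n - j)%N) ^+ 2))).
  by apply: ler_sum => n _; exact: step.
rewrite big_split /= lerD//.
  apply: (@le_trans _ _ (\sum_(n < k + N) (n < k)%:R)).
    by rewrite addnC big_split_ord /= lerDl sumr_ge0.
  rewrite big_split_ord /= [X in _ + X]big1 ?addr0; last first.
    by move=> n _; rewrite ltnNge leq_addr.
  rewrite (eq_bigr (fun=> 1)); last by move=> n _; rewrite ltn_ord.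
  by rewrite sumr_const card_ord.
by rewrite -mulr_sumr -[leRHS]mulr1 ler_wpM2l ?renewal_energy// invr_ge0 ltW.
Qed.

Lemma l2_shiftD a b : l2_shift a -> l2_shift b -> l2_shift (a + b).
Proof.
move=> [Da hA] [Db hB]; exists (2 * Da + 2 * Db) => N.
apply: (@le_trans _ _ (\sum_(n < N) (2 * (u n - v n a) ^+ 2 +
  2 * (if (a <= n)%N then (u (n - a)%N - v (n - a)%N b) ^+ 2 else 0)))).
  apply: ler_sum => n _; have -> : u n - v n (a + b) =
    (u n - v n a) + (v n a - v n (a + b)) by ring.
  apply: le_trans (sqrD_le2 _ _) _; rewrite lerD2l ler_wpM2l// /v.
  case: (leqP a n) => an; last by rewrite leqNgt (leq_trans an (leq_addr _ _)) subr0 expr0n.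
  by rewrite leq_subRL// subnDA.
rewrite big_split /= -!mulr_sumr lerD// ler_wpM2l//; first exact: hA.
exact: le_trans (sum_shift_le a N (fun n => sqr_ge0 (u n - v n b))) (hB N).
Qed.

(** The increment over [c] at [n] is read off at [b + n], as the difference of the increments over
    [b + c] and over [b]. *)
Lemma l2_shiftB b c : l2_shift (b + c) -> l2_shift b -> l2_shift c.
Proof.
move=> [Da hA] [Db hB]; exists (2 * Db + 2 * Da) => N.
have sh (G : nat -> R) D : (forall n, 0 <= G n) -> (forall N, \sum_(n < N) G n <= D) ->
    \sum_(n < N) G (b + n)%N <= D.
  move=> G0 hG; apply: le_trans (hG (b + N)%N).
  by rewrite big_split_ord /= lerDr sumr_ge0.
have hA' := sh _ _ (fun n => sqr_ge0 (u n - v n (b + c))) hA.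
have hB' := sh _ _ (fun n => sqr_ge0 (u n - v n b)) hB.
apply: (@le_trans _ _ (\sum_(n < N) (2 * (u (b + n)%N - v (b + n)%N b) ^+ 2 +
   2 * (u (b + n)%N - v (b + n)%N (b + c)%N) ^+ 2))).
  apply: ler_sum => n _; rewrite /v leq_addr addKn leq_add2l subnDl -/(v n c).
  rewrite -[(u (b + n)%N - u n) ^+ 2]sqrrN.
  by rewrite (le_trans _ (sqrD_le2 _ _))// opprB addrA subrK.
by rewrite big_split /= -!mulr_sumr lerD// ler_wpM2l.
Qed.

Lemma l2_shift0 : l2_shift 0.
Proof.
exists 0 => N; rewrite big1// => n _.
by rewrite /v leq0n subn0 subrr expr0n.
Qed.

Lemma l2_shiftM k n : l2_shift k -> l2_shift (n * k).
Proof. by move=> gk; elim: n => [|n IH]; [exact: l2_shift0|rewrite mulSn; exact: l2_shiftD]. Qed.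

Lemma l2_shift1 : l2_shift 1.
Proof.
have [k fk] : exists k, 0 < f k.+1 /\ l2_shift k.+1.
  apply: contrapT => /forallNP nf.
  (* Without a positive support point, every number, and in particular 2, would divide the
     support. *)
  have : 2%N = 1%N; last by [].
  apply: f_aperiodic => -[//|k] fk.
  by have := nf k; case; split=> //; exact: l2_shift_support.
have ex : exists p, (0 < p)%N && `[< l2_shift p >].
  by exists k.+1; rewrite ltn0Sn; apply/asboolP; exact: fk.2.
have := ex_minnP ex; case=> p /andP[p0 /asboolP gp] pmin.
suff <- : p = 1%N by [].
apply: f_aperiodic => -[//|j] fj.
have gj := l2_shift_support fj.
rewrite /dvdn; apply/negPn/negP => jp.
have gm : l2_shift (j.+1 %% p).
  apply: (@l2_shiftB (j.+1 %/ p * p)); first by rewrite -divn_eq.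
  exact: l2_shiftM.
have := pmin (j.+1 %% p)%N; rewrite lt0n jp /= => /(_ (asboolT gm)).
by rewrite leqNgt ltn_mod p0.
Qed.

(** Two bounds are combined: iterating the unit shift gives [k^2 D], and each term being at most 1
    gives [N]. Their geometric mean is linear in [k], as it must be to be summed against [tail] with
    only two moments of the step. *)
Lemma renewal_diff_bound : exists2 D, 0 <= D & forall k N,
  \sum_(n < N) (u n - v n k) ^+ 2 <= k%:R * Num.sqrt (D * N%:R).
Proof.
have [D hD] := l2_shift1; have D0 : 0 <= D by have := hD 0%N; rewrite big_ord0.
exists D => // k N.
have sq k' : \sum_(n < N) (u n - v n k'.+1) ^+ 2 <= k'.+1%:R ^+ 2 * D.
  elim: k' => [|k' IH]; first by rewrite expr1n mul1r.
  have K0 : 0 < (k'.+1%:R : R) by rewrite ltr0n.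
  (* After [K] unit shifts, the weights [1 + 1/K] and [1 + K] in the inequality for [(a + b)^2] turn
     [K^2 D] and [D] into exactly [(K + 1)^2 D]. *)
  apply: (@le_trans _ _ (\sum_(n < N) ((1 + k'.+1%:R^-1) * (u n - v n k'.+1) ^+ 2 +
    (1 + k'.+1%:R) * (if (k'.+1 <= n)%N then (u (n - k'.+1)%N - v (n - k'.+1)%N 1) ^+ 2 else 0)))).
    apply: ler_sum => n _; have -> : u n - v n k'.+2 =
      (u n - v n k'.+1) + (v n k'.+1 - v n k'.+2) by ring.
    apply: (@le_trans _ _ ((1 + k'.+1%:R^-1) * (u n - v n k'.+1) ^+ 2 +
       (1 + k'.+1%:R) * (v n k'.+1 - v n k'.+2) ^+ 2)).
      move: (u n - v n k'.+1) (v n k'.+1 - v n k'.+2) => a b.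
      rewrite -subr_ge0; set K := k'.+1%:R in K0 *.
      have -> : (1 + K^-1) * a ^+ 2 + (1 + K) * b ^+ 2 - (a + b) ^+ 2 =
        (a - K * b) ^+ 2 / K by field; rewrite gt_eqF.
      by rewrite divr_ge0 ?sqr_ge0// ltW.
    rewrite lerD2l ler_wpM2l ?addr_ge0// /v.
    case: (leqP k'.+1 n) => an; last by rewrite leqNgt (leq_trans an (leqnSn _)) subr0 expr0n.
    by rewrite subn_gt0 -subnDA addn1.
  rewrite big_split /= -!mulr_sumr.
  apply: (@le_trans _ _ ((1 + k'.+1%:R^-1) * (k'.+1%:R ^+ 2 * D) + (1 + k'.+1%:R) * D)).
    apply: lerD; apply: ler_wpM2l; rewrite ?addr_ge0//.
    exact: le_trans (sum_shift_le _ N (fun n => sqr_ge0 (u n - v n 1))) (hD N).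
  rewrite -[k'.+2%:R]natr1 le_eqVlt; apply/orP; left; apply/eqP; field.
  by rewrite gt_eqF.
case: k => [|k].
  by rewrite mul0r big1// => n _; rewrite /v leq0n subn0 subrr expr0n.
set S := \sum_(n < N) _; have S0 : 0 <= S by apply: sumr_ge0 => n _; exact: sqr_ge0.
have SN : S <= N%:R.
  apply: (@le_trans _ _ (\sum_(n < N) 1)); first by apply: ler_sum => n _; exact: diff_sqr_le1.
  by rewrite sumr_const card_ord.
have DN : 0 <= D * N%:R by rewrite mulr_ge0.
rewrite -(@ler_pXn2r _ 2) ?nnegrE ?mulr_ge0 ?sqrtr_ge0//.
by rewrite exprMn sqr_sqrtr// mulrA expr2 ler_pM// sq.
Qed.

Lemma renewal_mean_ge1 : 1 <= m.
Proof. by have := tail2_ge0 0; rewrite /tail2 big_ord1 /tail big_ord0; lra. Qed.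

(** Subtracting [renewal_tail] from [m u n] writes [m u n - 1] as a [tail]-weighted sum of
    increments of [u] plus [u n * tail2 n]. The first part is squared by Cauchy-Schwarz and summed
    with [renewal_diff_bound]; the square of the second is at most [m * tail2 n], which is
    summable. *)
Theorem renewal_sequence_l2 :
  exists2 C, 0 <= C & forall N, \sum_(n < N) (u n - m^-1) ^+ 2 <= C * Num.sqrt N%:R.
Proof.
have [D D0 hD] := renewal_diff_bound; have m1 := renewal_mean_ge1.
have m0 : 0 < m by lra.
have mm : 0 <= m by exact: ltW.
have M0 : 0 <= M2 by have := sum_tail 0; rewrite big_ord0.
exists ((2 * m * M2 * Num.sqrt D + 2 * m * M2) / m ^+ 2).
  by rewrite divr_ge0 ?sqr_ge0// addr_ge0// !mulr_ge0 ?sqrtr_ge0// ltW.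
move=> [|N]; first by rewrite big_ord0 sqrtr0 mulr0.
set L := N.+1.
have Rm n : \sum_(k < n.+1) tail k <= m by have := tail2_ge0 n; rewrite /tail2; lra.
have t2 n : tail2 n ^+ 2 <= m * tail2 n.
  rewrite expr2 ler_wpM2r//; rewrite /tail2; have : 0 <= \sum_(k < n.+1) tail k by exact: sumr_ge0.
  by lra.
have eqn n : m * u n - 1 = \sum_(k < n.+1) tail k * (u n - v n k) + u n * tail2 n.
  rewrite -(renewal_tail n) /tail2 mulrBr mulr_sumr.
  rewrite [X in _ = X + _](eq_bigr (fun k : 'I_n.+1 => u n * tail k - tail k * u (n - k)%N)).
    by rewrite sumrB; ring.
  by move=> k _; rewrite /v -ltnS ltn_ord; ring.
have pt n : (m * u n - 1) ^+ 2 <=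
    2 * m * (\sum_(k < n.+1) tail k * (u n - v n k) ^+ 2) + 2 * m * tail2 n.
  rewrite eqn; apply: le_trans (sqrD_le2 _ _) _; rewrite -!mulrA lerD// ler_wpM2l//.
    apply: le_trans (sum_weighted_sqr_le _ (fun k => u n - v n k) tail_ge0) _.
    by rewrite ler_wpM2r// sumr_ge0// => k _; rewrite mulr_ge0// sqr_ge0.
  apply: le_trans (t2 n); rewrite exprMn -[leRHS]mul1r ler_wpM2r ?sqr_ge0//.
  by rewrite exprn_ile1.
have tot : \sum_(n < L) (m * u n - 1) ^+ 2 <=
    2 * m * M2 * Num.sqrt D * Num.sqrt L%:R + 2 * m * M2.
  apply: (@le_trans _ _ (\sum_(n < L) (2 * m * (\sum_(k < n.+1) tail k * (u n - v n k) ^+ 2)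
      + 2 * m * tail2 n))); first by apply: ler_sum => n _; exact: pt.
  rewrite big_split /= -!mulr_sumr; apply: lerD; last first.
    by apply: ler_wpM2l; [exact: mulr_ge0|exact: sum_tail2].
  rewrite -!mulrA; do 2 (rewrite ler_wpM2l//).
  apply: (@le_trans _ _ (\sum_(n < L) \sum_(k < L) tail k * (u n - v n k) ^+ 2)).
    apply: ler_sum => n _; apply: (sum_ord_le (F := fun k => tail k * (u n - v n k) ^+ 2)) => //.
    by move=> k; rewrite mulr_ge0// sqr_ge0.
  rewrite exchange_big /=.
  apply: (@le_trans _ _ (\sum_(k < L) k%:R * tail k * Num.sqrt (D * L%:R))).
    apply: ler_sum => k _; rewrite -mulr_sumr [leRHS](_ : _ =
      tail k * (k%:R * Num.sqrt (D * L%:R))); last by ring.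
    by rewrite ler_wpM2l// hD.
  by rewrite -mulr_suml sqrtrM// ler_wpM2r// mulr_ge0 ?sqrtr_ge0.
have -> : \sum_(n < L) (u n - m^-1) ^+ 2 = (\sum_(n < L) (m * u n - 1) ^+ 2) / m ^+ 2.
  rewrite mulr_suml; apply: eq_bigr => n _; field; rewrite gt_eqF//.
rewrite mulrAC ler_wpM2r ?invr_ge0 ?sqr_ge0//; apply: le_trans tot _.
rewrite [leRHS]mulrDl lerD2l ler_peMr ?mulr_ge0 ?(ltW m0)//.
by rewrite -[leLHS]sqrtr1 ler_wsqrtr// ler1n.
Qed.

End renewal_sequence.

(** * Visited sites of the renewal process *)

Section renewal_walk.
Context d (T : measurableType d) (R : realType) (P : probability T R).
Context (X : nat -> T -> nat).
Hypothesis iidX : iid_N P X.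
Hypothesis X_gt0 : forall i w, (0 < X i w)%N.

Definition step_law (k : nat) : R := Ex P (fun w => (X 0 w == k)%:R).

Lemma measurable_Xeq i k : measurable_fun setT (fun w => (X i w == k)%:R : R).
Proof.
have [mX _ _] := iidX; rewrite (_ : (fun w => _) = \1_(X i @^-1` [set k])).
  exact: measurable_indic.
apply/funext => w; rewrite indicE; congr (nat_of_bool _)%:R.
by apply/eqP/idP; rewrite inE.
Qed.

Lemma intble_bool (b : T -> bool) :
  measurable_fun setT (fun w => (b w)%:R : R) -> intble P (fun w => (b w)%:R).
Proof.
by move=> mb; apply: (intble_bounded P mb (M := 1)) => w; case: (b w); rewrite ?normr1 ?normr0.
Qed.

Lemma Ex_Xeq i k : Ex P (fun w => (X i w == k)%:R) = step_law k.
Proof.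
have [mX _ eX] := iidX; have key j : Ex P (fun w => (X j w == k)%:R) = fine (P (X j @^-1` [set k])).
  rewrite -Ex_indic//; apply: eq_Ex => w; rewrite indicE; congr (nat_of_bool _)%:R.
  by apply/eqP/idP; rewrite inE.
by rewrite /step_law !key eX.
Qed.

Definition pattern (s : seq nat) (c : nat -> nat) (w : T) : R :=
  (all (fun i => X i w == c i) s)%:R.

Lemma pattern_cons i s c w :
  pattern (i :: s) c w = (X i w == c i)%:R * pattern s c w.
Proof. by rewrite /pattern /=; case: eqP => _; rewrite ?mul1r ?mul0r. Qed.

Lemma measurable_pattern s c : measurable_fun setT (pattern s c).
Proof.
elim: s => [|i s IH]; first exact: measurable_cst.
rewrite (_ : pattern _ _ = fun w => (X i w == c i)%:R * pattern s c w).
  by apply: measurable_funM => //; exact: measurable_Xeq.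
by apply/funext => w; rewrite pattern_cons.
Qed.

Lemma Ex_pattern s c : uniq s -> Ex P (pattern s c) = \prod_(i <- s) step_law (c i).
Proof.
have [mX indX _] := iidX => us.
have := indX s (fun i => [set c i]) us.
have -> : \bigcap_(i in [set` s]) X i @^-1` [set c i] =
    [set w | all (fun i => X i w == c i) s].
  apply/seteqP; split=> [w h|w /= /allP h i /= si]; last exact/eqP/h.
  by apply/allP => i si; apply/eqP; exact: h.
set A := [set w | _] => PA.
have mA : measurable A.
  have -> : A = \bigcap_(i in [set` s]) X i @^-1` [set c i].
    apply/seteqP; split=> [w /= /allP h i /= si|w h]; first exact/eqP/h.
    by apply/allP => i si; apply/eqP; exact: h.
  by apply: fin_bigcap_measurable => //.
have -> : Ex P (pattern s c) = fine (P A).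
  rewrite -Ex_indic//; apply: eq_Ex => w; rewrite /pattern indicE; congr (nat_of_bool _)%:R.
  by apply/idP/idP; rewrite inE.
rewrite PA; have : (\prod_(i <- s) P (X i @^-1` [set c i]) = (\prod_(i <- s) step_law (c i))%:E)%E.
  elim: s {us PA mA A} => [|i s IH]; first by rewrite !big_nil.
  rewrite !big_cons IH EFinM; congr (_ * _)%E; rewrite -(Ex_Xeq i).
  rewrite (@eq_Ex _ _ _ P _ (\1_(X i @^-1` [set c i]))).
    by rewrite Ex_indic// fineK//; exact: fin_num_measure.
  by move=> w; rewrite indicE; congr (nat_of_bool _)%:R; apply/eqP/idP; rewrite inE.
by move=> ->.
Qed.

(** Stands in for dependence on the first [n] steps alone, through the one consequence needed: [F]
    is uncorrelated with any prescription of finitely many later steps. *)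
Definition past (n : nat) (F : T -> R) : Prop :=
  [/\ measurable_fun setT F, exists M, forall w, `|F w| <= M &
    forall s c, uniq s -> (forall i, i \in s -> (n <= i)%N) ->
      Ex P (fun w => F w * pattern s c w) = Ex P F * Ex P (pattern s c)].

Lemma past_intble n F : past n F -> intble P F.
Proof. by move=> [mF [M FM] _]; exact: (intble_bounded P mF FM). Qed.

Lemma pastM_intble (F : T -> R) s c : measurable_fun setT F -> (exists M, forall w, `|F w| <= M) ->
  intble P (fun w => F w * pattern s c w).
Proof.
move=> mF [M FM]; apply: (@intble_bounded _ _ _ P _ M).
  by apply: measurable_funM => //; exact: measurable_pattern.
move=> w; rewrite normrM /pattern; case: all; first by rewrite normr1 mulr1.
by rewrite normr0 mulr0 (le_trans (normr_ge0 _) (FM w)).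
Qed.

Lemma past_cst n k : past n (fun=> k).
Proof.
split; [exact: measurable_cst|by exists (`|k|)|move=> s c us _].
rewrite ExZ ?Ex_cst//; apply: (intble_bool (measurable_pattern s c)).
Qed.

Lemma past_sum n N (F : nat -> T -> R) : (forall k, past n (F k)) ->
  past n (fun w => \sum_(k < N) F k w).
Proof.
move=> pF; have mF k : measurable_fun setT (F k) by have [] := pF k.
have bF k : exists M, forall w, `|F k w| <= M by have [] := pF k.
split.
- by apply: measurable_sum => k; exact: mF.
- elim: N => [|N [M HM]]; first by exists 0 => w; rewrite big_ord0 normr0.
  have [M' HM'] := bF N; exists (M + M') => w.
  by rewrite big_ord_recr (le_trans (ler_normD _ _))// lerD.
- move=> s c us ns; rewrite Ex_sum; last by move=> k _; exact: past_intble (pF k).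
  rewrite mulr_suml (@eq_Ex _ _ _ P _ (fun w => \sum_(k < N) F k w * pattern s c w)).
    rewrite Ex_sum; last by move=> k _; exact: pastM_intble.
    by apply: eq_bigr => k _; have [_ _] := pF k; exact.
  by move=> w; rewrite mulr_suml.
Qed.

Lemma past_step n F c : past n F ->
  past n.+1 (fun w => F w * (X n w == c)%:R) /\
  Ex P (fun w => F w * (X n w == c)%:R) = Ex P F * step_law c.
Proof.
move=> [mF [M FM] indF].
have E : Ex P (fun w => F w * (X n w == c)%:R) = Ex P F * step_law c.
  rewrite -(Ex_Xeq n); have := indF [:: n] (fun=> c) isT.
  have eqp w : pattern [:: n] (fun=> c) w = (X n w == c)%:R.
    by rewrite pattern_cons /pattern /= mulr1.
  rewrite (eq_Ex _ eqp) => <-; last by move=> i; rewrite inE => /eqP ->.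
  by apply: eq_Ex => w; rewrite eqp.
split=> //; split.
- by apply: measurable_funM => //; exact: measurable_Xeq.
- exists M => w; rewrite normrM; case: (X n w == c); first by rewrite normr1 mulr1.
  by rewrite normr0 mulr0 (le_trans (normr_ge0 _) (FM w)).
move=> s c' us ns; rewrite E.
have sn : n \notin s by apply/negP => /ns; rewrite ltnn.
(* A pattern takes one value function for all its indices, so the value [c] at [n] is patched into
   [c']; this is harmless because [n] is not in [s]. *)
pose c2 i := if i == n then c else c' i.
have eqp w : pattern s c2 w = pattern s c' w.
  congr (nat_of_bool _)%:R; apply: eq_in_all => i si; rewrite /c2.
  by case: (eqVneq i n) => [e|//]; move: si; rewrite e (negbTE sn).
have := indF (n :: s) c2; rewrite /= sn us => /(_ isT) h.
rewrite (@eq_Ex _ _ _ P _ (fun w => F w * pattern (n :: s) c2 w)).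
  rewrite h; last by move=> i; rewrite inE => /orP[/eqP -> //|/ns /ltnW].
  rewrite !Ex_pattern//=; last by rewrite sn.
  rewrite big_cons {1}/c2 eqxx mulrA; congr (_ * _); apply: eq_big_seq => i si.
  by rewrite /c2; case: (eqVneq i n) => [e|//]; move: si; rewrite e (negbTE sn).
by move=> w; rewrite pattern_cons eqp {1}/c2 eqxx mulrA.
Qed.

Lemma renewalS n w : renewal X n.+1 w = (renewal X n w + X n w)%N.
Proof. by rewrite /renewal big_ord_recr. Qed.

Lemma renewal_ltS n w : (renewal X n w < renewal X n.+1 w)%N.
Proof. by rewrite renewalS -addn1 leq_add2l X_gt0. Qed.

Lemma renewal_lt i j w : (i < j)%N -> (renewal X i w < renewal X j w)%N.
Proof.
elim: j => // j IH; rewrite ltnS leq_eqVlt => /orP[/eqP ->|/IH h].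
  exact: renewal_ltS.
exact: ltn_trans h (renewal_ltS _ _).
Qed.

Lemma renewal_le i j w : (i <= j)%N -> (renewal X i w <= renewal X j w)%N.
Proof. by rewrite leq_eqVlt => /orP[/eqP ->//|/(renewal_lt w)/ltnW]. Qed.

Lemma renewal_ge n w : (n <= renewal X n w)%N.
Proof. by elim: n => // n IH; exact: leq_ltn_trans IH (renewal_ltS _ _). Qed.

Lemma renewal_inj w : injective (renewal X ^~ w).
Proof.
move=> i j /= eij; case: (ltngtP i j) => // /(renewal_lt w) h; exfalso; move: h.
  by rewrite eij ltnn.
by rewrite eij ltnn.
Qed.

Lemma renewal0 w : renewal X 0 w = 0%N.
Proof. by rewrite /renewal big_ord0. Qed.

Lemma sum_eq_nat (N a : nat) (p : nat -> R) :
  \sum_(c < N) (a == c)%:R * p c = (a < N)%:R * p a.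
Proof.
have [aN|aN] := ltnP a N; last first.
  rewrite mul0r big1// => c _; case: eqP => [ac|]; last by rewrite mul0r.
  by move: aN; rewrite ac leqNgt ltn_ord.
rewrite mul1r (bigD1 (Ordinal aN))//= eqxx mul1r big1 ?addr0// => c ca.
by case: eqP => [ac|]; rewrite ?mul0r//; move/eqP: ca; case; exact/val_inj.
Qed.

Lemma renewal_eqS n a w : (renewal X n.+1 w == a)%:R =
  \sum_(c < a.+1) (renewal X n w == c)%:R * (X n w == (a - c)%N)%:R :> R.
Proof.
rewrite (sum_eq_nat _ _ (fun c => (X n w == (a - c)%N)%:R)) renewalS ltnS.
have [la|la] := leqP; last first.
  by rewrite mul0r (_ : (_ == a) = false)//; apply/eqP; lia.
by rewrite mul1r; congr (nat_of_bool _)%:R; apply/eqP/eqP; lia.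
Qed.

Definition walk_law (n a : nat) : R := Ex P (fun w => (renewal X n w == a)%:R).

Lemma past_renewal n a : past n (fun w => (renewal X n w == a)%:R).
Proof.
elim: n a => [|n IH] a.
  rewrite (_ : (fun w => _) = fun=> (0%N == a)%:R); first exact: past_cst.
  by apply/funext => w; rewrite renewal0.
rewrite (_ : (fun w => _) = fun w => \sum_(c < a.+1)
    (renewal X n w == c)%:R * (X n w == (a - c)%N)%:R).
  apply: (past_sum _ (F := fun c w => (renewal X n w == c)%:R * (X n w == (a - c)%N)%:R)) => c.
  by have [] := past_step (a - c)%N (IH c).
by apply/funext => w; rewrite renewal_eqS.
Qed.

Lemma measurable_renewal_eq n a :
  measurable_fun setT (fun w => (renewal X n w == a)%:R : R).
Proof. by have [] := past_renewal n a. Qed.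

Lemma walk_lawS n a : walk_law n.+1 a = \sum_(c < a.+1) walk_law n c * step_law (a - c)%N.
Proof.
rewrite /walk_law (eq_Ex _ (renewal_eqS n a)) Ex_sum.
  by apply: eq_bigr => c _; have [] := past_step (a - c)%N (past_renewal n c).
by move=> c _; have [/past_intble] := past_step (a - c)%N (past_renewal n c).
Qed.

(** The regeneration property: from [a] on, the walk moves like a fresh one. The induction on [k]
    splits at the site before the last step and carries the [past] statement that allows this step
    to be factored out. *)
Lemma walk_joint n a k b :
  past (n + k) (fun w => (renewal X n w == a)%:R * (renewal X (n + k) w == (a + b)%N)%:R) /\
  Ex P (fun w => (renewal X n w == a)%:R * (renewal X (n + k) w == (a + b)%N)%:R)
    = walk_law n a * walk_law k b.
Proof.
elim: k b => [|k IH] b.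
  rewrite addn0 (_ : (fun w => _) = fun w => (b == 0%N)%:R * (renewal X n w == a)%:R); last first.
    apply/funext => w; case: eqP => [->|]; last by rewrite mul0r mulr0.
    by rewrite -{1}[a]addn0 eqn_add2l eq_sym mulrC.
  split; last first.
    rewrite ExZ; last exact: past_intble (past_renewal n a).
    rewrite mulrC; congr (_ * _); rewrite /walk_law (@eq_Ex _ _ _ P _ (fun=> (b == 0%N)%:R)) ?Ex_cst//.
    by move=> w; rewrite renewal0 eq_sym.
  case: eqP => _.
    rewrite (_ : (fun w => _) = fun w => (renewal X n w == a)%:R); first exact: past_renewal.
    by apply/funext => w; rewrite mul1r.
  rewrite (_ : (fun w => _) = fun=> 0); first exact: past_cst.
  by apply/funext => w; rewrite mul0r.
pose F c w : R := (renewal X n w == a)%:R * (renewal X (n + k) w == (a + c)%N)%:R.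
have eqF w : (renewal X n w == a)%:R * (renewal X (n + k.+1) w == (a + b)%N)%:R =
    \sum_(c < b.+1) F c w * (X (n + k)%N w == (b - c)%N)%:R.
  rewrite /F; have [an|_] := eqVneq (renewal X n w) a; last first.
    by rewrite mul0r big1// => c _; rewrite !mul0r.
  have := renewal_le w (leq_addr k n); rewrite an => ha.
  have e c : (renewal X (n + k) w == (a + c)%N) = ((renewal X (n + k) w - a)%N == c).
    by apply/eqP/eqP; lia.
  under eq_bigr do rewrite e mul1r.
  rewrite (sum_eq_nat _ _ (fun c => (X (n + k)%N w == (b - c)%N)%:R)) addnS renewalS ltnS.
  have [la|la] := leqP; last first.
    by rewrite mul0r mul1r (_ : (_ == _) = false)//; apply/eqP; lia.
  by rewrite !mul1r; congr (nat_of_bool _)%:R; apply/eqP/eqP; lia.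
have pF c : past (n + k) (F c) by have [] := IH c.
split.
  rewrite (funext eqF) addnS.
  apply: (past_sum _ (F := fun c w => F c w * (X (n + k)%N w == (b - c)%N)%:R)) => c.
  by have [] := past_step (b - c)%N (pF c).
rewrite (eq_Ex _ eqF) Ex_sum.
  rewrite walk_lawS mulr_sumr; apply: eq_bigr => c _.
  have [_ ->] := past_step (b - c)%N (pF c); have [_ ->] := IH c.
  by rewrite mulrA.
by move=> c _; have [/past_intble] := past_step (b - c)%N (pF c).
Qed.

(** The bound on [k] loses nothing, since [k] steps of length at least 1 lead to [k] or further; it
    makes the indicator a finite sum. *)
Definition visited (x : nat) (w : T) : bool :=
  [exists k : 'I_x.+1, renewal X k w == x].

Lemma visitedP x w : reflect (exists k, renewal X k w = x) (visited x w).
Proof.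
apply: (iffP existsP) => [[k /eqP kx]|[k kx]]; first by exists k.
have kl : (k < x.+1)%N by rewrite ltnS -kx renewal_ge.
by exists (Ordinal kl); rewrite /= kx.
Qed.

Lemma visitedE x N w : (x < N)%N ->
  (visited x w)%:R = \sum_(k < N) (renewal X k w == x)%:R :> R.
Proof.
move=> xN; case: visitedP => [[k kx]|nk]; last first.
  by rewrite big1// => k _; case: eqP => // kx; case: nk; exists k.
have kl : (k < N)%N by rewrite (leq_ltn_trans _ xN)// -kx renewal_ge.
rewrite (bigD1 (Ordinal kl))//= kx eqxx big1 ?addr0// => j jk.
case: eqP => // jx; move/eqP: jk; case; apply/val_inj; apply: (@renewal_inj w).
by rewrite /= jx kx.
Qed.

Definition hit (x : nat) : R := Ex P (fun w => (visited x w)%:R).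

Lemma measurable_visited x : measurable_fun setT (fun w => (visited x w)%:R : R).
Proof.
rewrite (_ : (fun w => _) = fun w => \sum_(k < x.+1) (renewal X k w == x)%:R).
  by apply: measurable_sum => k; exact: measurable_renewal_eq.
by apply/funext => w; exact: visitedE.
Qed.

Lemma hitE x N : (x < N)%N -> hit x = \sum_(k < N) walk_law k x.
Proof.
move=> xN; rewrite /hit (eq_Ex _ (fun w => visitedE w xN)) Ex_sum//.
by move=> k _; exact/intble_bool/measurable_renewal_eq.
Qed.

(** The walk increases strictly, so a visit to [x + z] comes at most [z] steps after the one to [x].
    Then [walk_joint] factors each term and the sums over [k] and [l] separate. *)
Lemma Ex_visited2 x z :
  Ex P (fun w => (visited x w)%:R * (visited (x + z) w)%:R) = hit x * hit z.
Proof.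
rewrite (@eq_Ex _ _ _ P _ (fun w => \sum_(k < x.+1) \sum_(l < z.+1)
    (renewal X k w == x)%:R * (renewal X (k + l) w == (x + z)%N)%:R)); last first.
  move=> w; rewrite (visitedE w (ltnSn x)) mulr_suml; apply: eq_bigr => k _.
  rewrite -mulr_sumr; have [kx|] := eqVneq (renewal X k w) x; last by rewrite !mul0r.
  rewrite !mul1r; case: visitedP => [[j jx]|nj]; last first.
    by rewrite big1// => l _; case: eqP => // kl; case: nj; exists (k + l)%N.
  have kj : (k <= j)%N.
    by rewrite leqNgt; apply/negP => /(renewal_lt w); lia.
  have lz : (j - k < z.+1)%N.
    rewrite ltnS -(leq_add2l x) -jx -{1}kx -{2}(subnKC kj).
    elim: (j - k)%N => [|l IH]; first by rewrite !addn0.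
    by rewrite !addnS; exact: leq_ltn_trans IH (renewal_ltS _ _).
  rewrite (bigD1 (Ordinal lz))//= subnKC// jx eqxx big1 ?addr0// => l ljk.
  case: eqP => // lx; move/eqP: ljk; case; apply/val_inj => /=.
  by have := @renewal_inj w (k + l)%N j; rewrite lx jx => /(_ erefl) <-; rewrite addKn.
have i2 k l := past_intble (walk_joint k x l z).1.
rewrite Ex_sum; last by move=> k _; apply: intble_sum => l _; exact: i2.
rewrite (hitE (ltnSn x)) mulr_suml; apply: eq_bigr => k _.
rewrite Ex_sum; last by move=> l _; exact: i2.
rewrite (hitE (ltnSn z)) mulr_sumr; apply: eq_bigr => l _.
by have [] := walk_joint k x l z.
Qed.

Lemma step_law0 : step_law 0 = 0.
Proof.
rewrite /step_law (@eq_Ex _ _ _ P _ (fun=> 0)) ?Ex_cst// => w.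
by case: eqP (X_gt0 0 w) => // ->.
Qed.

Lemma step_law_ge0 k : 0 <= step_law k.
Proof. exact: Ex_ge0. Qed.

Lemma hit0 : hit 0 = 1.
Proof.
rewrite /hit (@eq_Ex _ _ _ P _ (fun=> 1)) ?Ex_cst// => w.
by case: visitedP => // -[]; exists 0%N; exact: renewal0.
Qed.

(** The renewal equation, obtained by splitting at the last site before [n.+1] and reversing the
    sum; a step of length 0 has weight zero by [step_law0]. *)
Lemma hitS n : hit n.+1 = \sum_(k < n.+1) step_law k.+1 * hit (n - k)%N.
Proof.
rewrite (hitE (ltnSn n.+1)) big_ord_recl /=.
have -> : walk_law 0 n.+1 = 0.
  by rewrite /walk_law (@eq_Ex _ _ _ P _ (fun=> 0)) ?Ex_cst// => w; rewrite renewal0.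
rewrite add0r; under eq_bigr do rewrite walk_lawS.
rewrite exchange_big /= big_ord_recr /= [X in _ + X]big1 ?addr0; last first.
  by move=> k _; rewrite subnn step_law0 mulr0.
rewrite (reindex_inj rev_ord_inj) /=; apply: eq_bigr => k _.
have kn : (k <= n)%N by rewrite -ltnS ltn_ord.
rewrite subSS; have -> : (n.+1 - (n - k))%N = k.+1 by lia.
by rewrite -mulr_suml mulrC (@hitE _ n.+1)//; lia.
Qed.

End renewal_walk.

(** * Moments of the steps *)

Section renewal_moments.
Context d (T : measurableType d) (R : realType) (P : probability T R).
Context (X : nat -> T -> nat).
Hypothesis iidX : iid_N P X.
Hypothesis X_gt0 : forall i w, (0 < X i w)%N.
Hypothesis X_aperiodic : aperiodic (support_N P (X 0)).
Hypothesis X_intble : intble P (fun w => (X 0 w)%:R).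
Hypothesis X2_intble : intble P (fun w => (X 0 w)%:R ^+ 2).

Let m := Ex P (fun w => (X 0 w)%:R).
Let M2 := Ex P (fun w => (X 0 w)%:R ^+ 2).

Let f := step_law P X.

Lemma measurable_natX (b : nat -> R) i : measurable_fun setT (fun w => b (X i w)).
Proof.
have [mX _ _] := iidX; move=> _ B mB; rewrite setTI.
have -> : (fun w => b (X i w)) @^-1` B = \bigcup_(k in [set k | B (b k)]) (X i @^-1` [set k]).
  apply/seteqP; split=> [w /= h|w [k /= h kx]]; first by exists (X i w).
  by rewrite /= kx.
exact: bigcup_measurable.
Qed.

Lemma gtX_sum n : (fun w => (n < X 0 w)%:R) =1
  (fun w => 1 - \sum_(j < n) (X 0 w == j.+1)%:R) :> (T -> R).
Proof.
move=> w; elim: n => [|n IH]; first by rewrite big_ord0 subr0 X_gt0.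
rewrite big_ord_recr /= opprD addrA -IH.
by case: (ltngtP n.+1 (X 0 w)) => h; case: (ltnP n (X 0 w)) => h'; try lia;
  rewrite ?(gtn_eqF h) ?(ltn_eqF h) ?subr0 ?subrr//; lra.
Qed.

Lemma intble_gtX n : intble P (fun w => (n < X 0 w)%:R).
Proof.
exact: (intble_bool P (measurable_natX (fun k => (n < k)%:R) 0)).
Qed.

Lemma tail_step n : tail f n = Ex P (fun w => (n < X 0 w)%:R).
Proof.
have i0 j := intble_bool P (measurable_Xeq iidX 0 j).
rewrite (eq_Ex _ (gtX_sum n)) ExB ?Ex_cst ?Ex_sum//; first exact: intble_cst.
by apply: intble_sum => j _.
Qed.

(** The integrand is the part of the step beyond [n + 1], hence nonnegative. *)
Lemma tail2_step n : tail2 f m n =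
  Ex P (fun w => (X 0 w)%:R - \sum_(k < n.+1) (k < X 0 w)%:R).
Proof.
rewrite ExB//; last by apply: intble_sum => k _; exact: intble_gtX.
rewrite Ex_sum; last by move=> k _; exact: intble_gtX.
by congr (_ - _); apply: eq_bigr => k _; rewrite tail_step.
Qed.

Lemma sum_lt_nat (N x : nat) : \sum_(k < N) (k < x)%:R = (minn N x)%:R :> R.
Proof.
elim: N => [|N IH]; first by rewrite big_ord0 min0n.
rewrite big_ord_recr /= IH -natrD; congr (_%:R); case: ltnP; lia.
Qed.

Lemma hit_l2 : exists2 C, 0 <= C & forall N,
  \sum_(n < N) (hit P X n - m^-1) ^+ 2 <= C * Num.sqrt N%:R.
Proof.
apply: (@renewal_sequence_l2 R f (hit P X) m M2).
- exact: step_law_ge0.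
- exact: hit0.
- exact: hitS.
- move=> p hp; apply: X_aperiodic => k; rewrite /support_N /= => Pk; apply: hp.
  have [mX _ _] := iidX; rewrite /f -lte_fin -(Ex_Xeq iidX 0) (@eq_Ex _ _ _ P _ (\1_(X 0 @^-1` [set k]))).
    by rewrite Ex_indic// fineK//; exact: fin_num_measure.
  by move=> w; rewrite indicE; congr (nat_of_bool _)%:R; apply/eqP/idP; rewrite inE.
- by move=> k; rewrite tail_step; exact: Ex_ge0.
- move=> n; rewrite tail2_step; apply: Ex_ge0 => w; rewrite sum_lt_nat subr_ge0 ler_nat.
  exact: geq_minr.
- move=> N; have i1 (k : 'I_N) : intble P (fun w => k%:R * (k < X 0 w)%:R).
    by apply: intbleZ; exact: intble_gtX.
  rewrite (eq_bigr (fun k : 'I_N => Ex P (fun w => k%:R * (k < X 0 w)%:R))); last first.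
    by move=> k _; rewrite tail_step ExZ//; exact: intble_gtX.
  rewrite -Ex_sum; last by move=> k _; exact: i1.
  apply: le_Ex => //; first by apply: intble_sum => k _; exact: i1.
  (* In every nonzero term [k] is below the step, and there are at most as many such [k] as the
     length of the step: its square bounds the sum. *)
  move=> w; apply: (@le_trans _ _ (\sum_(k < N) (X 0 w)%:R * (k < X 0 w)%:R)).
    apply: ler_sum => k _; case: ltnP => kX; last by rewrite !mulr0.
    by rewrite !mulr1 ler_nat ltnW.
  rewrite -mulr_sumr sum_lt_nat expr2 ler_wpM2l// ler_nat; exact: geq_minr.
- move=> N; have i1 (n : nat) : intble P (fun w => (X 0 w)%:R - \sum_(k < n.+1) (k < X 0 w)%:R).
    by apply: intbleB => //; apply: intble_sum => k _; exact: intble_gtX.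
  under eq_bigr do rewrite tail2_step.
  rewrite -Ex_sum; last by move=> k _; exact: i1.
  apply: le_Ex => //; first by apply: intble_sum => k _; exact: i1.
  move=> w; apply: (@le_trans _ _ (\sum_(n < N) (X 0 w)%:R * (n < X 0 w)%:R)).
    apply: ler_sum => n _; rewrite sum_lt_nat; case: ltnP => nX.
      by rewrite mulr1 lerBlDr lerDl.
    by rewrite mulr0 subr_le0 ler_nat leq_min leqnn andbT leqW.
  rewrite -mulr_sumr sum_lt_nat expr2 ler_wpM2l// ler_nat; exact: geq_minr.
Qed.

Lemma mean_ge1 : 1 <= m.
Proof.
rewrite -[leLHS](Ex_cst P); apply: le_Ex => //; first exact: intble_cst.
by move=> w; rewrite ler1n.
Qed.

Let Y i w : R := (X i w)%:R - m.

Let mY i : measurable_fun setT (Y i).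
Proof. exact: (measurable_natX (fun k => k%:R - m)). Qed.

Lemma Ex_natX (b : nat -> R) i : intble P (fun w => b (X 0 w)) ->
  intble P (fun w => b (X i w)) /\ Ex P (fun w => b (X i w)) = Ex P (fun w => b (X 0 w)).
Proof.
have [_ _ eX] := iidX => bi.
apply: (@eq_law_Ex _ _ _ P (fun w => b (X i w)) (fun w => b (X 0 w)) id) => //;
  try exact: measurable_natX.
by move=> B mB; exact: (eX i [set k | B (b k)]).
Qed.

Lemma Ex_natX_prod i j (b : nat -> R) : i != j -> intble P (fun w => b (X 0 w)) ->
  intble P (fun w => b (X i w) * b (X j w)) /\
  Ex P (fun w => b (X i w) * b (X j w)) = Ex P (fun w => b (X 0 w)) ^+ 2.
Proof.
move=> ij bi; have [bi1 e1] := Ex_natX i bi; have [bj1 ej] := Ex_natX j bi.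
have [_ indX _] := iidX.
have [] := @intble_ExM _ _ _ P (fun w => b (X i w)) (fun w => b (X j w)) id id
  (measurable_natX b i) (measurable_natX b j) _ (@measurable_id _ _ setT)
  (@measurable_id _ _ setT) bi1 bj1.
  move=> A B mA mB.
  have := indX [:: i; j] (fun k => if k == i then [set k | A (b k)] else [set k | B (b k)]).
  rewrite !bigcap_cons bigcap_nil setIT !big_cons big_nil eqxx eq_sym (negbTE ij) mule1.
  by apply; rewrite /= inE ij.
by move=> h1 h2; split=> //; rewrite h2 expr2 -{2}ej -e1.
Qed.

Lemma renewal_variance n :
  intble P (fun w => ((renewal X n w)%:R - n%:R * m) ^+ 2) /\
  Ex P (fun w => ((renewal X n w)%:R - n%:R * m) ^+ 2) <= n%:R * M2.
Proof.
have iY : intble P (fun w => (X 0 w)%:R - m) by apply: intbleB => //; exact: intble_cst.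
have iY2 : intble P (fun w => ((X 0 w)%:R - m) ^+ 2).
  apply: (@eq_intble _ _ _ P (fun w => (X 0 w)%:R ^+ 2 - (2 * m * (X 0 w)%:R - m ^+ 2))).
    by move=> w; ring.
  by apply: intbleB => //; apply: intbleB; [exact: (intbleZ (2 * m) X_intble)|exact: intble_cst].
have EY2 : Ex P (fun w => ((X 0 w)%:R - m) ^+ 2) <= M2.
  rewrite (@eq_Ex _ _ _ P _ (fun w => (X 0 w)%:R ^+ 2 - (2 * m * (X 0 w)%:R - m ^+ 2))).
    have i1 := intbleZ (2 * m) X_intble; have i2 := intble_cst P (m ^+ 2).
    rewrite (ExB X2_intble (intbleB i1 i2)) (ExB i1 i2) (ExZ _ X_intble) Ex_cst.
    rewrite -/m -/M2; have := sqr_ge0 m; rewrite expr2; lra.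
  by move=> w; ring.
have EY : Ex P (fun w => (X 0 w)%:R - m) = 0.
  by rewrite ExB// ?Ex_cst ?subrr//; exact: intble_cst.
have eqS w : ((renewal X n w)%:R - n%:R * m) ^+ 2 =
    \sum_(i < n) \sum_(j < n) Y i w * Y j w.
  have -> : (renewal X n w)%:R - n%:R * m = \sum_(i < n) Y i w.
    by rewrite /renewal natr_sum sumrB sumr_const card_ord mulr_natl.
  by rewrite expr2 mulr_suml; apply: eq_bigr => i _; rewrite mulr_sumr.
have iYY (i j : nat) : intble P (fun w => Y i w * Y j w).
  have [->|ij] := eqVneq i j.
    exact: (Ex_natX (b := fun k => (k%:R - m) * (k%:R - m)) j iY2).1.
  exact: (Ex_natX_prod (b := fun k => k%:R - m) ij iY).1.
split.
  apply: (eq_intble (fun w => esym (eqS w))).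
  by apply: intble_sum => i _; apply: intble_sum => j _; exact: iYY.
rewrite (eq_Ex _ eqS) Ex_sum; last by move=> i _; apply: intble_sum => j _; exact: iYY.
rewrite mulr_natl -[n in leRHS]card_ord -sumr_const; apply: ler_sum => i _.
rewrite Ex_sum; last by move=> j _; exact: iYY.
rewrite (bigD1 i)//= big1 ?addr0.
  apply: le_trans EY2; rewrite le_eqVlt; apply/orP; left; apply/eqP.
  exact: (Ex_natX (b := fun k => (k%:R - m) * (k%:R - m)) i iY2).2.
move=> j ji; have ij : (i : nat) != j by rewrite eq_sym.
by rewrite (Ex_natX_prod (b := fun k => k%:R - m) ij iY).2 EY expr0n.
Qed.

End renewal_moments.

(** * Two replicas of the walk in one scenery *)

Section finite_deviation.
Context (R : realFieldType).

(** Each distance occurs at most twice, once on either side of [i]. *)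
Lemma sum_dist_le (v : nat -> R) (i N : nat) : (forall z, 0 <= v z) -> (i < N)%N ->
  \sum_(j < N) v `|i - j|%N <= 2 * \sum_(z < N) v z.
Proof.
move=> v0 iN; apply: (@le_trans _ _ (\sum_(j < N)
  ((if (i <= j)%N then v (j - i)%N else 0) + (if (j < i.+1)%N then v (i - j)%N else 0)))).
  apply: ler_sum => j _; rewrite ltnS; case: (ltngtP i j) => ij.
  - by rewrite addr0 (_ : `|i - j|%N = (j - i)%N)//; lia.
  - by rewrite add0r (_ : `|i - j|%N = (i - j)%N)//; lia.
  - by rewrite ij distnn subnn lerDl.
rewrite big_split /= mulr2n mulrDl mul1r lerD//.
  apply: (@le_trans _ _ (\sum_(j < i + N) (if (i <= j)%N then v (j - i)%N else 0))).
    by apply: (sum_ord_le (F := fun j => if (i <= j)%N then v (j - i)%N else 0));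
      [move=> j; case: ifP|exact: leq_addl].
  rewrite big_split_ord /= big1 ?add0r; last by move=> j _; rewrite leqNgt ltn_ord.
  by apply: ler_sum => j _; rewrite leq_addr addKn.
rewrite -(subnKC iN) big_split_ord /= [X in _ + X]big1 ?addr0; last first.
  by move=> j _; rewrite ltnNge leq_addr.
rewrite (eq_bigr (fun j : 'I_i.+1 => v (i - j)%N)); last by move=> j _; rewrite ltn_ord.
rewrite (reindex_inj rev_ord_inj) /= (eq_bigr (fun j : 'I_i.+1 => v j)); last first.
  move=> j _; congr v; rewrite subSS subKn// -ltnS ltn_ord//.
by rewrite big_split_ord /= lerDl sumr_ge0.
Qed.

Context (T : finType) (p : T -> R) (X : T -> nat -> R) (U : nat -> R) (M : R).
Hypothesis p_sum : \sum_e p e = 1.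
Hypothesis U_le1 : forall x, `|U x| <= 1.
Hypothesis M01 : 0 <= M <= 1.

(** The product hypothesis makes [cov x (x + z)] equal to [U x (U z - M) - M (U (x + z) - M)], so
    the whole double sum is controlled by the deviations of [U] from [M]. The form covers both the
    sites of one walk, with [U = u], and the common sites of two, with [U = u^2]. *)
Lemma weighted_deviation N :
  (forall x, (x <= N)%N -> \sum_e p e * X e x = U x) ->
  (forall x z, (x + z <= N)%N -> \sum_e p e * (X e x * X e (x + z)%N) = U x * U z) ->
  \sum_e p e * (\sum_(1 <= x < N.+1) X e x - N%:R * M) ^+ 2 <=
  4 * N%:R * \sum_(z < N.+1) `|U z - M|.
Proof.
move=> EX EXX; set v := fun z => `|U z - M|; have v0 z : 0 <= v z by exact: normr_ge0.
have /andP[M0 M1] := M01.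
have sqE e : (\sum_(1 <= x < N.+1) X e x - N%:R * M) ^+ 2 =
    \sum_(i < N) \sum_(j < N) (X e i.+1 - M) * (X e j.+1 - M).
  have -> : \sum_(1 <= x < N.+1) X e x - N%:R * M = \sum_(i < N) (X e i.+1 - M).
    by rewrite big_add1 /= big_mkord sumrB sumr_const card_ord mulr_natl.
  by rewrite expr2 mulr_suml; apply: eq_bigr => i _; rewrite mulr_sumr.
pose cov x y := \sum_e p e * ((X e x - M) * (X e y - M)).
have covC x y : cov x y = cov y x.
  by apply: eq_bigr => e _; rewrite [_ * (X e y - M)]mulrC.
have covE x z : (x + z <= N)%N -> cov x (x + z)%N = U x * (U z - M) - M * (U (x + z)%N - M).
  move=> xzN; rewrite /cov (eq_bigr (fun e => p e * (X e x * X e (x + z)%N) - M * (p e * X e x)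
    - M * (p e * X e (x + z)%N) + M ^+ 2 * p e)); last by move=> e _; ring.
  by rewrite big_split /= !sumrB -!mulr_sumr EXX// !EX ?p_sum//; [ring|exact: leq_trans (leq_addr _ _) xzN].
have covB (i j : 'I_N) : cov i.+1 j.+1 <= v `|i - j|%N + (v i.+1 + v j.+1).
  have hb x z : (x + z <= N)%N -> cov x (x + z)%N <= v z + v (x + z)%N.
    move=> xzN; rewrite covE//; apply: le_trans (ler_norm _) _; apply: le_trans (ler_normB _ _) _.
    by rewrite !normrM lerD// ler_piMl// ger0_norm.
  case: (leqP i j) => ij.
    have := hb i.+1 (j - i)%N; rewrite addSn subnKC// ltn_ord => /(_ isT).
    rewrite (_ : `|i - j|%N = (j - i)%N); last by lia.
    by move/le_trans; apply; rewrite lerD2l lerDr.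
  have := hb j.+1 (i - j)%N; rewrite addSn subnKC ?(ltnW ij)// ltn_ord => /(_ isT).
  rewrite (_ : `|i - j|%N = (i - j)%N); last by lia.
  by rewrite covC => /le_trans; apply; rewrite lerD2l lerDl.
have -> : \sum_e p e * (\sum_(1 <= x < N.+1) X e x - N%:R * M) ^+ 2 =
    \sum_(i < N) \sum_(j < N) cov i.+1 j.+1.
  under eq_bigr do rewrite sqE mulr_sumr.
  rewrite exchange_big /=; apply: eq_bigr => i _.
  under eq_bigr do rewrite mulr_sumr.
  by rewrite exchange_big.
have V1 : \sum_(z < N) v z <= \sum_(z < N.+1) v z by exact: sum_ord_le.
have V2 : \sum_(z < N) v z.+1 <= \sum_(z < N.+1) v z by rewrite [leRHS]big_ord_recl /= lerDr.
move: V1 V2; set V := \sum_(z < N.+1) v z => V1 V2.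
apply: (@le_trans _ _ (\sum_(i < N) (2 * V + (N%:R * v i.+1 + V)))).
  apply: ler_sum => i _; apply: (@le_trans _ _ (\sum_(j < N)
      (v `|i - j|%N + (v i.+1 + v j.+1)))); first by apply: ler_sum => j _; exact: covB.
  rewrite big_split /= lerD//.
    by apply: le_trans (sum_dist_le v0 (ltn_ord i)) _; rewrite ler_wpM2l.
  by rewrite big_split /= sumr_const card_ord lerD// mulr_natl.
rewrite !big_split /= -!mulr_sumr !sumr_const card_ord.
rewrite -[V *+ N]mulr_natl.
have : N%:R * \sum_(i < N) v i.+1 <= N%:R * V by rewrite ler_wpM2l.
by move: (N%:R * \sum_(i < N) v i.+1) => a; lra.
Qed.

Lemma weighted_abs_le (Z : T -> R) (c : R) : (forall e, 0 <= p e) -> 0 < c ->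
  \sum_e p e * `|Z e| <= c + (\sum_e p e * Z e ^+ 2) / c.
Proof.
move=> p0 c0; rewrite -[X in X + _]mulr1 -p_sum mulr_sumr mulr_suml -big_split /=.
apply: ler_sum => e _; rewrite [c * _]mulrC -mulrA -mulrDr ler_wpM2l//.
rewrite -(ler_pM2r c0) mulrDl mulfVK ?gt_eqF// -(real_normK (num_real (Z e))).
have := normr_ge0 (Z e); move: `|Z e| => z z0.
by have := sqr_ge0 (z - c); have := sqr_ge0 z; nra.
Qed.

End finite_deviation.

(** * Mean square distance of the characteristic function from its limit *)

Section replica.
Context (R : realType) d (Om : measurableType d) (PP : probability Om R).
Context (Y : nat -> Om -> R).
Hypothesis iidY : iid_R PP Y 0.
Hypothesis symY : forall B : set R, measurable B ->
  PP (Y 0 @^-1` B) = PP ((fun w => - Y 0 w) @^-1` B).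
Hypothesis momY : forall k : nat, (1 <= k)%N ->
  PP.-integrable setT (fun w => (`|Y 0 w| ^+ k)%:E).
Hypothesis varY : (\int[PP]_w (Y 0 w ^+ 2)%:E = 1)%E.
Context (T : finType) (p : T -> R) (xi : T -> nat -> bool) (u : nat -> R) (mu : R).
Hypothesis p_ge0 : forall e, 0 <= p e.
Hypothesis p_sum : \sum_e p e = 1.
Hypothesis u01 : forall x, 0 <= u x <= 1.
Hypothesis mu01 : 0 <= mu <= 1.
Context (N : nat).
Hypothesis Exi : forall x, (x <= N)%N -> \sum_e p e * (xi e x)%:R = u x.
Hypothesis Exixi : forall x z, (x + z <= N)%N ->
  \sum_e p e * ((xi e x)%:R * (xi e (x + z)%N)%:R) = u x * u z.

Definition centered_walk (e : T) (om : Om) : R :=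
  \sum_(1 <= x < N.+1) ((xi e x)%:R - mu) * Y x om.

Let mY i : measurable_fun setT (Y i).
Proof. by have [+ _ _] := iidY; exact. Qed.

Let K := moment PP Y 0%N 4 + 1.

Let K0 : 0 <= K.
Proof. by rewrite addr_ge0// (moment_ge0 iidY symY momY). Qed.

Lemma centered_walk_cos (b : nat -> R) (tau : R) :
  (forall x, `|b x| <= 1) ->
  `|Ex PP (fun om => cos (tau * \sum_(1 <= x < N.+1) b x * Y x om))
    - expR (- (tau ^+ 2 * (\sum_(1 <= x < N.+1) b x ^+ 2) / 2))|
  <= K * (tau ^+ 4 * N%:R).
Proof.
move=> b1; have us : uniq (index_iota 1 N.+1) by exact: iota_uniq.
have := Ex_cos_sum_gauss iidY symY momY varY (fun x => tau * b x) us.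
rewrite (@eq_Ex _ _ _ PP _ (fun om => cos (tau * \sum_(1 <= x < N.+1) b x * Y x om))); last first.
  by move=> om; congr cos; rewrite mulr_sumr; apply: eq_bigr => x _; rewrite mulrA.
rewrite (eq_bigr (fun x => tau ^+ 2 * b x ^+ 2)); last by move=> x _; rewrite exprMn.
rewrite -mulr_sumr => /le_trans; apply; rewrite ler_wpM2l//.
rewrite (eq_bigr (fun x => tau ^+ 4 * b x ^+ 4)); last by move=> x _; rewrite exprMn.
rewrite -mulr_sumr ler_wpM2l//; first by rewrite (exprM _ 2 2) sqr_ge0.
apply: (@le_trans _ _ (\sum_(1 <= x < N.+1) 1)).
  apply: ler_sum => x _; have b40 : 0 <= b x ^+ 4 by rewrite (exprM _ 2 2) sqr_ge0.
  by rewrite -(ger0_norm b40) normrX exprn_ile1.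
by rewrite big_const_nat subSS subn0 iter_addr_0.
Qed.

(** Centered counts of the sites visited by one walk and of the sites common to two. Given the
    walks, the variances over the scenery of the sum and of the difference depend on nothing
    else. *)
Let A e := \sum_(1 <= x < N.+1) (xi e x)%:R - N%:R * mu.
Let B e e' := \sum_(1 <= x < N.+1) (xi e x)%:R * (xi e' x)%:R - N%:R * mu ^+ 2.

Lemma sites_deviation c : 0 < c ->
  \sum_e p e * `|A e| <= c + 4 * N%:R * (\sum_(z < N.+1) `|u z - mu|) / c.
Proof.
move=> c0; apply: le_trans (weighted_abs_le p_sum _ p_ge0 c0) _.
rewrite lerD2l ler_wpM2r ?invr_ge0 ?(ltW c0)//.
apply: (weighted_deviation p_sum (U := u) (X := fun e x => (xi e x)%:R)) => //.
by move=> x; have /andP[u0 u1] := u01 x; rewrite ger0_norm.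
Qed.

(** Pairs of walks get the product weight, and [weighted_deviation] applies with [U = u^2] and
    [M = mu^2]; the constant is 8 rather than 4 because [|u^2 - mu^2| <= 2 |u - mu|]. *)
Lemma replica_deviation c : 0 < c ->
  \sum_e p e * \sum_e' p e' * `|B e e'|
  <= c + 8 * N%:R * (\sum_(z < N.+1) `|u z - mu|) / c.
Proof.
move=> c0; have /andP[mu0 mu1] := mu01.
pose p2 (e : T * T) := p e.1 * p e.2.
have pair (F : T -> T -> R) : \sum_e p e * \sum_e' p e' * F e e' = \sum_e p2 e * F e.1 e.2.
  rewrite -(pair_bigA _ (fun e e' => p2 (e, e') * F e e')) /=; apply: eq_bigr => e _.
  by rewrite mulr_sumr; apply: eq_bigr => e' _; rewrite /p2 /= mulrA.
rewrite pair.
have prod (F G : T -> R) : \sum_e p2 e * (F e.1 * G e.2) =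
    (\sum_e p e * F e) * (\sum_e p e * G e).
  rewrite -(pair (fun e e' => F e * G e')) mulr_suml; apply: eq_bigr => e _.
  by rewrite -mulrA; congr (_ * _); rewrite mulr_sumr; apply: eq_bigr => e' _; ring.
have p2_sum : \sum_e p2 e = 1.
  have := prod (fun=> 1) (fun=> 1); rewrite (eq_bigr p2); last by move=> e _; rewrite !mulr1.
  by rewrite (eq_bigr p) ?p_sum ?mulr1// => e _; rewrite mulr1.
have p20 e : 0 <= p2 e by rewrite mulr_ge0.
apply: le_trans (weighted_abs_le p2_sum (fun e => B e.1 e.2) p20 c0) _.
rewrite lerD2l ler_wpM2r ?invr_ge0 ?(ltW c0)//.
apply: le_trans (weighted_deviation (X := fun e x => (xi e.1 x)%:R * (xi e.2 x)%:R)
  (U := fun x => u x ^+ 2) (N := N) p2_sum _ _ _ _) _.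
- by move=> x; have /andP[u0 u1] := u01 x; rewrite ger0_norm ?sqr_ge0// exprn_ile1.
- by rewrite sqr_ge0 exprn_ile1.
- by move=> x xN; rewrite (prod (fun e => (xi e x)%:R) (fun e => (xi e x)%:R)) Exi// expr2.
- move=> x z xzN; rewrite -exprMn expr2 -(Exixi xzN) -prod.
  by apply: eq_bigr => e _; ring.
have -> : 8 * N%:R * \sum_(z < N.+1) `|u z - mu| =
    4 * N%:R * \sum_(z < N.+1) 2 * `|u z - mu| by rewrite -mulr_sumr; ring.
rewrite ler_wpM2l ?mulr_ge0//; apply: ler_sum => z _.
have -> : u z ^+ 2 - mu ^+ 2 = (u z + mu) * (u z - mu) by ring.
have /andP[z0 z1] := u01 z.
by rewrite normrM ler_wpM2r// ger0_norm ?addr_ge0//; lra.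
Qed.

Definition phi_cos tau om := \sum_e p e * cos (tau * centered_walk e om).
Definition phi_sin tau om := \sum_e p e * sin (tau * centered_walk e om).

(* The squared modulus of a characteristic function is that of the difference of two
   independent copies of the walk, here in the same scenery. *)
Lemma phi_sqrD tau om : phi_cos tau om ^+ 2 + phi_sin tau om ^+ 2 =
  \sum_e p e * \sum_e' p e' * cos (tau * (centered_walk e om - centered_walk e' om)).
Proof.
rewrite /phi_cos /phi_sin !expr2 !mulr_suml -big_split /=; apply: eq_bigr => e _.
rewrite -!mulrA -mulrDr; congr (_ * _); rewrite [cos _ * _]mulr_sumr [sin _ * _]mulr_sumr -big_split /=.
by apply: eq_bigr => e' _; rewrite mulrBr cosB; ring.
Qed.

(** One has [|phi - c|^2 = (|phi|^2 - c^2) - 2 c (Re phi - c)]; the first bracket averages over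
    pairs of walks, the second over single ones. The Gaussian approximations cost [K tau^4 N] three
    times, once for pairs and twice for single walks as [c <= 1]. Replacing the random variances by
    their limits costs [tau^2] times the mean deviations of the site counts. *)
Lemma replica_bound (n t : R) (c := expR (- ((1 - mu) * t ^+ 2 / 2)))
    (tau := t / Num.sqrt n) delta :
  0 < n -> 0 < delta -> `|N%:R * mu - n| <= 1 ->
  Ex PP (fun om => (phi_cos tau om - c) ^+ 2 + phi_sin tau om ^+ 2) <=
  3 * K * (tau ^+ 4 * N%:R) +
  tau ^+ 2 * (3 * delta + 16 * N%:R * (\sum_(z < N.+1) `|u z - mu|) / delta + 2).
Proof.
move=> n0 delta0 hN; have /andP[mu0 mu1] := mu01.
have tau2 : tau ^+ 2 * n = t ^+ 2.
  by rewrite /tau exprMn exprVn sqr_sqrtr ?(ltW n0)// mulfVK// gt_eqF.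
have t0 : 0 <= tau ^+ 2 by exact: sqr_ge0.
have cpos : 0 <= c by exact: expR_ge0.
have c1 : c <= 1.
  by rewrite expR_le1 oppr_le0 divr_ge0// mulr_ge0 ?sqr_ge0// subr_ge0.
have q1 : `|(N%:R * mu - n) * (1 - mu)| <= 1.
  by rewrite normrM mulr_ile1// ger0_norm; lra.
set KN := K * (tau ^+ 4 * N%:R).
have KN0 : 0 <= KN by rewrite mulr_ge0// mulr_ge0// (exprM _ 2 2) sqr_ge0.
have mW e : measurable_fun setT (centered_walk e).
  by apply: measurable_sum => x; exact: measurable_funM.
have mWW e e' : measurable_fun setT (fun om => centered_walk e om - centered_walk e' om).
  exact: measurable_funB.
have bb e x : (xi e x)%:R ^+ 2 = (xi e x)%:R :> R.
  by case: (xi e x); rewrite ?expr1n ?expr0n.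
pose E1 e e' := Ex PP (fun om => cos (tau * (centered_walk e om - centered_walk e' om))).
pose E2 e := Ex PP (fun om => cos (tau * centered_walk e om)).
have i1 e e' : intble PP (fun om => cos (tau * (centered_walk e om - centered_walk e' om))).
  exact: intble_cosM (mWW e e').
have i2 e : intble PP (fun om => cos (tau * centered_walk e om)).
  exact: intble_cosM (mW e).
have step1 : Ex PP (fun om => (phi_cos tau om - c) ^+ 2 + phi_sin tau om ^+ 2) =
    \sum_e p e * \sum_e' p e' * (E1 e e' - c ^+ 2) - 2 * c * \sum_e p e * (E2 e - c).
  rewrite (@eq_Ex _ _ _ PP _ (fun om => (\sum_e p e * \sum_e' p e' *
      cos (tau * (centered_walk e om - centered_walk e' om)))
      - (2 * c * phi_cos tau om - c ^+ 2))); last first.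
    by move=> om; rewrite -phi_sqrD; ring.
  have j1 e : intble PP (fun om => \sum_e' p e' *
      cos (tau * (centered_walk e om - centered_walk e' om))).
    by apply: intble_sum => e' _; exact: intbleZ.
  have j2 : intble PP (fun om => phi_cos tau om).
    by apply: intble_sum => e _; exact: intbleZ.
  have j3 : intble PP (fun om => 2 * c * phi_cos tau om) by exact: intbleZ.
  rewrite ExB; last 2 first.
  - by apply: intble_sum => e _; exact: intbleZ.
  - by apply: intbleB => //; exact: intble_cst.
  rewrite (ExB j3 (intble_cst PP _)) (ExZ _ j2) Ex_cst Ex_sum; last by move=> e _; exact: intbleZ.
  rewrite /phi_cos Ex_sum; last by move=> e _; exact: intbleZ.
  rewrite [X in X - _](eq_bigr (fun e => p e * \sum_e' p e' * E1 e e')); last first.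
    move=> e _; rewrite ExZ// Ex_sum; last by move=> e' _; exact: intbleZ.
    by congr (_ * _); apply: eq_bigr => e' _; rewrite ExZ.
  rewrite [X in _ - (2 * c * X - _)](eq_bigr (fun e => p e * E2 e)); last first.
    by move=> e _; rewrite ExZ.
  have -> : \sum_e p e * (\sum_e' p e' * (E1 e e' - c ^+ 2)) =
      \sum_e p e * (\sum_e' p e' * E1 e e') - c ^+ 2.
    rewrite (eq_bigr (fun e => p e * (\sum_e' p e' * E1 e e') - p e * c ^+ 2)).
      by rewrite sumrB -mulr_suml p_sum mul1r.
    move=> e _; rewrite -mulrBr; congr (_ * _).
    under eq_bigr do rewrite mulrBr.
    by rewrite sumrB -mulr_suml p_sum mul1r.
  have -> : \sum_e p e * (E2 e - c) = \sum_e p e * E2 e - c.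
    under eq_bigr do rewrite mulrBr.
    by rewrite sumrB -mulr_suml p_sum mul1r.
  by ring.
have step2 e e' : E1 e e' - c ^+ 2 <=
    KN + tau ^+ 2 * ((`|A e| + `|A e'|) / 2 + `|B e e'| + 1).
  have := @centered_walk_cos (fun x => (xi e x)%:R - (xi e' x)%:R) tau.
  set S := \sum_(1 <= x < N.+1) ((xi e x)%:R - (xi e' x)%:R) ^+ 2.
  rewrite (@eq_Ex _ _ _ PP _ (fun om => cos (tau * (centered_walk e om - centered_walk e' om)))); last first.
    move=> om; congr (cos (_ * _)); rewrite /centered_walk -sumrB.
    by apply: eq_bigr => x _; ring.
  move=> h.
  have {}h : `|E1 e e' - expR (- (tau ^+ 2 * S / 2))| <= KN.
    by apply: h => x; case: (xi e x); case: (xi e' x);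
      rewrite ?subrr ?subr0 ?sub0r ?normrN ?normr1 ?normr0.
  (* Indicators satisfy [(x - y)^2 = x + y - 2 x y]. The main part [2 N mu (1 - mu)] is about
     [2 n (1 - mu)], twice that of one walk, which produces [c^2]. *)
  have SE : S = A e + A e' - 2 * B e e' + 2 * (N%:R * mu) - 2 * (N%:R * mu ^+ 2).
    rewrite /S (eq_bigr (fun x => (xi e x)%:R + (xi e' x)%:R - 2 * ((xi e x)%:R * (xi e' x)%:R))).
      by rewrite sumrB big_split /= -mulr_sumr /A /B; ring.
    by move=> x _; rewrite sqrrB !bb -[_ *+ 2]mulr_natl; ring.
  have S0 : 0 <= S by apply: sumr_ge0 => x _; exact: sqr_ge0.
  have -> : c ^+ 2 = expR (- ((1 - mu) * t ^+ 2)).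
    by rewrite /c expr2 -expRD; congr expR; lra.
  have h2 := @expRN_dist _ (tau ^+ 2 * S / 2) ((1 - mu) * t ^+ 2).
  have {}h2 : `|expR (- (tau ^+ 2 * S / 2)) - expR (- ((1 - mu) * t ^+ 2))| <=
      `|tau ^+ 2 * S / 2 - (1 - mu) * t ^+ 2|.
    by apply: h2; [rewrite divr_ge0// mulr_ge0|rewrite mulr_ge0 ?sqr_ge0// subr_ge0].
  have h3 : `|tau ^+ 2 * S / 2 - (1 - mu) * t ^+ 2| <=
      tau ^+ 2 * ((`|A e| + `|A e'|) / 2 + `|B e e'| + 1).
    have -> : tau ^+ 2 * S / 2 - (1 - mu) * t ^+ 2 = tau ^+ 2 *
      ((A e + A e') / 2 - B e e' + (N%:R * mu - n) * (1 - mu)).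
      by rewrite -tau2 SE; field.
    rewrite normrM ger0_norm// ler_wpM2l//.
    apply: le_trans (ler_normD _ _) _; rewrite lerD//.
    apply: le_trans (ler_normB _ _) _; rewrite lerD2r normrM [`|2^-1|]ger0_norm//.
    by rewrite ler_wpM2r// ler_normD.
  move: h h2; rewrite !ler_norml => /andP[_ h] /andP[_ h2].
  by move: h3; move: `|tau ^+ 2 * S / 2 - _| h2 => z h2 h3; lra.
have step3 e : `|E2 e - c| <= KN + tau ^+ 2 * ((`|A e| + 1) / 2).
  have := @centered_walk_cos (fun x => (xi e x)%:R - mu) tau.
  set S := \sum_(1 <= x < N.+1) ((xi e x)%:R - mu) ^+ 2.
  move=> h; have {}h : `|E2 e - expR (- (tau ^+ 2 * S / 2))| <= KN.
    apply: h => x; case: (xi e x); rewrite ler_norml /=; lra.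
  (* Here [(x - mu)^2 = (1 - 2 mu) x + mu^2] for an indicator [x]. *)
  have SE : S = A e * (1 - 2 * mu) + N%:R * mu - N%:R * mu ^+ 2.
    rewrite /S (eq_bigr (fun x => (xi e x)%:R * (1 - 2 * mu) + mu ^+ 2)).
      rewrite big_split /= -mulr_suml big_const_nat subSS subn0 iter_addr_0 /A.
      by rewrite -[mu ^+ 2 *+ N]mulr_natl; ring.
    by move=> x _; rewrite sqrrB bb -[_ *+ 2]mulr_natl; ring.
  have S0 : 0 <= S by apply: sumr_ge0 => x _; exact: sqr_ge0.
  have h2 := @expRN_dist _ (tau ^+ 2 * S / 2) ((1 - mu) * t ^+ 2 / 2).
  have {}h2 : `|expR (- (tau ^+ 2 * S / 2)) - c| <=
      `|tau ^+ 2 * S / 2 - (1 - mu) * t ^+ 2 / 2|.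
    by apply: h2; [rewrite divr_ge0// mulr_ge0
                  |rewrite divr_ge0// mulr_ge0 ?sqr_ge0// subr_ge0].
  have h3 : `|tau ^+ 2 * S / 2 - (1 - mu) * t ^+ 2 / 2| <=
      tau ^+ 2 * ((`|A e| + 1) / 2).
    have -> : tau ^+ 2 * S / 2 - (1 - mu) * t ^+ 2 / 2 = tau ^+ 2 *
      ((A e * (1 - 2 * mu) + (N%:R * mu - n) * (1 - mu)) / 2).
      by rewrite -tau2 SE; field.
    rewrite normrM ger0_norm// ler_wpM2l// normrM [`|2^-1|]ger0_norm// ler_wpM2r//.
    apply: le_trans (ler_normD _ _) _; rewrite lerD//.
    by rewrite normrM ler_piMr// ler_norml; lra.
  have -> : E2 e - c = (E2 e - expR (- (tau ^+ 2 * S / 2))) + (expR (- (tau ^+ 2 * S / 2)) - c).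
    by ring.
  by apply: le_trans (ler_normD _ _) _; rewrite lerD// (le_trans h2).
rewrite step1.
pose a := \sum_e p e * `|A e|.
pose b := \sum_e p e * \sum_e' p e' * `|B e e'|.
have avg (F : T -> R) (x y : R) : \sum_e p e * (x + y * F e) = x + y * \sum_e p e * F e.
  rewrite (eq_bigr (fun e => p e * x + y * (p e * F e))); last by move=> e _; ring.
  by rewrite big_split /= -mulr_suml p_sum mul1r -mulr_sumr.
have s2 : \sum_e p e * \sum_e' p e' * (E1 e e' - c ^+ 2) <=
    KN + tau ^+ 2 * (a + b + 1).
  apply: (@le_trans _ _ (\sum_e p e * (KN + tau ^+ 2 *
     (`|A e| / 2 + a / 2 + \sum_e' p e' * `|B e e'| + 1)))).
    apply: ler_sum => e _; rewrite ler_wpM2l//.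
    apply: (@le_trans _ _ (\sum_e' p e' * (KN + tau ^+ 2 *
      ((`|A e| + `|A e'|) / 2 + `|B e e'| + 1)))).
      by apply: ler_sum => e' _; rewrite ler_wpM2l.
    rewrite avg lerD2l ler_wpM2l//.
    rewrite (eq_bigr (fun e' => p e' * (`|A e| / 2 + 1) + (p e' * `|A e'|) / 2 + p e' * `|B e e'|));
      last by move=> e' _; field.
    by rewrite !big_split /= -!mulr_suml p_sum mul1r -/a; lra.
  rewrite avg lerD2l ler_wpM2l//.
  rewrite (eq_bigr (fun e => (p e * `|A e|) / 2 + p e * (a / 2 + 1) +
    p e * \sum_e' p e' * `|B e e'|)); last by move=> e _; field.
  by rewrite !big_split /= -!mulr_suml p_sum mul1r -/a -/b; lra.
have s3 : `|\sum_e p e * (E2 e - c)| <= KN + tau ^+ 2 * ((a + 1) / 2).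
  apply: le_trans (ler_norm_sum _ _ _) _.
  apply: (@le_trans _ _ (\sum_e p e * (KN + tau ^+ 2 * ((`|A e| + 1) / 2)))).
    by apply: ler_sum => e _; rewrite normrM ger0_norm// ler_wpM2l.
  rewrite avg lerD2l ler_wpM2l//.
  rewrite (eq_bigr (fun e => (p e * `|A e|) / 2 + p e / 2)); last by move=> e _; field.
  by rewrite big_split /= -!mulr_suml p_sum -/a; lra.
have hA := sites_deviation delta0; have hB := replica_deviation delta0.
set V := \sum_(z < N.+1) `|u z - mu| in hA hB *.
have s4 : - (2 * c * \sum_e p e * (E2 e - c)) <= 2 * (KN + tau ^+ 2 * ((a + 1) / 2)).
  apply: le_trans (ler_norm _) _; rewrite normrN !normrM ger0_norm// (ger0_norm cpos).
  by rewrite -mulrA ler_wpM2l// -[leRHS]mul1r ler_pM.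
have hab : 2 * a + b + 2 <= 3 * delta + 16 * N%:R * V / delta + 2.
  have -> : 16 * N%:R * V / delta = 2 * (4 * N%:R * V / delta) + 8 * N%:R * V / delta.
    by field; rewrite gt_eqF.
  move: hA hB; rewrite -/a -/b; move: (4 * N%:R * V / delta) (8 * N%:R * V / delta).
  by move: a b {s2 s3 s4} => a b z1 z2; lra.
apply: le_trans (lerD s2 s4) _.
have -> : KN + tau ^+ 2 * (a + b + 1) + 2 * (KN + tau ^+ 2 * ((a + 1) / 2)) =
  3 * KN + tau ^+ 2 * (2 * a + b + 2) by field.
by rewrite -[3 * K * _]mulrA lerD2l ler_wpM2l.
Qed.

End replica.

(** * Reduction to finitely many configurations *)

Section configurations.
Context (R : realType) d (T : measurableType d) (P : probability T R).
Context (X : nat -> T -> nat).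
Hypothesis iidX : iid_N P X.
Hypothesis X_gt0 : forall i w, (0 < X i w)%N.
Context (N : nat).

(* The walk enters only through the set of sites up to [N] that it visits, which makes its
   expectations finite sums. *)
Definition config (w : T) : {ffun 'I_N.+1 -> bool} :=
  [ffun x : 'I_N.+1 => visited X x w].

Definition config_weight (e : {ffun 'I_N.+1 -> bool}) : R :=
  Ex P (fun w => (config w == e)%:R).

Definition occupied (e : {ffun 'I_N.+1 -> bool}) (x : nat) : bool := e (inord x).

Lemma occupied_config x w : (x <= N)%N -> occupied (config w) x = visited X x w.
Proof. by move=> xN; rewrite /occupied ffunE inordK. Qed.

Lemma measurable_config e : measurable_fun setT (fun w => (config w == e)%:R : R).
Proof.
rewrite (_ : (fun w => _) = fun w => \prod_(x < N.+1) (visited X x w == e x)%:R).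
  apply: measurable_prod => x _.
  case: (e x); last first.
    rewrite (_ : (fun w => _) = fun w => 1 - (visited X x w)%:R).
      by apply: measurable_funB => //; exact: (measurable_visited iidX X_gt0).
    by apply/funext => w; case: visited; rewrite ?subr0 ?subrr.
  rewrite (_ : (fun w => _) = fun w => (visited X x w)%:R).
    exact: (measurable_visited iidX X_gt0).
  by apply/funext => w; case: visited.
apply/funext => w; case: (eqVneq (config w) e) => [<-|ne].
  by rewrite big1// => x _; rewrite ffunE eqxx.
have [x xe] : exists x : 'I_N.+1, visited X x w != e x.
  apply: contrapT => /forallNP h; move/eqP: ne; apply; apply/ffunP => x; rewrite ffunE.
  by have /negP := h x; rewrite negbK => /eqP.
by rewrite (bigD1 x)//= (negbTE xe) mul0r.
Qed.

Lemma Ex_config (F : {ffun 'I_N.+1 -> bool} -> R) :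
  intble P (fun w => F (config w)) /\
  Ex P (fun w => F (config w)) = \sum_e config_weight e * F e.
Proof.
have FE : (fun w => F (config w)) = fun w => \sum_e F e * (config w == e)%:R.
  apply/funext => w; rewrite (bigD1 (config w))//= eqxx mulr1 big1 ?addr0// => e ne.
  by rewrite eq_sym (negbTE ne) mulr0.
have ie e : intble P (fun w => (config w == e)%:R) by exact: (intble_bool P (measurable_config e)).
rewrite FE; split; first by apply: intble_sum => e _; exact: intbleZ.
rewrite Ex_sum; last by move=> e _; exact: intbleZ.
by apply: eq_bigr => e _; rewrite ExZ// mulrC.
Qed.

Lemma config_weight_ge0 e : 0 <= config_weight e.
Proof. exact: Ex_ge0. Qed.

Lemma sum_config_weight : \sum_e config_weight e = 1.
Proof.
have [_] := Ex_config (fun=> 1); rewrite Ex_cst => ->.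
by apply: eq_bigr => e _; rewrite mulr1.
Qed.

Lemma config_occupied x : (x <= N)%N ->
  \sum_e config_weight e * (occupied e x)%:R = hit P X x.
Proof.
move=> xN; rewrite -(Ex_config (fun e => (occupied e x)%:R)).2.
by apply: eq_Ex => w; rewrite occupied_config.
Qed.

Lemma config_occupied2 x z : (x + z <= N)%N ->
  \sum_e config_weight e * ((occupied e x)%:R * (occupied e (x + z)%N)%:R) =
  hit P X x * hit P X z.
Proof.
move=> xzN; rewrite -(Ex_config (fun e => (occupied e x)%:R * (occupied e (x + z)%N)%:R)).2.
rewrite -(Ex_visited2 iidX X_gt0); apply: eq_Ex => w.
by rewrite !occupied_config//; lia.
Qed.

End configurations.

(** * Rates in mean over the scenery *)

Section quenched.
Context (R : realType) d (Om : measurableType d) (PP : probability Om R).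
Context (Y : nat -> Om -> R).
Hypothesis iidY : iid_R PP Y 0.
Hypothesis symY : forall B : set R, measurable B ->
  PP (Y 0 @^-1` B) = PP ((fun w => - Y 0 w) @^-1` B).
Hypothesis momY : forall k : nat, (1 <= k)%N ->
  PP.-integrable setT (fun w => (`|Y 0 w| ^+ k)%:E).
Hypothesis varY : (\int[PP]_w (Y 0 w ^+ 2)%:E = 1)%E.
Context d' (Om' : measurableType d') (P : probability Om' R).
Context (X : nat -> Om' -> nat).
Hypothesis iidX : iid_N P X.
Hypothesis X_gt0 : forall i w, (0 < X i w)%N.
Hypothesis X_aperiodic : aperiodic (support_N P (X 0)).
Hypothesis X_intble : intble P (fun w => (X 0 w)%:R).
Hypothesis X2_intble : intble P (fun w => (X 0 w)%:R ^+ 2).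

Let m : R := Ex P (fun w => (X 0 w)%:R).
Let mu := m^-1.

Definition horizon (n : nat) : nat := Num.truncn (n%:R * m).

Definition fluct (n : nat) (om : Om) (w : Om') : R :=
  \sum_(1 <= x < (horizon n).+1) ((visited X x w)%:R - mu) * Y x om.

Let mY i : measurable_fun setT (Y i).
Proof. by have [+ _ _] := iidY; exact. Qed.

Lemma mean_bounds : [/\ 1 <= m, 0 < m, 0 <= mu <= 1 & m * mu = 1].
Proof.
have m1 : 1 <= m := mean_ge1 X_gt0 X_intble; have m0 : 0 < m by lra.
split=> //; last by rewrite /mu mulfV// gt_eqF.
by rewrite invr_ge0 ltW//= invf_le1.
Qed.

Lemma horizon_bounds n : (horizon n)%:R <= n%:R * m < (horizon n)%:R + 1.
Proof.
have [_ m0 _ _] := mean_bounds; rewrite natr1; apply: Num.Theory.truncn_itv.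
by rewrite mulr_ge0// ltW.
Qed.

Lemma horizon_mu n : `|(horizon n)%:R * mu - n%:R| <= 1.
Proof.
have [m1 m0 /andP[mu0 mu1] mmu] := mean_bounds; have /andP[h1 h2] := horizon_bounds n.
have -> : (horizon n)%:R * mu - n%:R = ((horizon n)%:R - n%:R * m) * mu.
  by rewrite mulrBl -[in RHS]mulrA mmu mulr1.
by rewrite normrM (ger0_norm mu0); apply: mulr_ile1 => //; rewrite ler_norml; lra.
Qed.

Let W n (e : {ffun 'I_(horizon n).+1 -> bool}) om :=
  centered_walk Y (@occupied (horizon n)) mu (horizon n) e om.

Lemma fluct_config n om w : fluct n om w = W (config X (horizon n) w) om.
Proof.
rewrite /fluct /W /centered_walk; apply: eq_big_nat => x /andP[_ xN].
by rewrite occupied_config.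
Qed.

Let weight n := config_weight P X (N := horizon n).

Lemma Ex_fluct n om (g : R -> R) :
  intble P (fun w => g (fluct n om w)) /\
  Ex P (fun w => g (fluct n om w)) = \sum_(e : {ffun 'I_(horizon n).+1 -> bool}) weight e * g (W e om) :> R.
Proof.
have := Ex_config iidX X_gt0 (N := horizon n) (fun e => g (W e om)).
by rewrite (_ : (fun w => g (W (config X (horizon n) w) om)) =
  (fun w => g (fluct n om w)))//; apply/funext => w; rewrite fluct_config.
Qed.

Lemma measurable_W n (e : {ffun 'I_(horizon n).+1 -> bool}) : measurable_fun setT (W e).
Proof. by apply: measurable_sum => x; exact: measurable_funM. Qed.

Lemma measurable_Ex_fluct n (g : R -> R) : measurable_fun setT g ->
  measurable_fun setT (fun om => Ex P (fun w => g (fluct n om w))).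
Proof.
move=> mg; rewrite (_ : (fun om => _) = fun om => \sum_(e : {ffun 'I_(horizon n).+1 -> bool}) weight e * g (W e om)).
  apply: measurable_sum => e; apply: measurable_funM => //.
  exact: (measurableT_comp mg (measurable_W e)).
by apply/funext => om; rewrite (Ex_fluct n om g).2.
Qed.

Definition fluct_cos (n : nat) (t : R) (om : Om) : R :=
  Ex P (fun w => cos (t / Num.sqrt n%:R * fluct n om w)).
Definition fluct_sin (n : nat) (t : R) (om : Om) : R :=
  Ex P (fun w => sin (t / Num.sqrt n%:R * fluct n om w)).
Definition gauss_char (t : R) : R := expR (- ((1 - mu) * t ^+ 2 / 2)).

(** Each term is at most [r^-2 + r^2 (hit - mu)^2]. The horizon is [O(r^8)], so the first part sums
    to [O(r^6)]; by [hit_l2] the second sums to [r^2] times the square root of the horizon, again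
    [O(r^6)]. Taking [n = r^8] keeps these exponents integers. *)
Lemma hit_deviation_sum : exists2 C, 0 <= C & forall r n : nat, (0 < r)%N -> n = (r ^ 8)%N ->
  \sum_(z < (horizon n).+1) `|hit P X z - mu| <= C * r%:R ^+ 6.
Proof.
have [C C0 hC] := hit_l2 iidX X_gt0 X_aperiodic X_intble X2_intble.
have [m1 m0 /andP[mu0 mu1] mmu] := mean_bounds.
exists ((m + 1) * (1 + C)); first by rewrite mulr_ge0 ?addr_ge0// ltW.
move=> r n r0 nE; have /andP[h1 _] := horizon_bounds n.
have r1 : 1 <= r%:R :> R by rewrite ler1n.
have rp : 0 < r%:R :> R by lra.
have rn k : 0 < r%:R ^+ k :> R by rewrite exprn_gt0.
have nR : n%:R = r%:R ^+ 8 :> R by rewrite nE natrX.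
have hN : (horizon n).+1%:R <= (m + 1) * r%:R ^+ 8.
  have : 1 <= r%:R ^+ 8 :> R by rewrite exprn_ege1.
  by rewrite -natr1 -nR; move: h1; lra.
have hs : Num.sqrt (horizon n).+1%:R <= (m + 1) * r%:R ^+ 4.
  rewrite -(@ler_pXn2r _ 2) ?nnegrE ?sqrtr_ge0 ?mulr_ge0 ?addr_ge0 ?(ltW m0) ?exprn_ge0//.
  rewrite sqr_sqrtr// exprMn -exprM (le_trans hN)// ler_wpM2r ?exprn_ge0//.
  by rewrite expr2; nra.
have := hC (horizon n).+1; rewrite -/m -/mu => {}hC.
set v := fun z : nat => `|hit P X z - mu|.
apply: (@le_trans _ _ (\sum_(z < (horizon n).+1) ((r%:R ^+ 2)^-1 + r%:R ^+ 2 * (hit P X z - mu) ^+ 2))).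
  apply: ler_sum => z _; rewrite -(ler_pM2r (rn 2%N)) mulrDl mulVf ?gt_eqF//.
  rewrite -[(_ - mu) ^+ 2]real_normK ?num_real//; move: `|_| (normr_ge0 (hit P X z - mu)) => a a0.
  move: (r%:R ^+ 2) (rn 2%N) => q q0; have := sqr_ge0 (a * q - 1); rewrite sqrrB; nra.
rewrite big_split /= sumr_const card_ord -mulr_sumr.
apply: (@le_trans _ _ ((m + 1) * r%:R ^+ 6 + r%:R ^+ 2 * (C * ((m + 1) * r%:R ^+ 4)))).
  apply: lerD.
    by rewrite -[_^-1 *+ _]mulr_natl ler_pdivrMr// -mulrA -exprD.
  rewrite ler_wpM2l ?exprn_ge0//; apply: le_trans hC _; exact: ler_wpM2l.
by rewrite le_eqVlt; apply/orP; left; apply/eqP; ring.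
Qed.

Lemma quenched_char_rate : exists2 C, 0 <= C & forall r n : nat, (0 < r)%N -> n = (r ^ 8)%N ->
  forall t, Ex PP (fun om => (fluct_cos n t om - gauss_char t) ^+ 2 + fluct_sin n t om ^+ 2)
    <= C * (1 + t ^+ 4) / r%:R.
Proof.
have [C C0 hC] := hit_deviation_sum; have [m1 m0 /andP[mu0 mu1] mmu] := mean_bounds.
set K := moment PP Y 0%N 4 + 1.
have K0 : 0 <= K by rewrite addr_ge0// (moment_ge0 iidY symY momY).
exists (3 * K * m + 5 + 16 * m * C).
  by rewrite !addr_ge0// !mulr_ge0// ltW.
move=> r n r0 nE t; have /andP[h1 _] := horizon_bounds n.
have r1 : 1 <= r%:R :> R by rewrite ler1n.
have rp : 0 < r%:R :> R by lra.
have rn k : 0 < r%:R ^+ k :> R by rewrite exprn_gt0.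
have nR : n%:R = r%:R ^+ 8 :> R by rewrite nE natrX.
have n0 : 0 < n%:R :> R by rewrite nR.
have u01 x : 0 <= hit P X x <= 1.
  rewrite Ex_ge0//= -[leRHS](Ex_cst P); apply: le_Ex => //.
  - exact: (intble_bool P (measurable_visited iidX X_gt0 _)).
  - exact: intble_cst.
  - by move=> w; case: visited.
(* The choice [delta = r^7] balances [delta] with [N V / delta], as [N V] is [O(r^14)]; the factor
   [tau^2 = t^2 / r^8] then leaves [t^2 / r]. *)
have := @replica_bound R _ _ PP Y iidY symY momY varY _ (@weight n) (@occupied (horizon n))
  (hit P X) mu (@config_weight_ge0 R _ _ P X _) (sum_config_weight iidX X_gt0 _) u01
  _ (horizon n) (@config_occupied _ _ _ P X iidX X_gt0 _)
  (@config_occupied2 _ _ _ P X iidX X_gt0 _) n%:R t (r%:R ^+ 7) n0 (rn 7%N) (horizon_mu n).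
rewrite mu0 mu1 => /(_ isT); set V := \sum_(z < _) _; set tau := t / _.
have hV : V <= C * r%:R ^+ 6 := hC r n r0 nE.
rewrite (@eq_Ex _ _ _ PP _ (fun om => (fluct_cos n t om - gauss_char t) ^+ 2 + fluct_sin n t om ^+ 2)); last first.
  by move=> om; rewrite /fluct_cos /fluct_sin (Ex_fluct n om (fun z => cos (tau * z))).2
    (Ex_fluct n om (fun z => sin (tau * z))).2.
move=> /le_trans; apply; rewrite -/K.
have tau2 : tau ^+ 2 = t ^+ 2 / r%:R ^+ 8.
  by rewrite /tau exprMn exprVn sqr_sqrtr ?(ltW n0)// nR.
have t4 : 0 <= t ^+ 4 by rewrite (exprM _ 2 2) sqr_ge0.
have t2 : 0 <= t ^+ 2 by exact: sqr_ge0.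
have t24 : t ^+ 2 <= 1 + t ^+ 4.
  by rewrite (exprM _ 2 2); have := sqr_ge0 (t ^+ 2 - 1); rewrite sqrrB; nra.
have a1 : tau ^+ 4 * (horizon n)%:R <= m * t ^+ 4 / r%:R.
  rewrite (exprM _ 2 2) tau2 exprMn -exprM -[leLHS]mulrA.
  apply: (@le_trans _ _ (t ^+ 4 * ((r%:R ^+ 8)^-1 ^+ 2 * (r%:R ^+ 8 * m)))).
    by apply: ler_wpM2l => //; apply: ler_wpM2l; [exact: sqr_ge0|rewrite -nR].
  have -> : t ^+ 4 * ((r%:R ^+ 8)^-1 ^+ 2 * (r%:R ^+ 8 * m)) = m * t ^+ 4 / r%:R ^+ 8.
    by field; rewrite gt_eqF.
  apply: ler_wpM2l; first by apply: mulr_ge0 => //; exact: ltW.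
  rewrite lef_pV2 ?posrE//.
  by rewrite -[leLHS]expr1 ler_weXn2l.
have a2 : 3 * r%:R ^+ 7 + 16 * (horizon n)%:R * V / r%:R ^+ 7 + 2 <=
    (5 + 16 * m * C) * r%:R ^+ 7.
  have e1 : 1 <= r%:R ^+ 7 :> R by rewrite exprn_ege1.
  suff : 16 * (horizon n)%:R * V / r%:R ^+ 7 <= 16 * m * C * r%:R ^+ 7 by lra.
  rewrite ler_pdivrMr//.
  apply: (@le_trans _ _ (16 * (r%:R ^+ 8 * m) * (C * r%:R ^+ 6))).
    rewrite ler_pM ?mulr_ge0 ?sumr_ge0//.
    by rewrite -nR ler_wpM2l.
  by rewrite le_eqVlt; apply/orP; left; apply/eqP; ring.
apply: (@le_trans _ _ (3 * K * (m * t ^+ 4 / r%:R) +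
    t ^+ 2 / r%:R ^+ 8 * ((5 + 16 * m * C) * r%:R ^+ 7))).
  by rewrite -tau2; apply: lerD; apply: ler_wpM2l; rewrite ?sqr_ge0// mulr_ge0.
have -> : t ^+ 2 / r%:R ^+ 8 * ((5 + 16 * m * C) * r%:R ^+ 7) = (5 + 16 * m * C) * t ^+ 2 / r%:R.
  by field; rewrite gt_eqF.
have -> : 3 * K * (m * t ^+ 4 / r%:R) + (5 + 16 * m * C) * t ^+ 2 / r%:R =
  (3 * K * m * t ^+ 4 + (5 + 16 * m * C) * t ^+ 2) / r%:R by ring.
rewrite ler_wpM2r ?invr_ge0 ?(ltW rp)//.
have h5 : 0 <= 5 + 16 * m * C by rewrite addr_ge0// !mulr_ge0// ltW.
have h6 : 0 <= 3 * K * m by rewrite !mulr_ge0// ltW.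
have := ler_wpM2l h5 t24; have := ler_wpM2l h6 (_ : t ^+ 4 <= 1 + t ^+ 4).
rewrite lerDr ler01 => /(_ isT) k1 k2.
rewrite -[3 * K * m + 5 + _]addrA [leRHS]mulrDl; exact: lerD.
Qed.

(** The quenched mean is a linear combination of the scenery with coefficients [hit - mu], so its
    mean square is [1/n] times the sum of their squares, which is [O(1 / sqrt n)] by [hit_l2]:
    subtracting [mu] has already done the work of the centering. *)
Lemma quenched_mean_rate : exists2 C, 0 <= C & forall r n : nat, (0 < r)%N -> n = (r ^ 8)%N ->
  intble PP (fun om => Ex P (fun w => (Num.sqrt n%:R)^-1 * fluct n om w) ^+ 2) /\
  Ex PP (fun om => Ex P (fun w => (Num.sqrt n%:R)^-1 * fluct n om w) ^+ 2) <= C / r%:R.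
Proof.
have [C C0 hC] := hit_l2 iidX X_gt0 X_aperiodic X_intble X2_intble.
have [m1 m0 /andP[mu0 mu1] mmu] := mean_bounds.
exists (C * (m + 1)); first by rewrite mulr_ge0// addr_ge0// ltW.
move=> r n r0 nE; have /andP[h1 _] := horizon_bounds n.
have r1 : 1 <= r%:R :> R by rewrite ler1n.
have rp : 0 < r%:R :> R by lra.
have rn k : 0 < r%:R ^+ k :> R by rewrite exprn_gt0.
have nR : n%:R = r%:R ^+ 8 :> R by rewrite nE natrX.
have n0 : 0 < n%:R :> R by rewrite nR.
have eqW om : Ex P (fun w => (Num.sqrt n%:R)^-1 * fluct n om w) ^+ 2 =
    n%:R^-1 * (\sum_(1 <= x < (horizon n).+1) (hit P X x - mu) * Y x om) ^+ 2.
  rewrite ExZ; last exact: (Ex_fluct n om id).1.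
  rewrite exprMn exprVn sqr_sqrtr ?(ltW n0)//; congr (_ * _ ^+ 2).
  have iv x : intble P (fun w => (visited X x w)%:R).
    exact: (intble_bool P (measurable_visited iidX X_gt0 _)).
  have ivm x : intble P (fun w => Y x om * ((visited X x w)%:R - mu)).
    by apply: intbleZ; apply: intbleB => //; exact: intble_cst.
  rewrite (@eq_Ex _ _ _ P _ (fun w => \sum_(1 <= x < (horizon n).+1) Y x om * ((visited X x w)%:R - mu))).
    rewrite Ex_sum//; apply: eq_bigr => x _.
    rewrite ExZ; last by apply: intbleB => //; exact: intble_cst.
    by rewrite (ExB (iv x) (intble_cst P mu)) Ex_cst mulrC.
  by move=> w; apply: eq_bigr => x _; rewrite mulrC.
have us : uniq (index_iota 1 (horizon n).+1) by exact: iota_uniq.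
have i2 := lincomb_power iidY momY (fun x => hit P X x - mu) 2 us.
split; first by apply: (eq_intble (fun om => esym (eqW om))); exact: intbleZ.
rewrite (eq_Ex _ eqW) ExZ//.
rewrite (Ex_lincomb_sqr iidY symY momY varY _ us).
apply: (@le_trans _ _ (n%:R^-1 * (C * Num.sqrt (horizon n).+1%:R))).
  rewrite ler_wpM2l ?invr_ge0 ?(ltW n0)//; apply: le_trans (hC _).
  by rewrite -(big_mkord xpredT (fun x => (hit P X x - mu) ^+ 2)) [leRHS]big_nat_recl//
    big_add1 /= lerDr sqr_ge0.
have hN : (horizon n).+1%:R <= (m + 1) * r%:R ^+ 8.
  have : 1 <= r%:R ^+ 8 :> R by rewrite exprn_ege1.
  by rewrite -natr1 -nR; move: h1; lra.
have hs : Num.sqrt (horizon n).+1%:R <= (m + 1) * r%:R ^+ 4.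
  rewrite -(@ler_pXn2r _ 2) ?nnegrE ?sqrtr_ge0 ?mulr_ge0 ?addr_ge0 ?(ltW m0) ?exprn_ge0//.
  rewrite sqr_sqrtr// exprMn -exprM (le_trans hN)// ler_wpM2r ?exprn_ge0//.
  by rewrite expr2; nra.
apply: (@le_trans _ _ (n%:R^-1 * (C * ((m + 1) * r%:R ^+ 4)))).
  by rewrite ler_wpM2l ?invr_ge0 ?(ltW n0)// ler_wpM2l.
have -> : n%:R^-1 * (C * ((m + 1) * r%:R ^+ 4)) = C * (m + 1) / r%:R ^+ 4.
  by rewrite nR; field; rewrite gt_eqF.
apply: ler_wpM2l; first by rewrite mulr_ge0 ?addr_ge0 ?(ltW m0).
rewrite lef_pV2 ?posrE//.
by rewrite -[leLHS]expr1 ler_weXn2l.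
Qed.

Lemma intble_Ex_fluct_power n c k :
  intble PP (fun om => Ex P (fun w => (c * fluct n om w) ^+ k)).
Proof.
have us : uniq (index_iota 1 (horizon n).+1) by exact: iota_uniq.
rewrite (_ : (fun om => _) = fun om => \sum_(e : {ffun 'I_(horizon n).+1 -> bool})
    weight e * (c ^+ k * W e om ^+ k)).
  by apply: intble_sum => e _; do 2 apply: intbleZ; exact: (lincomb_power iidY momY _ _ us).
apply/funext => om; rewrite (Ex_fluct n om (fun z => (c * z) ^+ k)).2.
by apply: eq_bigr => e _; rewrite exprMn.
Qed.

(** For a fixed configuration the coefficients are at most 1 in absolute value, so
    [lincomb_moment_le] bounds the moment over the scenery uniformly in the configuration. *)
Lemma quenched_fourth_moment : exists2 C, 0 <= C & forall n : nat, (0 < n)%N ->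
  Ex PP (fun om => Ex P (fun w => ((Num.sqrt n%:R)^-1 * fluct n om w) ^+ 4)) <= C.
Proof.
have [C C0 hC] := lincomb_moment_le iidY symY momY 2.
have [m1 m0 /andP[mu0 mu1] mmu] := mean_bounds.
exists (C * m ^+ 2); first by rewrite mulr_ge0// sqr_ge0.
move=> n n0; have /andP[h1 _] := horizon_bounds n.
have np : 0 < n%:R :> R by rewrite ltr0n.
have us : uniq (index_iota 1 (horizon n).+1) by exact: iota_uniq.
have iW e : intble PP (fun om => W (n := n) e om ^+ 4) by exact: (lincomb_power iidY momY _ _ us).
rewrite (@eq_Ex _ _ _ PP _ (fun om => \sum_(e : {ffun 'I_(horizon n).+1 -> bool}) weight e * ((n%:R ^+ 2)^-1 * W (n := n) e om ^+ 4))); last first.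
  move=> om; rewrite (Ex_fluct n om (fun z => ((Num.sqrt n%:R)^-1 * z) ^+ 4)).2.
  apply: eq_bigr => e _; rewrite exprMn exprVn (exprM _ 2 2) sqr_sqrtr//; exact: ltW.
rewrite Ex_sum; last by move=> e _; do 2 apply: intbleZ.
rewrite -[leRHS]mulr1 -[X in _ <= _ * X](sum_config_weight iidX X_gt0 (horizon n)) mulr_sumr.
apply: ler_sum => e _; rewrite ExZ; last exact: intbleZ.
rewrite mulrC; apply: ler_wpM2r; first exact: config_weight_ge0.
rewrite ExZ// mulrC ler_pdivrMr ?exprn_gt0//.
apply: le_trans (hC 2%N _ (fun x => (occupied e x)%:R - mu) _ us _) _ => //.
  by move=> x; move: mu mu0 mu1 => v v0 v1; case: occupied; rewrite ler_norml /=; lra.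
have mn : 0 <= m * n%:R by apply: mulr_ge0 => //; exact: ltW.
rewrite -mulrA; apply: ler_wpM2l => //; rewrite -exprMn size_iota subSS subn0.
by rewrite lerXn2r ?nnegrE// mulrC.
Qed.

End quenched.

(** * Almost sure limits along blocks *)

Section summable.
Context (R : realType) d (T : measurableType d) (P : probability T R).

Lemma sum_inv_sqr_le (n : nat) : \sum_(j < n) (j.+1%:R ^+ 2)^-1 <= 2 :> R.
Proof.
have h j : (j.+1%:R ^+ 2)^-1 <= 2 * (j.+1%:R^-1 - j.+2%:R^-1) :> R.
  have a1 : 1 <= j.+1%:R :> R by rewrite ler1n.
  rewrite -[j.+2%:R]natr1; move: j.+1%:R a1 => a a1.
  have a0 : a != 0 by rewrite gt_eqF//; lra.
  have b0 : a + 1 != 0 by rewrite gt_eqF//; lra.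
  rewrite -subr_ge0; have -> : 2 * (a^-1 - (a + 1)^-1) - (a ^+ 2)^-1 =
    (a - 1) / (a ^+ 2 * (a + 1)) by field; rewrite ?a0 ?b0.
  by rewrite divr_ge0 ?mulr_ge0 ?sqr_ge0//; lra.
apply: (@le_trans _ _ (\sum_(j < n) 2 * (j.+1%:R^-1 - j.+2%:R^-1))).
  by apply: ler_sum => j _; exact: h.
rewrite -mulr_sumr -[leRHS]mulr1 ler_wpM2l//.
suff -> : \sum_(j < n) (j.+1%:R^-1 - j.+2%:R^-1) = 1 - n.+1%:R^-1 :> R.
  by rewrite lerBlDr lerDl.
elim: n => [|n IH]; first by rewrite big_ord0 invr1 subrr.
by rewrite big_ord_recr /= IH; ring.
Qed.

(** Borel-Cantelli in the form of monotone convergence: the sum of the [g j] has a finite integral,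
    so it is finite almost everywhere and its terms tend to 0. *)
Lemma ae_cvg0_rate (g : nat -> T -> R) (C : R) :
  (forall j, measurable_fun setT (g j)) -> (forall j w, 0 <= g j w) ->
  (forall j, \int[P]_w (g j w)%:E <= (C / j.+1%:R ^+ 2)%:E)%E ->
  {ae P, forall w, (fun j => g j w) @ \oo --> (0 : R)}.
Proof.
move=> mg g0 hC.
have mgE j : measurable_fun setT (fun w => (g j w)%:E) by exact/measurable_EFinP.
have C0 : 0 <= C.
  have : (0 <= \int[P]_w (g 0 w)%:E)%E by apply: integral_ge0 => w _; rewrite lee_fin.
  by move=> /le_trans/(_ (hC 0%N)); rewrite lee_fin expr1n divr1.
pose s w := (\sum_(j <oo) (g j w)%:E)%E.
have ms : measurable_fun setT s.
  by apply: ge0_emeasurable_sum => // j w _ _; rewrite lee_fin.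
have s0 w : (0 <= s w)%E by apply: nneseries_ge0 => j _ _; rewrite lee_fin.
have Is : (\int[P]_w s w <= (2 * C)%:E)%E.
  rewrite /s integral_nneseries//; last by move=> j w _; rewrite lee_fin.
  apply: lime_le.
    by apply: is_cvg_nneseries => j _ _; apply: integral_ge0 => w _; rewrite lee_fin.
  near=> n; rewrite big_mkord.
  apply: (@le_trans _ _ (\sum_(j < n) (C / j.+1%:R ^+ 2)%:E)%E).
    by apply: lee_sum => j _; exact: hC.
  by rewrite sumEFin lee_fin -mulr_sumr mulrC ler_wpM2r// sum_inv_sqr_le.
have si : P.-integrable setT s.
  apply/integrableP; split => //.
  rewrite (eq_integral s) => [|w _]; last by rewrite gee0_abs.
  by rewrite (le_lt_trans Is)// ltry.
apply: filterS (integrable_ae measurableT si) => w /(_ I) fs.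
apply: (@cvg_series_cvg_0 R R^o).
apply: nondecreasing_is_cvgn.
  by apply/nondecreasing_series => j _ _; exact: g0.
exists (fine (s w)) => _ [n _ <-].
rewrite -lee_fin fineK// /series /= -sumEFin.
by apply: nneseries_lim_ge => j _ _; rewrite lee_fin.
Unshelve. all: by end_near.
Qed.

Lemma ae_cvg0_Ex (g : nat -> T -> R) (C : R) :
  (forall j, intble P (g j)) -> (forall j w, 0 <= g j w) ->
  (forall j, Ex P (g j) <= C / j.+1%:R ^+ 2) ->
  {ae P, forall w, (fun j => g j w) @ \oo --> (0 : R)}.
Proof.
move=> ig g0 hC; apply: (@ae_cvg0_rate _ C) => // j.
  exact: intble_measurable (ig j).
by rewrite (Ex_EFin (ig j)) lee_fin.
Qed.

End summable.

Section cvg_real.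
Context (R : realType).

Lemma cvg0_norm_le (f g : nat -> R) : (forall j, `|f j| <= g j) ->
  g @ \oo --> (0 : R) -> f @ \oo --> (0 : R).
Proof.
move=> fg g0; apply/norm_cvg0P; apply: (squeeze_cvgr (f := fun=> 0) _ (cvg_cst _) g0).
by near=> n; rewrite normr_ge0 fg.
Unshelve. all: by end_near.
Qed.

Lemma cvg0_sqr (f : nat -> R) : (fun j => f j ^+ 2) @ \oo --> (0 : R) -> f @ \oo --> (0 : R).
Proof.
move=> f2; apply/cvgrPdist_lt => e e0.
have e2 : 0 < e ^+ 2 by rewrite exprn_gt0.
near=> n; rewrite sub0r normrN -(@ltr_pXn2r _ 2) ?nnegrE ?(ltW e0)// real_normK ?num_real//.
near: n; exact: cvgr_lt f2 _ e2.
Unshelve. all: by end_near.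
Qed.

End cvg_real.

Section quenched_limits.
Context (R : realType) d (Om : measurableType d) (PP : probability Om R).
Context (Y : nat -> Om -> R).
Hypothesis iidY : iid_R PP Y 0.
Hypothesis symY : forall B : set R, measurable B ->
  PP (Y 0 @^-1` B) = PP ((fun w => - Y 0 w) @^-1` B).
Hypothesis momY : forall k : nat, (1 <= k)%N ->
  PP.-integrable setT (fun w => (`|Y 0 w| ^+ k)%:E).
Hypothesis varY : (\int[PP]_w (Y 0 w ^+ 2)%:E = 1)%E.
Context d' (Om' : measurableType d') (P : probability Om' R).
Context (X : nat -> Om' -> nat).
Hypothesis iidX : iid_N P X.
Hypothesis X_gt0 : forall i w, (0 < X i w)%N.
Hypothesis X_aperiodic : aperiodic (support_N P (X 0)).
Hypothesis X_intble : intble P (fun w => (X 0 w)%:R).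
Hypothesis X2_intble : intble P (fun w => (X 0 w)%:R ^+ 2).

Definition block_root (j : nat) : nat := (j.+1 ^ 6)%N.
Definition block (j : nat) : nat := (block_root j ^ 8)%N.

Lemma block_root_gt0 j : (0 < block_root j)%N.
Proof. by rewrite expn_gt0. Qed.

Lemma block_gt0 j : (0 < block j)%N.
Proof. by rewrite expn_gt0 block_root_gt0. Qed.

Let flu n om w := fluct Y P X n om w.

Lemma measurable_fluct_cos n t : measurable_fun setT (fluct_cos Y P X n t).
Proof.
apply: (@measurable_Ex_fluct _ _ _ _ _ iidY _ _ _ _ iidX X_gt0 n
  (fun z => cos (t / Num.sqrt n%:R * z))); exact: measurable_cosM.
Qed.

Lemma measurable_fluct_sin n t : measurable_fun setT (fluct_sin Y P X n t).
Proof.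
apply: (@measurable_Ex_fluct _ _ _ _ _ iidY _ _ _ _ iidX X_gt0 n
  (fun z => sin (t / Num.sqrt n%:R * z))); exact: measurable_sinM.
Qed.

Lemma gauss_char_bounds t : 0 <= gauss_char P X t <= 1.
Proof.
have [_ _ /andP[mu0 mu1] _] := mean_bounds X_gt0 X_intble.
rewrite expR_ge0 expR_le1 oppr_le0 divr_ge0// mulr_ge0 ?sqr_ge0// subr_ge0//.
Qed.

Lemma measurable_fluct n om : measurable_fun setT (flu n om).
Proof.
exact: intble_measurable (Ex_fluct Y iidX X_gt0 n om id).1.
Qed.

Let G n t om := (fluct_cos Y P X n t om - gauss_char P X t) ^+ 2 + fluct_sin Y P X n t om ^+ 2.

Lemma intble_G n t : intble PP (G n t).
Proof.
apply: (@intble_bounded _ _ _ _ _ 5).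
  apply: measurable_funD; apply: measurable_funX; last exact: measurable_fluct_sin.
  by apply: measurable_funB => //; exact: measurable_fluct_cos.
move=> om; rewrite ger0_norm ?addr_ge0 ?sqr_ge0//.
have h1 : `|fluct_cos Y P X n t om| <= 1.
  apply: norm_Ex_bounded => [|w]; last exact: cos_max.
  exact: (measurableT_comp (measurable_cosM _) (measurable_fluct n om)).
have h2 : `|fluct_sin Y P X n t om| <= 1.
  apply: norm_Ex_bounded => [|w]; last exact: sin_max.
  exact: (measurableT_comp (measurable_sinM _) (measurable_fluct n om)).
have /andP[c0 c1] := gauss_char_bounds t.
have s2 : fluct_sin Y P X n t om ^+ 2 <= 1 by rewrite -real_normK ?num_real// exprn_ile1.
have : (fluct_cos Y P X n t om - gauss_char P X t) ^+ 2 <= 2 ^+ 2.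
  rewrite -real_normK ?num_real// lerXn2r ?nnegrE//.
  by move: h1; rewrite !ler_norml => /andP[]; lra.
by rewrite /G; lra.
Qed.

Lemma inv_block_root_le j : (block_root j)%:R^-1 <= (j.+1%:R ^+ 2)^-1 :> R.
Proof.
by rewrite lef_pV2 ?posrE ?exprn_gt0 ?ltr0n ?block_root_gt0// -natrX ler_nat leq_pexp2l.
Qed.

Lemma ae_char_limits t : {ae PP, forall om, (fun j => G (block j) t om) @ \oo --> (0 : R)}.
Proof.
have [C C0 hC] := quenched_char_rate iidY symY momY varY iidX X_gt0 X_aperiodic X_intble X2_intble.
apply: (@ae_cvg0_Ex _ _ _ _ _ (C * (1 + t ^+ 4))) => [j|j om|j].
- exact: intble_G.
- by rewrite addr_ge0// sqr_ge0.
apply: le_trans (hC _ _ (block_root_gt0 j) erefl t) _.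
rewrite ler_wpM2l ?inv_block_root_le// mulr_ge0// addr_ge0//.
by rewrite (exprM _ 2 2) sqr_ge0.
Qed.

(** At the frequency [t = 1/(j+1)], [second_moment_le] divides [1 - fluct_cos] by [t^2], so the
    distance to the Gaussian value must be [O(t^2)]: hence the weight [t^-4] on its square. *)
Lemma ae_char_small : {ae PP, forall om,
  (fun j => j.+1%:R ^+ 4 * G (block j) j.+1%:R^-1 om) @ \oo --> (0 : R)}.
Proof.
have [C C0 hC] := quenched_char_rate iidY symY momY varY iidX X_gt0 X_aperiodic X_intble X2_intble.
apply: (@ae_cvg0_Ex _ _ _ _ _ (C * 2)) => [j|j om|j].
- by apply: intbleZ; exact: intble_G.
- by rewrite mulr_ge0 ?exprn_ge0// addr_ge0// sqr_ge0.
rewrite ExZ; last exact: intble_G.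
have a0 : 0 < j.+1%:R :> R by rewrite ltr0n.
apply: (@le_trans _ _ (j.+1%:R ^+ 4 * (C * 2 / (block_root j)%:R))).
  rewrite ler_wpM2l ?exprn_ge0//; apply: le_trans (hC _ _ (block_root_gt0 j) erefl _) _.
  rewrite ler_wpM2r ?invr_ge0// ler_wpM2l// -[2]/(1 + 1) lerD2l.
  by rewrite exprVn invf_le1 ?exprn_gt0// exprn_ege1// ler1n.
rewrite le_eqVlt; apply/orP; left; apply/eqP.
by rewrite /block_root natrX; field; rewrite gt_eqF.
Qed.

Let Z n om w : R := (Num.sqrt n%:R)^-1 * flu n om w.

(** The fourth moment is only bounded in mean over the scenery; the weight [t^2 = (j+1)^-2], with
    which it enters [second_moment_le], makes the series summable. *)
Lemma ae_fourth_moment : {ae PP, forall om,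
  (fun j => (j.+1%:R ^+ 2)^-1 * Ex P (fun w => Z (block j) om w ^+ 4)) @ \oo --> (0 : R)}.
Proof.
have [C C0 hC] := quenched_fourth_moment iidY symY momY iidX X_gt0 X_intble.
apply: (@ae_cvg0_Ex _ _ _ _ _ C) => [j|j om|j].
- by apply: intbleZ; exact: (intble_Ex_fluct_power iidY momY iidX X_gt0).
- rewrite mulr_ge0 ?invr_ge0 ?sqr_ge0//; apply: Ex_ge0 => w.
  by rewrite (exprM _ 2 2) sqr_ge0.
rewrite ExZ; last exact: (intble_Ex_fluct_power iidY momY iidX X_gt0).
by rewrite mulrC ler_wpM2r ?invr_ge0 ?sqr_ge0// hC// block_gt0.
Qed.

Lemma ae_mean : {ae PP, forall om, (fun j => Ex P (Z (block j) om)) @ \oo --> (0 : R)}.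
Proof.
have [C C0 hC] := quenched_mean_rate iidY symY momY varY iidX X_gt0 X_aperiodic X_intble X2_intble.
have := @ae_cvg0_Ex _ _ _ PP (fun j om => Ex P (Z (block j) om) ^+ 2) C.
have ae0 : {ae PP, forall om, (fun j => Ex P (Z (block j) om) ^+ 2) @ \oo --> (0 : R)}.
  apply: (@ae_cvg0_Ex _ _ _ _ _ C) => [j|j om|j].
  - exact: (hC _ _ (block_root_gt0 j) erefl).1.
  - exact: sqr_ge0.
  - apply: le_trans (hC _ _ (block_root_gt0 j) erefl).2 _.
    by rewrite ler_wpM2l// inv_block_root_le.
by move=> _; apply: filterS ae0 => om; exact: cvg0_sqr.
Qed.

Lemma intble_Z n om k : intble P (fun w => Z n om w ^+ k).
Proof. exact: (Ex_fluct Y iidX X_gt0 n om (fun z => ((Num.sqrt n%:R)^-1 * z) ^+ k)).1. Qed.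

(* [z^2 <= 2 (1 - cos (t z)) / t^2 + t^2 z^4 / 12], integrated. *)
Lemma second_moment_le n om t : 0 < t ->
  Ex P (fun w => Z n om w ^+ 2) <=
  2 * (1 - fluct_cos Y P X n t om) / t ^+ 2 + t ^+ 2 * Ex P (fun w => Z n om w ^+ 4).
Proof.
move=> t0; have t2 : 0 < t ^+ 2 by rewrite exprn_gt0.
have ic : intble P (fun w => cos (t / Num.sqrt n%:R * flu n om w)).
  exact: intble_cosM (measurable_fluct n om).
have i1 : intble P (fun w => 1 - cos (t / Num.sqrt n%:R * flu n om w)).
  by apply: intbleB => //; exact: intble_cst.
have <- : Ex P (fun w => 1 - cos (t / Num.sqrt n%:R * flu n om w)) = 1 - fluct_cos Y P X n t om.
  by rewrite (ExB (intble_cst P 1) ic) Ex_cst.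
rewrite mulrAC -(ExZ _ i1) -ExZ; last exact: intble_Z.
rewrite -ExD; [|exact: intbleZ|by apply: intbleZ; exact: intble_Z].
apply: le_Ex; [exact: intble_Z| |].
  by apply: intbleD; [exact: intbleZ|apply: intbleZ; exact: intble_Z].
move=> w; have -> : t / Num.sqrt n%:R * flu n om w = t * Z n om w by rewrite /Z mulrA.
move: (Z n om w) => z; have := cos_upper_bound (t * z); rewrite !exprMn => h.
have z4 : 0 <= t ^+ 4 * z ^+ 4 by rewrite -exprMn (exprM _ 2 2) sqr_ge0.
rewrite -(ler_pM2r t2).
have -> : (2 / t ^+ 2 * (1 - cos (t * z)) + t ^+ 2 * z ^+ 4) * t ^+ 2 =
  2 * (1 - cos (t * z)) + t ^+ 4 * z ^+ 4 by field; rewrite gt_eqF.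
rewrite mulrC; move: z4 h; move: (t ^+ 4 * z ^+ 4) (t ^+ 2 * z ^+ 2) (cos _) => a b c.
by lra.
Qed.

(** Nonnegative rational frequencies form a countable family, so one null set serves them all;
    trigonometric polynomials call for no others. *)
Theorem ae_quenched_limits : {ae PP, forall om,
  [/\ forall k a : nat, (fun j => fluct_cos Y P X (block j) (k%:R / a.+1%:R) om) @ \oo -->
        gauss_char P X (k%:R / a.+1%:R),
      forall k a : nat, (fun j => fluct_sin Y P X (block j) (k%:R / a.+1%:R) om) @ \oo --> (0 : R),
      (fun j => Ex P (Z (block j) om)) @ \oo --> (0 : R) &
      \forall j \near \oo, Ex P (fun w => Z (block j) om w ^+ 2) <= 6]}.
Proof.
have h1 : {ae PP, forall om, forall k a : nat,
    (fun j => G (block j) (k%:R / a.+1%:R) om) @ \oo --> (0 : R)}.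
  by apply: ae_foralln => k; apply: ae_foralln => a; exact: ae_char_limits.
have h2 : {ae PP, forall om,
    (fun j => j.+1%:R ^+ 4 * G (block j) j.+1%:R^-1 om) @ \oo --> (0 : R) /\
    (fun j => (j.+1%:R ^+ 2)^-1 * Ex P (fun w => Z (block j) om w ^+ 4)) @ \oo --> (0 : R)}.
  by apply: filterS2 ae_char_small ae_fourth_moment => om.
apply: filterS3 h1 h2 ae_mean => om H1 [H2 H3] H4; split=> //.
- move=> k a; apply/subr_cvg0/cvg0_sqr.
  apply: cvg0_norm_le (H1 k a) => j; rewrite ger0_norm ?sqr_ge0//.
  by rewrite /G lerDl sqr_ge0.
- move=> k a; apply/cvg0_sqr.
  apply: cvg0_norm_le (H1 k a) => j; rewrite ger0_norm ?sqr_ge0//.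
  by rewrite /G lerDr sqr_ge0.
have [_ _ /andP[mu0 mu1] _] := mean_bounds X_gt0 X_intble.
near=> j.
have a0 : 0 < j.+1%:R :> R by rewrite ltr0n.
have b1 : j.+1%:R ^+ 4 * G (block j) j.+1%:R^-1 om <= 1.
  by apply: ltW; near: j; exact: cvgr_lt H2 _ ltr01.
have b2 : (j.+1%:R ^+ 2)^-1 * Ex P (fun w => Z (block j) om w ^+ 4) <= 1.
  by apply: ltW; near: j; exact: cvgr_lt H3 _ ltr01.
have ai : 0 < j.+1%:R^-1 :> R by rewrite invr_gt0.
(* With [q = t^-2], both [q (1 - gauss_char) <= 1/2] and [q |fluct_cos - gauss_char| <= 1], so the
   right-hand side is at most [2 * 3/2 + 1], below 6. *)
apply: le_trans (second_moment_le (block j) om ai) _.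
rewrite exprVn invrK; set q := j.+1%:R ^+ 2 in b2 *.
have q0 : 0 < q by rewrite exprn_gt0.
have c1 : 1 - gauss_char P X j.+1%:R^-1 <= q^-1 / 2.
  rewrite /gauss_char exprVn -/q; have := expR_ge1Dx (- ((1 - (Ex P (fun w => (X 0 w)%:R))^-1) * q^-1 / 2)).
  move=> h; have qi : 0 <= q^-1 by rewrite invr_ge0 ltW.
  have h' : (1 - (Ex P (fun w => (X 0 w)%:R))^-1) * q^-1 <= q^-1.
    by rewrite -[leRHS]mul1r ler_wpM2r// lerBlDr lerDl.
  rewrite lerBlDr -lerBlDl; apply: le_trans h; rewrite lerD2l lerN2.
  by rewrite ler_wpM2r.
have c2 : q * `|fluct_cos Y P X (block j) j.+1%:R^-1 om - gauss_char P X j.+1%:R^-1| <= 1.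
  rewrite -(@ler_pXn2r _ 2) ?nnegrE ?mulr_ge0 ?(ltW q0)// expr1n exprMn real_normK ?num_real//.
  apply: le_trans b1; rewrite -[j.+1%:R ^+ 4]/(j.+1%:R ^+ (2 * 2)) exprM -/q.
  by rewrite ler_wpM2l ?sqr_ge0// lerDl sqr_ge0.
have c3 : (1 - fluct_cos Y P X (block j) j.+1%:R^-1 om) * q <= 3 / 2.
  have : (1 - gauss_char P X j.+1%:R^-1) * q <= 1 / 2.
    by rewrite -ler_pdivlMr// mulrC mul1r.
  move: c2; move: (fluct_cos _ _ _ _ _ _) (gauss_char _ _ _) => x y c2.
  have := ler_norm (y - x); rewrite distrC => /(ler_wpM2l (ltW q0)) hh.
  by nra.
by rewrite -mulrA; lra.
Unshelve. all: by end_near.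
Qed.

End quenched_limits.

(** * From blocks to all times *)

Section tonelli.
Context (R : realType) d (Om : measurableType d) (PP : probability Om R).
Context d' (Om' : measurableType d') (P : probability Om' R).

(** The bound [b] holds for each fixed walk, in mean over the scenery. Exchanging the integrals
    turns it into a bound in mean on the quenched expectation, whose integral is therefore finite
    for almost every scenery. *)
Lemma section_tonelli (f : Om * Om' -> R) (b : Om' -> R) :
  measurable_fun setT f -> (forall z, 0 <= f z) ->
  (forall w, intble PP (fun om => f (om, w)) /\ Ex PP (fun om => f (om, w)) <= b w) ->
  intble P b ->
  [/\ {ae PP, forall om, intble P (fun w => f (om, w))},
      measurable_fun setT (fun om => Ex P (fun w => f (om, w))) &
      (\int[PP]_om (Ex P (fun w => f (om, w)))%:E <= (Ex P b)%:E)%E].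
Proof.
move=> mf f0 fb ib.
have mfE : measurable_fun setT (fun z => (f z)%:E) by exact/measurable_EFinP.
have f0E z : (0 <= (f z)%:E)%E by rewrite lee_fin.
pose F om := (\int[P]_w (f (om, w))%:E)%E.
have mF : measurable_fun setT F.
  exact: (measurable_fun_fubini_tonelli_F (m2 := P) (fun z => (f z)%:E) mfE f0E).
have F0 om : (0 <= F om)%E by apply: integral_ge0 => w _.
have IF : (\int[PP]_om F om <= (Ex P b)%:E)%E.
  rewrite /F (@fubini_tonelli _ _ _ _ _ PP P (fun z => (f z)%:E) mfE f0E) -(Ex_EFin ib).
  apply: ge0_le_integral => //.
  - by move=> w _; apply: integral_ge0.
  - exact: (measurable_fun_fubini_tonelli_G (m1 := PP) (fun z => (f z)%:E) mfE f0E).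
  - exact: measurable_int ib.
  - by move=> w _; rewrite (Ex_EFin (fb w).1) lee_fin; exact: (fb w).2.
have iF : PP.-integrable setT F.
  apply/integrableP; split => //.
  rewrite (eq_integral F) => [|om _]; last by rewrite gee0_abs.
  by rewrite (le_lt_trans IF)// ltry.
have mE : measurable_fun setT (fun om => Ex P (fun w => f (om, w))).
  exact: (measurableT_comp (fine_measurable measurableT) mF).
split=> //.
- apply: filterS (integrable_ae measurableT iF) => om /(_ I) fF.
  have mo : measurable_fun setT (fun w => f (om, w)).
    exact: measurable_fun_pair2.
  apply/integrableP; split; first exact/measurable_EFinP.
  rewrite (eq_integral (fun w => (f (om, w))%:E)); last by move=> w _ /=; rewrite ger0_norm.
  by move: fF; rewrite ge0_fin_numE.
apply: le_trans IF; apply: ge0_le_integral => //.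
- by move=> om _; rewrite lee_fin; exact: Ex_ge0.
- exact/measurable_EFinP.
(* [fine] sends an infinite value to 0, so [Ex] is everywhere at most the extended integral. *)
- by move=> om _; rewrite /Ex -/(F om); case: (F om) (F0 om) => [r|_|] //=; exact: leey.
Qed.

End tonelli.

Section power_gap.
Context (R : realFieldType).

Lemma expr_gap (k : nat) : exists2 G : R, 0 <= G & forall a : R, 1 <= a ->
  (a + 1) ^+ k.+1 - a ^+ k.+1 <= G * a ^+ k.
Proof.
elim: k => [|k [G G0 hG]].
  by exists 1 => // a a1; rewrite !expr1 expr0; lra.
exists (2 * G + 1); first by lra.
move=> a a1; have h := hG a a1; rewrite [(a + 1) ^+ k.+2]exprS [a ^+ k.+2]exprS.
have -> : (a + 1) * (a + 1) ^+ k.+1 - a * a ^+ k.+1 =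
  (a + 1) * ((a + 1) ^+ k.+1 - a ^+ k.+1) + a ^+ k.+1 by ring.
rewrite [leRHS]mulrDl mul1r lerD2r.
apply: (@le_trans _ _ ((a + 1) * (G * a ^+ k))); first by apply: ler_wpM2l => //; lra.
apply: (@le_trans _ _ ((2 * a) * (G * a ^+ k))).
  by apply: ler_wpM2r; [rewrite mulr_ge0 ?exprn_ge0//; lra|lra].
by rewrite [a ^+ k.+1]exprS le_eqVlt; apply/orP; left; apply/eqP; ring.
Qed.

(** If [|z| > e], then [|z|] is at most [|z| (|z|/e)^(2p-1)]. *)
Lemma norm_le_power (e z : R) (p : nat) : 0 < e -> (0 < p)%N ->
  `|z| <= e + z ^+ p.*2 / e ^+ p.*2.-1.
Proof.
move=> e0 p0; have z0 : 0 <= z ^+ p.*2 by rewrite -mul2n exprM exprn_ge0// sqr_ge0.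
have [ze|ez] := leP `|z| e.
  by rewrite (le_trans ze)// lerDl divr_ge0// exprn_ge0// ltW.
apply: (@le_trans _ _ (z ^+ p.*2 / e ^+ p.*2.-1)); last by rewrite lerDr ltW.
rewrite ler_pdivlMr ?exprn_gt0// -[z ^+ _]ger0_norm// normrX.
have -> : p.*2 = p.*2.-1.+1 by rewrite prednK// double_gt0.
by rewrite /= exprS ler_wpM2l// lerXn2r ?nnegrE ?(ltW e0)// ltW.
Qed.

End power_gap.

Section walk_remainder.
Context (R : realType) d (Om : measurableType d) (PP : probability Om R).
Context (Y : nat -> Om -> R).
Hypothesis iidY : iid_R PP Y 0.
Hypothesis symY : forall B : set R, measurable B ->
  PP (Y 0 @^-1` B) = PP ((fun w => - Y 0 w) @^-1` B).
Hypothesis momY : forall k : nat, (1 <= k)%N ->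
  PP.-integrable setT (fun w => (`|Y 0 w| ^+ k)%:E).
Hypothesis varY : (\int[PP]_w (Y 0 w ^+ 2)%:E = 1)%E.
Context d' (Om' : measurableType d') (P : probability Om' R).
Context (X : nat -> Om' -> nat).
Hypothesis iidX : iid_N P X.
Hypothesis X_gt0 : forall i w, (0 < X i w)%N.
Hypothesis X_aperiodic : aperiodic (support_N P (X 0)).
Hypothesis X_intble : intble P (fun w => (X 0 w)%:R).
Hypothesis X2_intble : intble P (fun w => (X 0 w)%:R ^+ 2).

Definition walk_sum (n : nat) (om : Om) (w : Om') : R :=
  \sum_(0 <= k < n) Y (renewal X k.+1 w) om.

Definition site_sum (N : nat) (om : Om) (w : Om') : R :=
  \sum_(1 <= x < N.+1) (visited X x w)%:R * Y x om.

Let mY i : measurable_fun setT (Y i).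
Proof. by have [+ _ _] := iidY; exact. Qed.

Lemma measurable_renewal_set n x : measurable [set w | renewal X n w = x].
Proof.
have m1 := measurable_renewal_eq iidX n x (R := R).
have -> : [set w | renewal X n w = x] =
    (fun w => (renewal X n w == x)%:R : R) @^-1` [set 1].
  apply/seteqP; split=> w /=; first by move=> ->; rewrite eqxx.
  by case: eqP => // _ /eqP; rewrite eq_sym oner_eq0.
exact: (preimage_measurable m1).
Qed.

(** The site is random but takes countably many values, so the preimage is a countable union of
    rectangles. *)
Lemma measurable_scenery n :
  measurable_fun setT (fun z : Om * Om' => Y (renewal X n z.2) z.1).
Proof.
move=> _ B mB; rewrite setTI.
have -> : (fun z : Om * Om' => Y (renewal X n z.2) z.1) @^-1` B =
    \bigcup_x ((Y x @^-1` B) `*` [set w | renewal X n w = x]).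
  apply/seteqP; split=> [[om w] /= h|[om w] [x _ /= [h kx]]]; last by rewrite kx.
  by exists (renewal X n w).
apply: bigcup_measurable => x _; apply: measurableX.
  exact: preimage_measurable.
exact: measurable_renewal_set.
Qed.

Lemma measurable_walk_sum n :
  measurable_fun setT (fun z : Om * Om' => walk_sum n z.1 z.2).
Proof. by apply: measurable_sum => k; exact: measurable_scenery. Qed.

Lemma measurable_site_sum N :
  measurable_fun setT (fun z : Om * Om' => site_sum N z.1 z.2).
Proof.
apply: measurable_sum => x; apply: measurable_funM.
  exact: (measurableT_comp (measurable_visited (R := R) iidX X_gt0 x) measurable_snd).
exact: (measurableT_comp (mY x) measurable_fst).
Qed.

Lemma site_sumB a b om w : (a <= b)%N ->
  site_sum b om w - site_sum a om w =
  \sum_(a.+1 <= x < b.+1) (visited X x w)%:R * Y x om.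
Proof.
by move=> ab; rewrite /site_sum (@big_cat_nat _ _ _ a.+1 1 b.+1)//= addrAC subrr add0r.
Qed.

(** No site strictly between two consecutive renewal points is visited, so the site sum gains one
    term per step. *)
Lemma walk_sumE n om w : walk_sum n om w = site_sum (renewal X n w) om w.
Proof.
elim: n => [|n IH].
  by rewrite /walk_sum /site_sum renewal0 !big_geq.
rewrite /walk_sum big_nat_recr//= -/(walk_sum n om w) IH.
have lt := renewal_ltS X_gt0 n w.
have := site_sumB om w (ltnW lt); rewrite big_nat_recr//= big_nat_cond big1.
  move/eqP; rewrite subr_eq add0r => /eqP ->.
  have -> : visited X (renewal X n.+1 w) w by apply/(visitedP X_gt0); exists n.+1.
  by rewrite mul1r addrC.
move=> x /andP[/andP[h1 h2] _]; case: (visitedP X_gt0 x w) => [[k kx]|]; last by rewrite mul0r.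
have nk : (n < k)%N by rewrite ltnNge; apply/negP => /(renewal_le X_gt0 w); lia.
by have := renewal_le X_gt0 w nk; lia.
Qed.

Lemma Ex_site_sumB a b w :
  intble PP (fun om => (site_sum a om w - site_sum b om w) ^+ 2) /\
  Ex PP (fun om => (site_sum a om w - site_sum b om w) ^+ 2) <= `|a%:R - b%:R|.
Proof.
wlog ab : a b / (b <= a)%N.
  move=> H; have [ba|/ltnW ab] := leqP b a; first exact: H.
  have eqs om : (site_sum b om w - site_sum a om w) ^+ 2 = (site_sum a om w - site_sum b om w) ^+ 2.
    by rewrite -opprB sqrrN.
  have [i1 e1] := H b a ab; split; first exact: eq_intble eqs i1.
  by rewrite -(eq_Ex _ eqs) distrC.
have us : uniq (index_iota b.+1 a.+1) by exact: iota_uniq.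
have eqs om := congr1 (fun z => z ^+ 2) (site_sumB om w ab).
split; first exact: (eq_intble (fun om => esym (eqs om)) (lincomb_power iidY momY _ 2 us)).
rewrite (eq_Ex _ eqs) (Ex_lincomb_sqr iidY symY momY varY _ us).
apply: (@le_trans _ _ (\sum_(b.+1 <= x < a.+1) 1)).
  by apply: ler_sum => x _; case: visited; rewrite ?expr1n ?expr0n.
rewrite big_const_nat iter_addr_0 subSS ger0_norm ?subr_ge0 ?ler_nat//.
by rewrite -natrB.
Qed.

(** For a fixed walk the renewal points are distinct, so the increment is a sum of [b - a] different
    scenery variables with coefficients 1. *)
Lemma Ex_walk_sumB p : exists2 C, 0 <= C & forall a b w, (a <= b)%N ->
  intble PP (fun om => (walk_sum b om w - walk_sum a om w) ^+ p.*2) /\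
  Ex PP (fun om => (walk_sum b om w - walk_sum a om w) ^+ p.*2) <= C * (b - a)%:R ^+ p.
Proof.
have [C C0 hC] := lincomb_moment_le iidY symY momY p.
exists C => // a b w ab.
pose s := [seq renewal X k.+1 w | k <- index_iota a b].
have us : uniq s.
  rewrite map_inj_uniq ?iota_uniq// => i j /(renewal_inj X_gt0 (w := w)).
  by case.
have eqs om : (walk_sum b om w - walk_sum a om w) ^+ p.*2 =
    (\sum_(x <- s) 1 * Y x om) ^+ p.*2.
  congr (_ ^+ _); rewrite /walk_sum (@big_cat_nat _ _ _ a 0 b)//= addrAC subrr add0r.
  by rewrite big_map; apply: eq_bigr => k _; rewrite mul1r.
split.
  exact: (eq_intble (fun om => esym (eqs om)) (lincomb_power iidY momY (fun=> 1) p.*2 us)).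
rewrite (eq_Ex _ eqs); apply: le_trans (hC p s (fun=> 1) (leqnn p) us _) _.
  by move=> i; rewrite normr1.
by rewrite size_map size_iota.
Qed.

Lemma ae_intble_walk_sumB p a b : (a <= b)%N ->
  {ae PP, forall om, intble P (fun w => (walk_sum b om w - walk_sum a om w) ^+ p.*2)}.
Proof.
move=> ab; have [C C0 hC] := Ex_walk_sumB p.
have [] := @section_tonelli _ _ _ PP _ _ P
  (fun z => (walk_sum b z.1 z.2 - walk_sum a z.1 z.2) ^+ p.*2) (fun=> C * (b - a)%:R ^+ p) => //.
- by apply: measurable_funX; apply: measurable_funB; exact: measurable_walk_sum.
- by move=> z; rewrite -mul2n exprM exprn_ge0// sqr_ge0.
- by move=> w; exact: hC.
- exact: intble_cst.
Qed.

Definition boundary (j : nat) (om : Om) (w : Om') : R :=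
  walk_sum (block j) om w - site_sum (horizon P X (block j)) om w.

Lemma Ex_renewal_horizon n : (0 < n)%N ->
  intble P (fun w => `|(renewal X n w)%:R - (horizon P X n)%:R|) /\
  Ex P (fun w => `|(renewal X n w)%:R - (horizon P X n)%:R|) <=
    (2 + Ex P (fun w => (X 0 w)%:R ^+ 2)) * Num.sqrt n%:R.
Proof.
move=> n0; set m := Ex P (fun w => (X 0 w)%:R).
have [iV EV] := renewal_variance iidX X_intble X2_intble n.
have n1 : 1 <= n%:R :> R by rewrite ler1n.
have s1 : 1 <= Num.sqrt n%:R :> R by rewrite -[leLHS]sqrtr1 ler_wsqrtr.
have s0 : 0 < Num.sqrt n%:R :> R by lra.
have /andP[h1 h2] := horizon_bounds X_gt0 X_intble n.
pose B w : R := 1 + Num.sqrt n%:R + (Num.sqrt n%:R)^-1 * ((renewal X n w)%:R - n%:R * m) ^+ 2.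
have iB : intble P B by apply: intbleD; [exact: intble_cst|exact: intbleZ].
have dB w : `|(renewal X n w)%:R - (horizon P X n)%:R| <= B w.
  have -> : (renewal X n w)%:R - (horizon P X n)%:R =
    ((renewal X n w)%:R - n%:R * m) + (n%:R * m - (horizon P X n)%:R) by ring.
  apply: le_trans (ler_normD _ _) _; rewrite addrC /B -addrA lerD//.
    by rewrite ler_norml -/m in h1 h2 *; lra.
  have h := @norm_le_power _ _ ((renewal X n w)%:R - n%:R * m) 1 s0 isT.
  by apply: le_trans h _; rewrite expr1 lerD2l mulrC.
have mD : measurable_fun setT (fun w => `|(renewal X n w)%:R - (horizon P X n)%:R| : R).
  apply: measurableT_comp => //; apply: measurable_funB => //.
  rewrite (_ : (fun w => _) = fun w => \sum_(k < n) (X k w)%:R).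
    by apply: measurable_sum => k; exact: (measurable_natX iidX (fun k => k%:R)).
  by apply/funext => w; rewrite /renewal natr_sum.
have iD : intble P (fun w => `|(renewal X n w)%:R - (horizon P X n)%:R|).
  by apply: (intble_le mD _ iB) => w; rewrite normr_id.
split=> //; apply: le_trans (le_Ex iD iB dB) _.
rewrite ExD; [|exact: intble_cst|exact: intbleZ].
rewrite Ex_cst ExZ//.
apply: (@le_trans _ _ (1 + Num.sqrt n%:R + (Num.sqrt n%:R)^-1 * (n%:R * Ex P (fun w => (X 0 w)%:R ^+ 2)))).
  by rewrite lerD2l ler_wpM2l// invr_ge0 ltW.
have -> : (Num.sqrt n%:R)^-1 * (n%:R * Ex P (fun w => (X 0 w)%:R ^+ 2)) =
    Num.sqrt n%:R * Ex P (fun w => (X 0 w)%:R ^+ 2).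
  rewrite -{2}(sqr_sqrtr (ler0n R n)); field; rewrite gt_eqF//.
by lra.
Qed.

Lemma intble_site_sum N om k : intble P (fun w => site_sum N om w ^+ k).
Proof.
apply: (@intble_bounded _ _ _ P _ ((\sum_(1 <= x < N.+1) `|Y x om|) ^+ k)).
  apply: measurable_funX; exact: (measurable_fun_pair2 om (measurable_site_sum N)).
move=> w; rewrite normrX lerXn2r ?nnegrE ?sumr_ge0//.
apply: le_trans (ler_norm_sum _ _ _) _; apply: ler_sum => x _.
by rewrite normrM; case: visited; rewrite ?normr1 ?mul1r// normr0 mul0r.
Qed.

(** By [Ex_site_sumB] the mean square over the scenery is at most the distance of the walk from the
    horizon, which is [O(sqrt n)] in mean. Division by [n = (j+1)^48] leaves [(j+1)^-24]. *)
Lemma ae_boundary : {ae PP, forall om,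
  (fun j => Ex P (fun w => boundary j om w ^+ 2) / (block j)%:R) @ \oo --> (0 : R)}.
Proof.
set M2 := 2 + Ex P (fun w => (X 0 w)%:R ^+ 2).
have M20 : 0 <= M2 by rewrite addr_ge0// Ex_ge0// => w; exact: sqr_ge0.
have key j := @section_tonelli _ _ _ PP _ _ P (fun z => boundary j z.1 z.2 ^+ 2)
  (fun w => `|(renewal X (block j) w)%:R - (horizon P X (block j))%:R|).
have {}key j : intble PP (fun om => Ex P (fun w => boundary j om w ^+ 2)) /\
    Ex PP (fun om => Ex P (fun w => boundary j om w ^+ 2)) <= M2 * Num.sqrt (block j)%:R.
  have [i1 e1] := Ex_renewal_horizon (block_gt0 j).
  have [] := key j => //.
  - apply: measurable_funX; apply: measurable_funB.
      exact: measurable_walk_sum.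
    exact: measurable_site_sum.
  - by move=> z; exact: sqr_ge0.
  - move=> w; have [i2 e2] := Ex_site_sumB (renewal X (block j) w) (horizon P X (block j)) w.
    have eqs om : boundary j om w ^+ 2 = (site_sum (renewal X (block j) w) om w - site_sum (horizon P X (block j)) om w) ^+ 2.
      by rewrite /boundary walk_sumE.
    split; first exact: (eq_intble (fun om => esym (eqs om)) i2).
    by rewrite (eq_Ex _ eqs).
  - move=> _ h2 h3; apply: ge0_intble => // [om|]; first by apply: Ex_ge0 => w; exact: sqr_ge0.
    by apply: le_trans h3 _; rewrite lee_fin.
have eqs j om : (block j)%:R^-1 * Ex P (fun w => boundary j om w ^+ 2) =
  Ex P (fun w => boundary j om w ^+ 2) / (block j)%:R by rewrite mulrC.
apply: (@ae_cvg0_Ex _ _ _ _ _ M2) => [j|j om|j].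
- by apply: (eq_intble (eqs j)); apply: intbleZ; exact: (key j).1.
- by rewrite divr_ge0// Ex_ge0// => w; exact: sqr_ge0.
rewrite -(eq_Ex _ (eqs j)) ExZ; last exact: (key j).1.
have b0 : 0 < (block j)%:R :> R by rewrite ltr0n block_gt0.
rewrite mulrC; apply: (@le_trans _ _ (M2 * Num.sqrt (block j)%:R / (block j)%:R)).
  by rewrite ler_wpM2r ?invr_ge0 ?(ltW b0)//; exact: (key j).2.
rewrite -mulrA ler_wpM2l//.
have -> : (block j)%:R = (j.+1%:R ^+ 24) ^+ 2 :> R.
  by rewrite /block /block_root !natrX -!exprM.
rewrite sqrtr_sqr ger0_norm ?exprn_ge0//.
have a1 : 1 <= j.+1%:R :> R by rewrite ler1n.
have a0 : 0 < j.+1%:R :> R by lra.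
rewrite expr2 invfM mulrA mulfV ?mul1r ?gt_eqF ?exprn_gt0//.
by rewrite lef_pV2 ?posrE ?exprn_gt0// ler_weXn2l.
Qed.

End walk_remainder.

Section block_increments.
Context (R : realType) d (Om : measurableType d) (PP : probability Om R).
Context (Y : nat -> Om -> R).
Hypothesis iidY : iid_R PP Y 0.
Hypothesis symY : forall B : set R, measurable B ->
  PP (Y 0 @^-1` B) = PP ((fun w => - Y 0 w) @^-1` B).
Hypothesis momY : forall k : nat, (1 <= k)%N ->
  PP.-integrable setT (fun w => (`|Y 0 w| ^+ k)%:E).
Hypothesis varY : (\int[PP]_w (Y 0 w ^+ 2)%:E = 1)%E.
Context d' (Om' : measurableType d') (P : probability Om' R).
Context (X : nat -> Om' -> nat).
Hypothesis iidX : iid_N P X.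
Hypothesis X_gt0 : forall i w, (0 < X i w)%N.
Hypothesis X_aperiodic : aperiodic (support_N P (X 0)).
Hypothesis X_intble : intble P (fun w => (X 0 w)%:R).
Hypothesis X2_intble : intble P (fun w => (X 0 w)%:R ^+ 2).

(* With blocks of length O(j^47) starting at j^48, a union bound over a block
   of 2p-th moments is summable as soon as p > 48. *)
Definition block_power : nat := 49.

Definition increment (a b : nat) (om : Om) (w : Om') : R :=
  walk_sum Y X b om w - walk_sum Y X a om w.

Definition block_increment (j : nat) (om : Om) : R :=
  \sum_(i < block j.+1 - block j)
    Ex P (fun w => increment (block j) (block j + i) om w ^+ block_power.*2) / (block j)%:R ^+ block_power.

Lemma increment_power_ge0 a b om w p : 0 <= increment a b om w ^+ p.*2.
Proof. by rewrite -mul2n exprM exprn_ge0// sqr_ge0. Qed.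

Lemma blockE j : (block j)%:R = j.+1%:R ^+ 48 :> R.
Proof. by rewrite /block /block_root !natrX -!exprM. Qed.

Lemma leq_block i j : (i <= j)%N -> (block i <= block j)%N.
Proof. by move=> ij; rewrite /block /block_root !leq_exp2r. Qed.

Lemma block_index n J : (block J <= n)%N ->
  exists j, (J <= j)%N /\ (block j <= n < block j.+1)%N.
Proof.
move=> Jn; have bj j : (j < block j)%N.
  rewrite /block /block_root -expnM; have := @leq_pexp2l j.+1 1 (6 * 8) isT isT.
  by rewrite expn1.
have ex : exists j, (block j <= n)%N by exists J.
have ub j : (block j <= n)%N -> (j <= n)%N by move=> /(leq_trans (bj j)) /ltnW.
have := ex_maxnP ex ub; case=> j jn jmax.
exists j; split; first exact: jmax.
rewrite jn ltnNge; apply/negP => /jmax; by rewrite ltnn.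
Qed.

Lemma ae_block_increment : {ae PP, forall om,
  (fun j => block_increment j om) @ \oo --> (0 : R)}.
Proof.
have [C C0 hC] := Ex_walk_sumB iidY symY momY X_gt0 block_power.
have [G G0 hG] := expr_gap R 47.
pose L j : R := (block j.+1 - block j)%:R.
have iE j i : intble PP (fun om => Ex P (fun w => increment (block j) (block j + i) om w ^+ block_power.*2)) /\
    Ex PP (fun om => Ex P (fun w => increment (block j) (block j + i) om w ^+ block_power.*2)) <= C * i%:R ^+ block_power.
  have [] := @section_tonelli _ _ _ PP _ _ P
    (fun z => increment (block j) (block j + i) z.1 z.2 ^+ block_power.*2) (fun=> C * i%:R ^+ block_power).
  - by apply: measurable_funX; apply: measurable_funB; exact: (measurable_walk_sum iidY iidX).
  - by move=> z; exact: increment_power_ge0.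
  - move=> w; have := hC (block j) (block j + i)%N w (leq_addr _ _).
    by rewrite addKn.
  - exact: intble_cst.
  move=> _ h2; rewrite Ex_cst => h3; apply: ge0_intble => // om.
  by apply: Ex_ge0 => w; exact: increment_power_ge0.
have b0 j : 0 < (block j)%:R ^+ block_power :> R by rewrite exprn_gt0// ltr0n block_gt0.
have eqs j om : \sum_(i < block j.+1 - block j) ((block j)%:R ^+ block_power)^-1 *
    Ex P (fun w => increment (block j) (block j + i) om w ^+ block_power.*2) = block_increment j om.
  by apply: eq_bigr => i _; rewrite mulrC.
have ii j (i : 'I_(block j.+1 - block j)) : intble PP (fun om => ((block j)%:R ^+ block_power)^-1 *
    Ex P (fun w => increment (block j) (block j + i) om w ^+ block_power.*2)).
  by apply: intbleZ; exact: (iE j i).1.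
apply: (@ae_cvg0_Ex _ _ _ _ _ (C * G ^+ block_power.+1)) => [j|j om|j].
- by apply: (eq_intble (eqs j)); apply: intble_sum => i _; exact: ii.
- apply: sumr_ge0 => i _; rewrite divr_ge0 ?(ltW (b0 j))//.
  by apply: Ex_ge0 => w; exact: increment_power_ge0.
rewrite -(eq_Ex _ (eqs j)) Ex_sum; last by move=> i _; exact: ii.
have a1 : 1 <= j.+1%:R :> R by rewrite ler1n.
have a0 : 0 < j.+1%:R :> R by lra.
set q : R := j.+1%:R ^+ 47.
have q0 : 0 < q by rewrite exprn_gt0.
have Lq : L j <= G * q.
  have := hG _ a1; rewrite -/q /L natrB ?leq_block//.
  by rewrite !blockE natr1.
apply: (@le_trans _ _ (\sum_(i < block j.+1 - block j) C * (G * q) ^+ block_power / (block j)%:R ^+ block_power)).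
  apply: ler_sum => i _; rewrite ExZ; last exact: (iE j i).1.
  rewrite mulrC ler_wpM2r ?invr_ge0 ?(ltW (b0 j))//; apply: le_trans (iE j i).2 _.
  rewrite ler_wpM2l// lerXn2r ?nnegrE ?mulr_ge0 ?(ltW q0)//.
  by apply: le_trans Lq; rewrite ler_nat ltnW.
rewrite sumr_const card_ord -[_ *+ (_ - _)]mulr_natl -/(L j).
apply: (@le_trans _ _ (G * q * (C * (G * q) ^+ block_power / (block j)%:R ^+ block_power))).
  by rewrite ler_wpM2r// !mulr_ge0 ?exprn_ge0 ?invr_ge0 ?mulr_ge0 ?(ltW q0) ?(ltW (b0 j)).
(* With [q = (j+1)^47], the block contains at most [G q] times and starts at [q (j+1)]. The bound is
   thus [C G^50 q / (j+1)^49], and the exponent 49 leaves exactly [(j+1)^-2]. *)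
rewrite le_eqVlt; apply/orP; left; apply/eqP.
have -> : (block j)%:R = q * j.+1%:R :> R by rewrite blockE /q -exprSr.
have qp : q ^+ block_power != 0 by rewrite gt_eqF// exprn_gt0.
have -> : (q * j.+1%:R) ^+ block_power = q ^+ block_power * (q * j.+1%:R ^+ 2).
  by rewrite exprMn /q -[j.+1%:R ^+ 47 * _]exprD.
rewrite exprMn [G ^+ block_power.+1]exprS.
move: (q ^+ block_power) (G ^+ block_power) qp => x y x0.
by field; rewrite ?x0 ?gt_eqF.
Qed.

(** One null set for all pairs of times. The square with [a = 0] gives the square integrability of
    the walk sum itself. *)
Lemma ae_intble_increment : {ae PP, forall om, forall a b : nat, (a <= b)%N ->
  intble P (fun w => increment a b om w ^+ block_power.*2) /\
  intble P (fun w => increment a b om w ^+ 2)}.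
Proof.
apply: ae_foralln => a; apply: ae_foralln => b.
have [ab|ab] := boolP (a <= b)%N; last by apply: aeW => om.
have h1 := ae_intble_walk_sumB iidY symY momY iidX X_gt0 block_power ab (P := P).
have h2 := ae_intble_walk_sumB iidY symY momY iidX X_gt0 1 ab (P := P).
by apply: filterS2 h1 h2 => om.
Qed.

End block_increments.

(** * Convergence of characteristic functions *)

Section bernstein.
Context (R : realType).

(* [bernstein n x h] is the expectation of [h K] for [K] binomial of parameters [n] and [x]. *)
Fixpoint bernstein (n : nat) (x : R) (h : nat -> R) : R :=
  if n is n'.+1 then x * bernstein n' x (fun k => h k.+1) + (1 - x) * bernstein n' x h
  else h 0.

Lemma eq_bernstein n x (h h' : nat -> R) : h =1 h' -> bernstein n x h = bernstein n x h'.
Proof. by move=> /funext ->. Qed.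

Lemma bernstein_cst n x c : bernstein n x (fun=> c) = c.
Proof. by elim: n => //= n ->; ring. Qed.

Lemma bernstein_affine n x c a (h : nat -> R) :
  bernstein n x (fun k => c + a * h k) = c + a * bernstein n x h.
Proof. by elim: n h => //= n IH h; rewrite (IH (fun k => h k.+1)) IH; ring. Qed.

Lemma bernsteinB n x (h h' : nat -> R) :
  bernstein n x (fun k => h k - h' k) = bernstein n x h - bernstein n x h'.
Proof. by elim: n h h' => //= n IH h h'; rewrite (IH (fun k => h k.+1)) IH; ring. Qed.

Lemma le_bernstein n x (h h' : nat -> R) : 0 <= x <= 1 -> (forall k, h k <= h' k) ->
  bernstein n x h <= bernstein n x h'.
Proof.
move=> /andP[x0 x1]; elim: n h h' => //= n IH h h' hh.
by rewrite lerD// ler_wpM2l ?subr_ge0// IH.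
Qed.

Lemma bernstein_variance n x c : bernstein n x (fun k => (k%:R - c) ^+ 2) =
  n%:R * x * (1 - x) + (n%:R * x - c) ^+ 2.
Proof.
elim: n c => [|n IH] c /=; first by ring.
rewrite (@eq_bernstein n x (fun k => (k.+1%:R - c) ^+ 2) (fun k => (k%:R - (c - 1)) ^+ 2)).
  by rewrite !IH -natr1; ring.
by move=> k; rewrite -natr1; ring.
Qed.

(** Compactness, in its covering form, makes the local choices of [del] uniform. Only [x] is
    confined to the segment, because the comparison in [bernstein_approx] runs over all [k], and
    [k / n.+1] may exceed 1. *)
Lemma uniform_continuity_segment (g : R -> R) (a b e : R) : continuous g -> 0 < e ->
  exists2 del, 0 < del &
    forall x y, a <= x <= b -> `|x - y| < del -> `|g x - g y| < e.
Proof.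
move=> cg e0; have /compact_near_coveringP := @segment_compact R a b.
move=> /(_ R (0^'+) (fun del x => forall y, `|x - y| < del -> `|g x - g y| < e) _).
move=> H; have : \forall del \near 0^'+, forall x, `[a, b]%classic x ->
    (forall y, `|x - y| < del -> `|g x - g y| < e).
  apply: H => x _.
  have e2 : 0 < e / 2 by rewrite divr_gt0.
  have /cvgrPdist_lt/(_ _ e2)/nbhs_ballP[d /= d0 hd] := cg x.
  have d2 : 0 < d / 2 by rewrite divr_gt0.
  near=> x' del => /= y xy.
  have h1 : `|x - x'| < d / 2 by near: x'; exact: (nbhsx_ballx x _ d2).
  have h2 : del < d / 2 by near: del; exact: nbhs_right_lt.
  have k1 : `|g x - g x'| < e / 2.
    by apply: hd; rewrite -ball_normE /ball_ /=; lra.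
  have k2 : `|g x - g y| < e / 2.
    apply: hd; rewrite -ball_normE /ball_ /=; have := ler_normD (x - x') (x' - y).
    by rewrite addrA subrK => /le_lt_trans; apply; lra.
  have := ler_normD (g x' - g x) (g x - g y); rewrite addrA subrK (distrC (g x') (g x)) => /le_lt_trans.
  by apply; lra.
move=> near_del.
have [del [/= hdel del0]] := filter_ex (filterI near_del (@nbhs_right_gt R 0)).
by exists del => // x y xab; apply: hdel; rewrite /= in_itv.
Unshelve. all: by end_near.
Qed.

(** Bernstein's argument: where [|x - k/N| >= del], the difference is at most [2 M], hence at most
    [c (x - k/N)^2], and the variance of the binomial law makes the mean of this small as [N]
    grows. *)
Lemma bernstein_approx (g : R -> R) (M e : R) : continuous g ->
  (forall x, `|g x| <= M) -> 0 < e ->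
  exists n, forall x, 0 <= x <= 1 ->
    `|g x - bernstein n.+1 x (fun k => g (k%:R / n.+1%:R))| <= e.
Proof.
move=> cg gM e0; have M0 : 0 <= M by exact: le_trans (gM 0).
have e2 : 0 < e / 2 by rewrite divr_gt0.
have [del del0 hdel] := uniform_continuity_segment 0 1 cg e2.
have d2 : 0 < del ^+ 2 by rewrite exprn_gt0.
pose c := 2 * M / del ^+ 2; have c0 : 0 <= c by rewrite divr_ge0 ?mulr_ge0// ltW.
have [n hn] : exists n : nat, c / (e / 2) <= n.+1%:R.
  exists (Num.truncn (c / (e / 2))); apply/ltW; apply: truncnS_gt.
have n0 : 0 < n.+1%:R :> R by rewrite ltr0n.
exists n => x x01; set N := n.+1; rewrite -/N in hn n0.
have [x0 x1] := andP x01.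
have pt k : `|g x - g (k%:R / N%:R)| <= e / 2 + c / N%:R ^+ 2 * (k%:R - N%:R * x) ^+ 2.
  have dE : c / N%:R ^+ 2 * (k%:R - N%:R * x) ^+ 2 = c * (x - k%:R / N%:R) ^+ 2.
    by field; rewrite gt_eqF.
  rewrite dE; have [h|h] := ltP `|x - k%:R / N%:R| del.
    by apply: le_trans (ltW (hdel _ _ x01 h)) _; rewrite lerDl mulr_ge0// sqr_ge0.
  apply: (@le_trans _ _ (2 * M)).
    by apply: le_trans (ler_normB _ _) _; rewrite mulr2n mulrDl mul1r lerD.
  apply: (@le_trans _ _ (c * del ^+ 2)); first by rewrite /c mulfVK// gt_eqF.
  apply: (@le_trans _ _ (c * (x - k%:R / N%:R) ^+ 2)); last by rewrite lerDr ltW.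
  by rewrite ler_wpM2l// -[leRHS]real_normK ?num_real// lerXn2r ?nnegrE// ltW.
have := @bernstein_affine N x (e / 2) (c / N%:R ^+ 2) (fun k => (k%:R - N%:R * x) ^+ 2).
rewrite bernstein_variance subrr expr0n addr0 => EV.
have small : e / 2 + c / N%:R ^+ 2 * (N%:R * x * (1 - x)) <= e.
  have -> : c / N%:R ^+ 2 * (N%:R * x * (1 - x)) = c / N%:R * (x * (1 - x)).
    by field; rewrite gt_eqF.
  have h1 : c / N%:R <= e / 2 by rewrite ler_pdivrMr// mulrC -ler_pdivrMr.
  have h2 : 0 <= c / N%:R by rewrite divr_ge0// ltW.
  have h3 : x * (1 - x) <= 1 by nra.
  by have := ler_wpM2l h2 h3; rewrite mulr1; lra.
have gc : g x = bernstein N x (fun=> g x) by rewrite bernstein_cst.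
rewrite gc -bernsteinB ler_norml -/N; apply/andP; split.
  rewrite -[leRHS]opprK lerN2.
  have -> : - bernstein N x (fun k => g x - g (k%:R / N%:R)) =
      bernstein N x (fun k => 0 + -1 * (g x - g (k%:R / N%:R))).
    by rewrite bernstein_affine; ring.
  apply: le_trans small; rewrite -EV; apply: le_bernstein => // k.
  by apply: le_trans (pt k); rewrite add0r mulN1r -normrN ler_norm.
apply: le_trans small; rewrite -EV; apply: le_bernstein => // k.
by apply: le_trans (pt k); exact: ler_norm.
Qed.

End bernstein.

(** * Approximation by trigonometric polynomials *)

Section trigonometric_approximation.
Context (R : realType) (a : nat).

Inductive trig_poly : (R -> R) -> Prop :=
| trig_cos (k : nat) : trig_poly (fun y => cos (k%:R / a.+1%:R * y))
| trig_sin (k : nat) : trig_poly (fun y => sin (k%:R / a.+1%:R * y))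
| trig_add F G : trig_poly F -> trig_poly G -> trig_poly (fun y => F y + G y)
| trig_scale c F : trig_poly F -> trig_poly (fun y => c * F y).

Lemma trig_poly_ext F G : F =1 G -> trig_poly F -> trig_poly G.
Proof. by move=> /funext ->. Qed.

Lemma trig_cst c : trig_poly (fun=> c).
Proof.
apply: (@trig_poly_ext (fun y => c * cos (0%:R / a.+1%:R * y))).
  by move=> y; rewrite !mul0r cos0 mulr1.
exact/trig_scale/trig_cos.
Qed.

(** Product-to-sum formulas move the frequency index by one each way; [k = 0] stands apart because
    the indices are natural numbers. *)
Lemma trig_mul_sin F : trig_poly F -> trig_poly (fun y => sin (y / a.+1%:R) * F y).
Proof.
have th k y : k.+1%:R / a.+1%:R * y = k%:R / a.+1%:R * y + y / a.+1%:R :> R.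
  by rewrite -natr1; ring.
have th' k y : k%:R / a.+1%:R * y = k.+1%:R / a.+1%:R * y - y / a.+1%:R :> R.
  by rewrite th addrK.
elim=> [k|k|{}F G _ IHF _ IHG|c {}F _ IHF].
- case: k => [|k].
    apply: trig_poly_ext (trig_sin 1) => y.
    by rewrite !mul0r cos0 mulr1 mul1r mulrC.
  apply: (@trig_poly_ext (fun y => 2^-1 * (sin (k.+2%:R / a.+1%:R * y) +
      -1 * sin (k%:R / a.+1%:R * y)))) => [y|].
    by rewrite (th k.+1) (th' k) sinD sinB; field.
  by apply: trig_scale; apply: trig_add; [exact: trig_sin|apply: trig_scale; exact: trig_sin].
- case: k => [|k].
    by apply: trig_poly_ext (trig_cst 0) => y; rewrite !mul0r sin0 mulr0.
  apply: (@trig_poly_ext (fun y => 2^-1 * (cos (k%:R / a.+1%:R * y) +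
      -1 * cos (k.+2%:R / a.+1%:R * y)))) => [y|].
    by rewrite (th k.+1) (th' k) cosB cosD; field.
  by apply: trig_scale; apply: trig_add; [exact: trig_cos|apply: trig_scale; exact: trig_cos].
- by apply: trig_poly_ext (trig_add IHF IHG) => y; rewrite mulrDr.
- by apply: trig_poly_ext (trig_scale c IHF) => y; ring.
Qed.

Lemma trig_bernstein n (h : nat -> R) :
  trig_poly (fun y => bernstein n ((1 + sin (y / a.+1%:R)) / 2) h).
Proof.
elim: n h => [|n IH] h /=; first exact: trig_cst.
apply: (@trig_poly_ext (fun y =>
  2^-1 * (bernstein n ((1 + sin (y / a.+1%:R)) / 2) (fun k => h k.+1) +
          sin (y / a.+1%:R) * bernstein n ((1 + sin (y / a.+1%:R)) / 2) (fun k => h k.+1)) +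
  2^-1 * (bernstein n ((1 + sin (y / a.+1%:R)) / 2) h +
          -1 * (sin (y / a.+1%:R) * bernstein n ((1 + sin (y / a.+1%:R)) / 2) h)))).
  by move=> y; field.
apply: trig_add; apply: trig_scale; apply: trig_add => //.
  exact: trig_mul_sin.
by apply: trig_scale; exact: trig_mul_sin.
Qed.

(** Keeps the argument of [asin] inside [(-1, 1)], where [asin] is continuous; [sin 1] suffices
    because only [|y| <= a + 1] has to be recovered. *)
Let clamp (x : R) : R := Num.max (- sin 1) (Num.min x (sin 1)).

(** For [|y| <= a + 1], [asin] inverts the sine, so [f y] is a continuous function of
    [(1 + sin (y/(a+1)))/2], which Bernstein polynomials approximate within [e]. For larger [|y|]
    the additional error is at most [2 M], which the linear term covers. *)
Lemma trig_approximation (f : R -> R) (M e : R) : continuous f ->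
  (forall x, `|f x| <= M) -> 0 < e ->
  exists2 F, trig_poly F & forall y, `|f y - F y| <= e + 2 * M / a.+1%:R * `|y|.
Proof.
move=> cf fM e0; have M0 : 0 <= M by exact: le_trans (fM 0).
have a0 : 0 < a.+1%:R :> R by rewrite ltr0n.
have pi1 : 1 < pi / 2 :> R.
  rewrite lt_neqAle pihalf_ge1 andbT; apply/eqP => h.
  by have := @cos1_gt0 R; rewrite h cos_pihalf ltxx.
have hin (x : R) : -1 <= x <= 1 -> x \in `[(- (pi / 2)), (pi / 2)].
  by move=> /andP[x0 x1]; rewrite in_itv /=; apply/andP; split; lra.
have s1 : 0 < sin 1 :> R by apply: sin_gt0_pihalf; rewrite ltr01.
have s11 : sin 1 < 1 :> R.
  have pp : pi / 2 \in `[(- (pi / 2)), (pi / 2) : R].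
    by rewrite in_itv /= lexx andbT; lra.
  by rewrite -[ltRHS](sin_pihalf R) (ltr_sin (hin 1 _) pp)//; apply/andP; split; lra.
have clampP x : - sin 1 <= clamp x <= sin 1.
  rewrite /clamp le_max lexx /= ge_max ge_min lexx orbT andbT.
  by have := s1; lra.
pose g (x : R) := f (a.+1%:R * asin (clamp (2 * x - 1))).
have cclamp : continuous clamp.
  move=> x; apply: (@continuous_max R R (fun=> - sin 1) (fun x => Num.min x (sin 1))).
    exact: cst_continuous.
  apply: (@continuous_min R R id (fun=> sin 1)); first exact: cvg_id.
  exact: cst_continuous.
have cg : continuous g.
  have c1 : continuous (fun x : R => 2 * x - 1).
    by move=> x; apply: cvgB; [apply: cvgM; [exact: cvg_cst|exact: cvg_id]|exact: cvg_cst].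
  have c2 : continuous (asin \o (clamp \o (fun x : R => 2 * x - 1))).
    move=> x; apply: continuous_comp.
      by apply: continuous_comp; [exact: c1|exact: cclamp].
    by apply: continuous_asin; have /andP[] := clampP (2 * x - 1); rewrite /comp; lra.
  have c3 : continuous (f \o (fun x => a.+1%:R * (asin \o (clamp \o (fun x : R => 2 * x - 1))) x)).
    move=> x; apply: continuous_comp; last exact: cf.
    by apply: cvgM; [exact: cvg_cst|exact: c2].
  exact: c3.
have [n hn] := bernstein_approx cg (fun x => fM _) e0.
exists (fun y => bernstein n.+1 ((1 + sin (y / a.+1%:R)) / 2)
  (fun k => g (k%:R / n.+1%:R))); first exact: trig_bernstein.
move=> y; set x := (1 + _) / 2.
have x01 : 0 <= x <= 1.
  by have := sin_le1 (y / a.+1%:R); have := sin_geN1 (y / a.+1%:R); rewrite /x; lra.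
have := hn x x01; set b := bernstein _ _ _ => hb.
have [ya|ay] := leP `|y| a.+1%:R.
  suff -> : f y = g x.
    by apply: le_trans hb _; rewrite lerDl mulr_ge0// divr_ge0 ?mulr_ge0// ltW.
  have ya1 : -1 <= y / a.+1%:R <= 1.
    by rewrite -ler_norml normrM normfV [`|a.+1%:R|]gtr0_norm// ler_pdivrMr// mul1r.
  have -> : g x = f (a.+1%:R * asin (clamp (sin (y / a.+1%:R)))).
    by congr (f (_ * asin (clamp _))); rewrite /x; field.
  have -> : clamp (sin (y / a.+1%:R)) = sin (y / a.+1%:R).
    have /andP[y1 y2] := ya1.
    have k1 : sin (y / a.+1%:R) <= sin 1.
      move: y2; rewrite le_eqVlt => /orP[/eqP -> //|y2].
      by apply/ltW; rewrite ltr_sin ?hin//; apply/andP; split; lra.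
    have k2 : - sin 1 <= sin (y / a.+1%:R).
      rewrite -sinN; move: y1; rewrite le_eqVlt => /orP[/eqP -> //|y1].
      by apply/ltW; rewrite ltr_sin ?hin//; apply/andP; split; lra.
    by rewrite /clamp min_l// max_r.
  rewrite sinK; first by rewrite mulrC mulfVK// gt_eqF.
  exact: hin.
have fg : `|f y - g x| <= 2 * M.
  by apply: le_trans (ler_normB _ _) _; rewrite mulr2n mulrDl mul1r lerD// fM.
have : `|f y - b| <= `|f y - g x| + `|g x - b|.
  by have := ler_normD (f y - g x) (g x - b); rewrite addrA subrK.
move/le_trans; apply; rewrite addrC lerD//.
apply: le_trans fg _.
have -> : 2 * M / a.+1%:R * `|y| = 2 * M * (`|y| / a.+1%:R) by ring.
by rewrite -[leLHS]mulr1 ler_wpM2l ?mulr_ge0// ler_pdivlMr// mul1r ltW.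
Qed.

End trigonometric_approximation.

(** * Convergence in law from rational frequencies *)

Section levy.
Context (R : realType) d (T : measurableType d) (P : probability T R).
Context d' (T' : measurableType d') (Q : probability T' R).
Context (U : nat -> T -> R) (V : T' -> R).
Hypothesis mV : measurable_fun setT V.
Hypothesis iV : intble Q (fun x => `|V x|).
Hypothesis iU : forall n, intble P (fun w => `|U n w|).
Hypothesis mU : forall n, measurable_fun setT (U n).
Context (C : R).
Hypothesis U_tight : \forall n \near \oo, Ex P (fun w => `|U n w|) <= C.
Hypothesis U_cos : forall k a : nat,
  (fun n => Ex P (fun w => cos (k%:R / a.+1%:R * U n w))) @ \oo -->
  Ex Q (fun x => cos (k%:R / a.+1%:R * V x)).
Hypothesis U_sin : forall k a : nat,
  (fun n => Ex P (fun w => sin (k%:R / a.+1%:R * U n w))) @ \oo -->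
  Ex Q (fun x => sin (k%:R / a.+1%:R * V x)).

Lemma levy_trig a (F : R -> R) : trig_poly a F ->
  [/\ forall n, intble P (fun w => F (U n w)), intble Q (fun x => F (V x)) &
      (fun n => Ex P (fun w => F (U n w))) @ \oo --> Ex Q (fun x => F (V x))].
Proof.
elim=> [k|k|{}F G _ [F1 F2 F3] _ [G1 G2 G3]|c {}F _ [F1 F2 F3]].
- by split; [move=> n; exact: intble_cosM|exact: intble_cosM|exact: U_cos].
- by split; [move=> n; exact: intble_sinM|exact: intble_sinM|exact: U_sin].
- split; [by move=> n; exact: intbleD|exact: intbleD|].
  rewrite (ExD F2 G2) (_ : (fun n => _) = (fun n => Ex P (fun w => F (U n w)) + Ex P (fun w => G (U n w)))).
    exact: cvgD.
  by apply/funext => n; rewrite ExD.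
- split; [by move=> n; exact: intbleZ|exact: intbleZ|].
  rewrite (ExZ _ F2) (_ : (fun n => _) = (fun n => c * Ex P (fun w => F (U n w)))).
    by apply: cvgM => //; exact: cvg_cst.
  by apply/funext => n; rewrite ExZ.
Qed.

(** Bounded first absolute moments integrate the linear error of [trig_approximation] to
    [O(1/(a+1))], so [a] can be chosen independently of [n]; then the limit is taken for a single
    trigonometric polynomial. *)
Theorem levy_continuity (f : R -> R) (M : R) : continuous f -> (forall x, `|f x| <= M) ->
  (fun n => Ex P (fun w => f (U n w))) @ \oo --> Ex Q (fun x => f (V x)).
Proof.
move=> cf fM; have M0 : 0 <= M by exact: le_trans (fM 0).
have mf : measurable_fun setT f by exact: continuous_measurable_fun.
have ifU n : intble P (fun w => f (U n w)).
  by apply: (@intble_bounded _ _ _ _ _ M) => //; exact: measurableT_comp.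
have ifV : intble Q (fun x => f (V x)).
  by apply: (@intble_bounded _ _ _ _ _ M) => //; exact: measurableT_comp.
apply/cvgrPdist_le => e e0.
have e5 : 0 < e / 5 by rewrite divr_gt0.
pose D := `|C| + Ex Q (fun x => `|V x|).
have D0 : 0 <= D by rewrite addr_ge0// Ex_ge0.
have [a ha] : exists a : nat, 2 * M * D / (e / 5) <= a.+1%:R.
  by exists (Num.truncn (2 * M * D / (e / 5))); apply/ltW; exact: truncnS_gt.
have a0 : 0 < a.+1%:R :> R by rewrite ltr0n.
have hD : 2 * M / a.+1%:R * D <= e / 5.
  have -> : 2 * M / a.+1%:R * D = 2 * M * D / a.+1%:R by ring.
  by rewrite ler_pdivrMr// [leRHS]mulrC -ler_pdivrMr.
have c0 : 0 <= 2 * M / a.+1%:R by rewrite divr_ge0 ?mulr_ge0// ltW.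
have [F tF hF] := trig_approximation a cf fM e5.
have [F1 F2 F3] := levy_trig tF.
have bound (d0 : measure_display) (T0 : measurableType d0) (P0 : probability T0 R) (Z : T0 -> R) :
    intble P0 (fun w => `|Z w|) -> intble P0 (fun w => f (Z w)) -> intble P0 (fun w => F (Z w)) ->
    Ex P0 (fun w => `|Z w|) <= D ->
    `|Ex P0 (fun w => f (Z w)) - Ex P0 (fun w => F (Z w))| <= e / 5 + e / 5.
  move=> iZ ifZ iFZ ZD; rewrite -ExB//.
  have iB : intble P0 (fun w => e / 5 + 2 * M / a.+1%:R * `|Z w|).
    by apply: intbleD; [exact: intble_cst|exact: intbleZ].
  apply: le_trans (norm_Ex_le (intbleB ifZ iFZ) iB (fun w => hF (Z w))) _.
  rewrite (ExD (intble_cst P0 _) (intbleZ _ iZ)) Ex_cst ExZ// lerD2l.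
  by apply: le_trans hD; rewrite ler_wpM2l.
near=> n.
have bU : Ex P (fun w => `|U n w|) <= D.
  apply: (@le_trans _ _ C); first by near: n.
  by apply: le_trans (ler_norm _) _; rewrite lerDl Ex_ge0.
have {}bU := bound _ _ P (U n) (iU n) (ifU n) (F1 n) bU.
have mid : `|Ex Q (fun x => F (V x)) - Ex P (fun w => F (U n w))| <= e / 5.
  by near: n; move/cvgrPdist_le: F3; apply.
have bV : `|Ex Q (fun x => f (V x)) - Ex Q (fun x => F (V x))| <= e / 5 + e / 5.
  by apply: bound => //; rewrite lerDr.
move: bU mid bV; move: (Ex P _) (Ex P _) (Ex Q _) (Ex Q _) => x1 x2 x3 x4.
rewrite !ler_norml => /andP[? ?] /andP[? ?] /andP[? ?]; lra.
Unshelve. all: by end_near.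
Qed.

End levy.

(** * The characteristic function of the standard normal law *)

Section normal_characteristic_function.
Context (R : realType).
Local Notation mu := (@lebesgue_measure R).

Definition std_normal : probability (measurableTypeR R) R := normal_prob 0 1.

Lemma std_normal_dominated : std_normal `<< mu.
Proof. exact: normal_prob_dominates. Qed.

Definition gauss_pdf (x : R) : R := normal_peak 1 * expR (- (x ^+ 2 / 2)).

Lemma gauss_pdfE x : normal_pdf 0 1 x = gauss_pdf x.
Proof.
rewrite /normal_pdf (negbTE (oner_neq0 R)) /normal_fun /gauss_pdf; congr (_ * expR _).
by rewrite subr0 expr1n mulNr.
Qed.

Lemma measurable_gauss_pdf : measurable_fun setT gauss_pdf.
Proof.
rewrite (_ : gauss_pdf = normal_pdf 0 1); first exact: measurable_normal_pdf.
by apply/funext => x; rewrite gauss_pdfE.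
Qed.

Lemma gauss_pdf_ge0 x : 0 <= gauss_pdf x.
Proof. by rewrite mulr_ge0 ?normal_peak_ge0 ?expR_ge0. Qed.

Lemma std_normalE (A : set R) : std_normal A = (\int[mu]_(x in A) (gauss_pdf x)%:E)%E.
Proof. by apply: eq_integral => x _; rewrite gauss_pdfE. Qed.

Lemma integral_std_normal (f : R -> R) (U : set R) :
  measurable U -> std_normal.-integrable U (EFin \o f) ->
  (\int[std_normal]_(x in U) (f x)%:E = \int[mu]_(x in U) (f x * gauss_pdf x)%:E)%E.
Proof.
move=> mU fi; rewrite -(Radon_Nikodym_change_of_variables std_normal_dominated)//=.
under [RHS]eq_integral do rewrite EFinM.
have mf := measurable_int _ fi.
apply: ae_eq_integral => //.
- apply: emeasurable_funM => //; apply: (measurable_int mu).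
  apply: (integrableS _ _ (@subsetT _ _)) => //=.
  by apply: Radon_Nikodym_integrable; exact: std_normal_dominated.
- apply: emeasurable_funM => //=; apply/measurableT_comp => //=.
  by apply: measurable_funTS; exact: measurable_gauss_pdf.
- apply: ae_eqe_mul2l => /=.
  rewrite Radon_NikodymE//=; first exact: std_normal_dominated.
  move=> dom; case: cid => /= h [h1 h2 h3].
  apply: integral_ae_eq => //=.
  + exact: integrableS h2.
  + by apply: measurable_funTS; apply/measurable_EFinP; exact: measurable_gauss_pdf.
  + by move=> E EU mE; rewrite -h3//= std_normalE.
Qed.

Lemma ge0_integral_std_normal (f : R -> R) : measurable_fun setT f -> (forall x, 0 <= f x) ->
  (\int[std_normal]_x (f x)%:E = \int[mu]_x (f x * gauss_pdf x)%:E)%E.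
Proof.
move=> mf f0; have mfE : measurable_fun setT (EFin \o f) by exact/measurable_EFinP.
rewrite -(Radon_Nikodym_SigmaFinite.change_of_variables std_normal_dominated (f := EFin \o f))//=.
under [RHS]eq_integral do rewrite EFinM.
apply: ae_eq_integral => //.
- apply: emeasurable_funM => //; apply: (measurable_int mu).
  exact: (Radon_Nikodym_SigmaFinite.f_integrable std_normal_dominated).
- apply: emeasurable_funM => //=; apply/measurableT_comp => //=.
  exact: measurable_gauss_pdf.
- apply: ae_eqe_mul2l => /=; apply: integral_ae_eq => //=.
  + exact: (Radon_Nikodym_SigmaFinite.f_integrable std_normal_dominated).
  + by apply/measurable_EFinP; exact: measurable_gauss_pdf.
  + move=> E _ mE; rewrite -(Radon_Nikodym_SigmaFinite.f_integral std_normal_dominated)//.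
    exact: std_normalE.
Qed.

(** The density is compared with that of variance 2: half of the exponent absorbs the square, as
    [x^2 expR (- x^2/4) <= 4]. *)
Lemma intble_normal_sqr : intble std_normal (fun x : R => x ^+ 2).
Proof.
have mX : measurable_fun setT (fun x : R => x ^+ 2) by exact: measurable_funX.
pose s : R := Num.sqrt 2.
have s0 : s != 0 by rewrite gt_eqF// sqrtr_gt0.
have p0 : 0 < normal_peak s :> R by exact: normal_peak_gt0.
suff h : (\int[std_normal]_x (x ^+ 2)%:E <= (4 * normal_peak 1 / normal_peak s)%:E)%E.
  by case: (@ge0_intble _ _ _ std_normal _ _ mX (fun x => sqr_ge0 x) h).
rewrite ge0_integral_std_normal//; last by move=> x; exact: sqr_ge0.
have -> : (4 * normal_peak 1 / normal_peak s)%:E =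
    (\int[mu]_x (4 * normal_peak 1 / normal_peak s * normal_pdf 0 s x)%:E)%E.
  under eq_integral do rewrite EFinM.
  by rewrite integralZl//; [rewrite integral_normal_pdf mule1|exact: integrable_normal_pdf].
apply: ge0_le_integral => //.
- by move=> x _; rewrite lee_fin mulr_ge0 ?sqr_ge0 ?gauss_pdf_ge0.
- by apply/measurable_EFinP/measurable_funM => //; exact: measurable_gauss_pdf.
- by apply/measurable_EFinP/measurable_funM => //; exact: measurable_normal_pdf.
move=> x _; rewrite lee_fin /normal_pdf (negbTE s0) /normal_fun subr0 sqr_sqrtr//.
rewrite /gauss_pdf; have -> : - x ^+ 2 / (2 *+ 2) = - (x ^+ 2 / 4).
  by rewrite mulNr; congr (- (_ / _)); rewrite -mulr_natl; ring.
have -> : expR (- (x ^+ 2 / 2)) = expR (- (x ^+ 2 / 4)) * expR (- (x ^+ 2 / 4)).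
  by rewrite -expRD; congr expR; field.
have h : x ^+ 2 * expR (- (x ^+ 2 / 4)) <= 4.
  rewrite expRN ler_pdivrMr ?expR_gt0//.
  by have := expR_ge1Dx (x ^+ 2 / 4); lra.
have -> : 4 * normal_peak 1 / normal_peak s * (normal_peak s * expR (- (x ^+ 2 / 4))) =
    normal_peak 1 * expR (- (x ^+ 2 / 4)) * 4 by field; rewrite gt_eqF.
have -> : x ^+ 2 * (normal_peak 1 * (expR (- (x ^+ 2 / 4)) * expR (- (x ^+ 2 / 4)))) =
    normal_peak 1 * expR (- (x ^+ 2 / 4)) * (x ^+ 2 * expR (- (x ^+ 2 / 4))) by ring.
by rewrite ler_wpM2l// mulr_ge0 ?normal_peak_ge0 ?expR_ge0.
Qed.

Lemma intble_normal_norm : intble std_normal (fun x : R => `|x|).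
Proof.
apply: (@intble_le _ _ _ std_normal _ (fun x : R => 1 + x ^+ 2)).
- by apply: measurableT_comp => //; exact: measurable_id.
- move=> x; rewrite normr_id -[x ^+ 2]real_normK ?num_real//.
  by have := sqr_ge0 (`|x| - 1); have := normr_ge0 x; nra.
- by apply: intbleD; [exact: intble_cst|exact: intble_normal_sqr].
Qed.

Lemma intble_normal_id : intble std_normal (fun x : R => x).
Proof.
apply: (@intble_le _ _ _ std_normal _ (fun x : R => `|x|)) => //.
exact: intble_normal_norm.
Qed.

Lemma measurable_cos_phase t a : measurable_fun setT (fun x : R => cos (t * x + a)).
Proof.
apply: (measurableT_comp (continuous_measurable_fun (@continuous_cos R))).
by apply: measurable_funD => //; exact: measurable_funM.
Qed.

Lemma measurable_sin_phase t a : measurable_fun setT (fun x : R => sin (t * x + a)).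
Proof.
apply: (measurableT_comp (continuous_measurable_fun (@continuous_sin R))).
by apply: measurable_funD => //; exact: measurable_funM.
Qed.

Lemma intble_cos_phase t a : intble std_normal (fun x : R => cos (t * x + a)).
Proof.
apply: (@intble_bounded _ _ _ std_normal _ 1); first exact: measurable_cos_phase.
by move=> x; rewrite cos_max.
Qed.

Lemma intble_id_sin t a : intble std_normal (fun x : R => x * sin (t * x + a)).
Proof.
apply: (@intble_le _ _ _ std_normal _ (fun x : R => `|x|)).
- by apply: measurable_funM => //; exact: measurable_sin_phase.
- by move=> x; rewrite normrM -[leRHS]mulr1 ler_wpM2l// sin_max.
- exact: intble_normal_norm.
Qed.

Section stein.
Context (t a : R).

Let g (x : R) := t * cos (t * x + a) - x * sin (t * x + a).

Let G (x : R) := sin (t * x + a) * gauss_pdf x.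

Let is_derive_G (x : R) : is_derive x 1 G (g x * gauss_pdf x).
Proof.
rewrite (_ : G = fun y => sin (t *: (y : R^o) + a) * (normal_peak 1 *: (expR (- (2^-1 *: (y ^+ 2 : R^o))) : R^o))).
  apply: is_derive_eq; rewrite /g /gauss_pdf /GRing.scale /=.
  have -> : 2^-1 * x ^+ 2 = x ^+ 2 / 2 by rewrite mulrC.
  by rewrite -[_ *+ 2]mulr_natl; field.
apply/funext => y; rewrite /G /gauss_pdf /GRing.scale /=.
by rewrite (mulrC (y ^+ 2)).
Qed.

Let cG : continuous G.
Proof.
move=> x; apply: differentiable_continuous; apply/derivable1_diffP.
by have [] := is_derive_G x.
Qed.

Let cg : continuous (fun x => g x * gauss_pdf x).
Proof.
have cs : continuous (fun x : R => t * x + a).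
  by move=> x; apply: cvgD; last exact: cvg_cst; apply: cvgM; [exact: cvg_cst|exact: cvg_id].
have c1 : continuous (cos \o (fun x : R => t * x + a)).
  by move=> x; apply: continuous_comp; [exact: cs|exact: continuous_cos].
have c2 : continuous (sin \o (fun x : R => t * x + a)).
  by move=> x; apply: continuous_comp; [exact: cs|exact: continuous_sin].
have c3 : continuous (expR \o (fun x : R => - (x ^+ 2 / 2))).
  move=> x; apply: continuous_comp; last exact: continuous_expR.
  by apply: cvgN; apply: cvgM; [exact: exprn_continuous|exact: cvg_cst].
move=> x; apply: cvgM.
  apply: cvgB; apply: cvgM; [exact: cvg_cst|exact: c1|exact: cvg_id|exact: c2].
by apply: cvgM; [exact: cvg_cst|exact: c3].
Qed.

Let mg : measurable_fun setT g.
Proof.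
apply: measurable_funB; apply: measurable_funM => //.
  exact: measurable_cos_phase.
exact: measurable_sin_phase.
Qed.

Let g_le x : `|g x| <= `|t| + `|x|.
Proof.
apply: le_trans (ler_normB _ _) _; rewrite !normrM lerD// -[leRHS]mulr1 ler_wpM2l//.
  exact: cos_max.
exact: sin_max.
Qed.

Let intble_g : intble std_normal g.
Proof.
apply: (@intble_le _ _ _ std_normal _ (fun x => `|t| + `|x|) mg g_le).
by apply: intbleD; [exact: intble_cst|exact: intble_normal_norm].
Qed.

Let truncated n : (0 < n)%N ->
  Ex std_normal (fun x => g x * \1_`[(- n%:R), n%:R] x) = G n%:R - G (- n%:R).
Proof.
move=> n0; have np : 0 < n%:R :> R by rewrite ltr0n.
pose U : set R := `[(- n%:R), n%:R]%classic.
have e1 : (\int[std_normal]_x (g x * \1_U x)%:E = \int[std_normal]_(x in U) (g x)%:E)%E.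
  rewrite [RHS]integral_mkcond; apply: eq_integral => x _; rewrite patchE indicE.
  by case: ifP => _; rewrite ?mulr1 ?mulr0.
have mU : measurable U by exact: measurable_itv.
have iU : std_normal.-integrable U (EFin \o g).
  by apply: (@integrableS _ _ _ std_normal setT) => //; exact: intble_g.
have ab : (- n%:R) < n%:R :> R by rewrite -subr_gt0 opprK addr_gt0.
have e2 : (\int[mu]_(x in U) (g x * gauss_pdf x)%:E = (G n%:R)%:E - (G (- n%:R))%:E)%E.
  apply: (continuous_FTC2 ab).
  - exact: continuous_subspaceT.
  - split.
    + by move=> x _; have [] := is_derive_G x.
    + by apply: cvg_at_right_filter; exact: cG.
    + by apply: cvg_at_left_filter; exact: cG.
  - by move=> x _; rewrite derive1E; have [_ ->] := is_derive_G x.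
by rewrite /Ex e1 (integral_std_normal mU iU) e2.
Qed.

(** Inside [[-n, n]] the fundamental theorem leaves two boundary values, each [O(1/n)] by the decay
    of the density; outside, [|x| / n >= 1] trades the tail for a second moment divided by [n]. *)
Let tail_bound n : (0 < n)%N -> `|Ex std_normal g| <=
  (4 * normal_peak 1 + Ex std_normal (fun x => (`|t| + `|x|) * `|x|)) / n%:R.
Proof.
move=> n0; have np : 1 <= n%:R :> R by rewrite ler1n.
pose I (x : R) : R := \1_`[(- n%:R), n%:R] x.
have mI : measurable_fun setT I by exact: measurable_indic.
have iP : intble std_normal (fun x => (`|t| + `|x|) * `|x|).
  apply: (@eq_intble _ _ _ std_normal (fun x => `|t| * `|x| + x ^+ 2)).
    by move=> x; rewrite -[x ^+ 2]real_normK ?num_real//; ring.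
  by apply: intbleD; [apply: intbleZ; exact: intble_normal_norm|exact: intble_normal_sqr].
have iT : intble std_normal (fun x => g x * I x).
  apply: (@intble_le _ _ _ std_normal _ (fun x => `|t| + `|x|)).
  - exact: measurable_funM.
  - move=> x; rewrite normrM; apply: le_trans (g_le x); rewrite -[leRHS]mulr1 ler_wpM2l//.
    by rewrite /I indicE; case: (_ \in _); rewrite ?normr1 ?normr0.
  - by apply: intbleD; [exact: intble_cst|exact: intble_normal_norm].
have -> : Ex std_normal g = (G n%:R - G (- n%:R)) + Ex std_normal (fun x => g x - g x * I x).
  by rewrite (ExB intble_g iT) -(truncated n0) addrC subrK.
apply: le_trans (ler_normD _ _) _; rewrite mulrDl lerD//.
  have hG s : s ^+ 2 = n%:R ^+ 2 -> `|G s| <= 2 * normal_peak 1 / n%:R.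
    move=> sn; rewrite /G normrM -[leRHS]mul1r ler_pM//; first exact: sin_max.
    rewrite ger0_norm ?gauss_pdf_ge0// /gauss_pdf sn.
    have -> : 2 * normal_peak 1 / n%:R = normal_peak 1 * (n%:R / 2)^-1 :> R.
      by rewrite invf_div; ring.
    apply: ler_wpM2l; rewrite ?normal_peak_ge0// expRN.
    rewrite lef_pV2 ?posrE ?divr_gt0 ?expR_gt0 ?(lt_le_trans ltr01 np)//.
    by have := expR_ge1Dx (n%:R ^+ 2 / 2 : R); nra.
  apply: le_trans (ler_normB _ _) _; have := hG n%:R (erefl _); have := hG (- n%:R) (sqrrN _).
  by lra.
rewrite mulrC -(ExZ _ iP); apply: norm_Ex_le.
- exact: intbleB.
- exact: intbleZ.
move=> x; rewrite /I indicE; have [_|nI] := boolP (x \in `[- n%:R, n%:R]%classic);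
  rewrite ?mulr1 ?mulr0 ?subrr ?subr0.
  by rewrite normr0 !mulr_ge0// ?invr_ge0 ?addr_ge0//; lra.
have nx : n%:R < `|x|.
  by rewrite ltNge; apply: contra nI => nx; rewrite inE /= in_itv /= -ler_norml.
apply: le_trans (g_le x) _; rewrite mulrC -mulrA ler_peMr ?addr_ge0//.
by rewrite ler_pdivlMr ?mul1r ?ltW//; lra.
Qed.

(** Gaussian integration by parts: [|Ex std_normal g|] is at most [C / n] for every positive [n],
    hence zero. *)
Lemma stein_cos : Ex std_normal (fun x => x * sin (t * x + a)) =
  t * Ex std_normal (fun x => cos (t * x + a)).
Proof.
suff : Ex std_normal g = 0.
  have i1 := intble_cos_phase t a; have i2 := intble_id_sin t a.
  by rewrite /g ExB ?ExZ//; [move=> /eqP; rewrite subr_eq0 => /eqP|exact: intbleZ].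
apply/eqP; rewrite -normr_eq0 eq_le normr_ge0 andbT leNgt; apply/negP => e0.
set C := 4 * normal_peak 1 + Ex std_normal (fun x => (`|t| + `|x|) * `|x|).
pose n := (Num.truncn (C / `|Ex std_normal g|)).+1.
have n0 : 0 < n%:R :> R by rewrite ltr0n.
have h1 : C / `|Ex std_normal g| < n%:R by exact: truncnS_gt.
have := tail_bound (ltn0Sn _ : (0 < n)%N); rewrite -/C leNgt => /negP; apply.
by rewrite ltr_pdivrMr// mulrC -ltr_pdivrMr.
Qed.

End stein.

Let F a t := Ex std_normal (fun x => cos (t * x + a)).

(** A quadratic remainder, so that the difference quotients of [F] miss the derivative by at most a
    multiple of [|h|] times the second moment of the normal law. *)
Let phase_step (u y : R) : `|cos (u + y) - cos u + y * sin u| <= 2 * y ^+ 2 :> R.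
Proof.
have h1 : `|cos y - 1| <= y ^+ 2.
  rewrite ler_norml; have := cos_lower_bound y; have := cos_le1 y; have := sqr_ge0 y.
  by move=> *; apply/andP; split; lra.
have h2 : `|y - sin y| <= y ^+ 2.
  have key (z : R) : 0 <= z -> `|z - sin z| <= z ^+ 2.
    move=> z0; rewrite ger0_norm ?subr_ge0 ?sin_le_id//.
    have [z6|/ltW z6] := leP z 6.
      have := sin_lower_bound z0; have : z ^+ 3 <= 6 * z ^+ 2.
        by rewrite exprS ler_wpM2r// sqr_ge0.
      by lra.
    by have := sin_geN1 z; nra.
  have [y0|/ltW y0] := leP 0 y; first exact: key.
  by have := key (- y); rewrite oppr_ge0 sinN sqrrN -opprD normrN; apply.
have -> : cos (u + y) - cos u + y * sin u = cos u * (cos y - 1) + sin u * (y - sin y).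
  by rewrite cosD; ring.
apply: le_trans (ler_normD _ _) _; rewrite !normrM mulr_natl mulr2n.
by apply: lerD; rewrite -[leRHS]mul1r; apply: ler_pM => //; rewrite ?cos_max ?sin_max.
Qed.

Let is_derive_F (a t : R) : is_derive t 1 (F a) (- t * F a t).
Proof.
pose V := Ex std_normal (fun x : R => x ^+ 2).
have V0 : 0 <= V by apply: Ex_ge0 => x; exact: sqr_ge0.
have V1 : 0 < 2 * V + 1 by clearbody V; lra.
have i2 : intble std_normal (fun x : R => x * sin (t * x + a)) by exact: intble_id_sin.
have step h : `|F a (t + h) - F a t + h * (t * F a t)| <= 2 * h ^+ 2 * V.
  have i1 s := intble_cos_phase s a.
  have i3 := intbleB (i1 (t + h)) (i1 t); have i4 := intbleZ h i2.
  rewrite /F -stein_cos -(ExZ h i2) -(ExB (i1 _) (i1 _)) -(ExD i3 i4).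
  rewrite /V -(ExZ _ intble_normal_sqr); apply: norm_Ex_le.
  - exact: intbleD.
  - by apply: intbleZ; exact: intble_normal_sqr.
  move=> x; rewrite -mulrA -exprMn.
  have -> : (t + h) * x + a = t * x + a + h * x by ring.
  by rewrite mulrA; exact: phase_step.
have cv : (fun h => h^-1 *: (F a (h *: (1 : R^o) + t) - F a t)) @ 0^' --> (- t * F a t : R^o).
  apply/cvgrPdist_le => /= e e0; near=> h.
  have h0 : h != 0 by near: h; exact: nbhs_dnbhs_neq.
  rewrite /GRing.scale /= mulr1 distrC.
  have -> : h^-1 * (F a (h + t) - F a t) - - t * F a t =
      h^-1 * (F a (t + h) - F a t + h * (t * F a t)).
    by rewrite (addrC h); field.
  rewrite normrM normfV ler_pdivrMl ?normr_gt0//; apply: le_trans (step h) _.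
  rewrite -[h ^+ 2]real_normK ?num_real// [leLHS](_ : _ = `|h| * (`|h| * (2 * V))); last by ring.
  rewrite ler_wpM2l//.
  have hd : `|h| < e / (2 * V + 1).
    by near: h; apply: dnbhs0_lt; rewrite divr_gt0.
  apply: le_trans (_ : `|h| * (2 * V + 1) <= _).
    by apply: ler_wpM2l => //; rewrite lerDl.
  by rewrite -ler_pdivlMr// ltW.
have dF : derivable (F a) t 1 by apply/cvg_ex; exists (- t * F a t).
by split => //; apply/cvg_lim.
Unshelve. all: end_near. Qed.

(* Stein's identity is the equation [F' = - t F] for the left-hand side [F]; the phase [a]
   treats [cos] and [sin] at once. *)
Lemma normal_phase t a : Ex std_normal (fun x => cos (t * x + a)) = cos a * expR (- (t ^+ 2 / 2)).
Proof.
pose L (s : R) : R^o := F a s * expR (2^-1 *: (s ^+ 2 : R^o)).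
have dL (s : R) : is_derive s 1 L 0.
  have := is_derive_F a s => dF.
  apply: is_derive_eq; rewrite /GRing.scale /=.
  have -> : 2^-1 * (s * 1 + s * 1) = s by rewrite mulr1; field.
  by clearbody F; ring.
have := @is_derive_0_is_cst R L t 0 dL.
rewrite /L /F /GRing.scale /= expr0n /= mulr0 expR0 mulr1.
under [X in _ = X]eq_Ex do rewrite mul0r add0r.
by rewrite Ex_cst => <-; rewrite -mulrA -expRD (mulrC 2^-1) subrr expR0 mulr1.
Qed.

Lemma normal_cos t : Ex std_normal (fun x => cos (t * x)) = expR (- (t ^+ 2 / 2)).
Proof.
have := normal_phase t 0; rewrite cos0 mul1r => <-.
by apply: eq_Ex => x; rewrite addr0.
Qed.

Lemma normal_sin t : Ex std_normal (fun x => sin (t * x)) = 0.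
Proof.
have := normal_phase t (- (pi / 2)); rewrite cosN cos_pihalf mul0r => <-.
by apply: eq_Ex => x; rewrite cosBpihalf.
Qed.

End normal_characteristic_function.

(** * The quenched central limit theorem *)

Section square_integrable.
Context (R : realType) d (T : measurableType d) (P : probability T R).

Lemma intble_sqr_id (f : T -> R) : measurable_fun setT f ->
  intble P (fun w => f w ^+ 2) -> intble P f.
Proof.
move=> mf f2; apply: (intble_le mf (g := fun w => 1 + f w ^+ 2)).
  move=> w; rewrite -[f w ^+ 2]real_normK ?num_real//.
  by move: `|_| (normr_ge0 (f w)) => x x0; have := sqr_ge0 (x - 1); rewrite sqrrB; nra.
by apply: intbleD => //; exact: intble_cst.
Qed.

Lemma intble_sqrB (f g : T -> R) : measurable_fun setT f -> measurable_fun setT g ->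
  intble P (fun w => f w ^+ 2) -> intble P (fun w => g w ^+ 2) ->
  intble P (fun w => (f w - g w) ^+ 2).
Proof.
move=> mf mg f2 g2; apply: (intble_le _ (g := fun w => 2 * f w ^+ 2 + 2 * g w ^+ 2)).
- by apply: measurable_funX; exact: measurable_funB.
- move=> w; rewrite ger0_norm ?sqr_ge0//.
  by move: (f w) (g w) => x y; have := sqr_ge0 (x + y); rewrite sqrrB sqrrD; nra.
- by apply: intbleD; exact: intbleZ.
Qed.

Lemma Ex_norm_le_power (f : T -> R) (e r : R) (p : nat) : 0 < e -> (0 < p)%N ->
  intble P f -> intble P (fun w => f w ^+ p.*2) ->
  Ex P (fun w => f w ^+ p.*2) <= r -> Ex P (fun w => `|f w|) <= e + r / e ^+ p.*2.-1.
Proof.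
move=> e0 p0 fi fp fr.
have i2 := intbleZ (e ^+ p.*2.-1)^-1 fp.
apply: (@le_trans _ _ (Ex P (fun w => e + (e ^+ p.*2.-1)^-1 * f w ^+ p.*2))).
  apply: le_Ex; [exact: intble_norm|by apply: intbleD => //; exact: intble_cst|].
  by move=> w; rewrite [_^-1 * _]mulrC; exact: norm_le_power.
rewrite (ExD (intble_cst P e) i2) Ex_cst ExZ// mulrC lerD2l ler_wpM2r//.
by rewrite invr_ge0 exprn_ge0// ltW.
Qed.

End square_integrable.

Section central_limit.
Context (R : realType) d (Om : measurableType d) (PP : probability Om R).
Context (Y : nat -> Om -> R).
Hypothesis iidY : iid_R PP Y 0.
Hypothesis symY : forall B : set R, measurable B ->
  PP (Y 0 @^-1` B) = PP ((fun w => - Y 0 w) @^-1` B).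
Hypothesis momY : forall k : nat, (1 <= k)%N ->
  PP.-integrable setT (fun w => (`|Y 0 w| ^+ k)%:E).
Hypothesis varY : (\int[PP]_w (Y 0 w ^+ 2)%:E = 1)%E.
Context d' (Om' : measurableType d') (P : probability Om' R).
Context (X : nat -> Om' -> nat).
Hypothesis iidX : iid_N P X.
Hypothesis X_gt0 : forall i w, (0 < X i w)%N.
Hypothesis X_aperiodic : aperiodic (support_N P (X 0)).
Hypothesis X_intble : intble P (fun w => (X 0 w)%:R).
Hypothesis X2_intble : intble P (fun w => (X 0 w)%:R ^+ 2).

Definition normalized (n : nat) (om : Om) (w : Om') : R :=
  (walk_sum Y X n om w - Ex P (walk_sum Y X n om)) / Num.sqrt n%:R.

Let Z j om w : R := (Num.sqrt (block j)%:R)^-1 * fluct Y P X (block j) om w.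

(* This term depends on the scenery only, so centering removes it. *)
Let drift j om : R :=
  (Ex P (fun w => (X 0 w)%:R))^-1 * \sum_(1 <= x < (horizon P X (block j)).+1) Y x om.

Lemma walk_sum_decomposition j n om w : walk_sum Y X n om w =
  increment Y X (block j) n om w + boundary Y P X j om w +
  Num.sqrt (block j)%:R * Z j om w + drift j om.
Proof.
have b0 : Num.sqrt (block j)%:R != 0 :> R by rewrite gt_eqF// sqrtr_gt0 ltr0n block_gt0.
rewrite /Z mulVKf// -addrA.
have -> : fluct Y P X (block j) om w + drift j om = site_sum Y X (horizon P X (block j)) om w.
  rewrite /fluct /drift /site_sum mulr_sumr -big_split /=; apply: eq_bigr => x _.
  by rewrite mulrBl subrK.
by rewrite /increment /boundary; ring.
Qed.

Let measurable_walk n om : measurable_fun setT (walk_sum Y X n om).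
Proof. exact: (measurable_fun_pair2 om (measurable_walk_sum iidY iidX n)). Qed.

Let measurable_site N om : measurable_fun setT (site_sum Y X N om).
Proof. exact: (measurable_fun_pair2 om (measurable_site_sum iidY iidX X_gt0 N)). Qed.

Let measurable_increment a b om : measurable_fun setT (increment Y X a b om).
Proof. exact: measurable_funB. Qed.

Let intble_Z j om k : intble P (fun w => Z j om w ^+ k).
Proof. exact: (Ex_fluct Y iidX X_gt0 _ om (fun z => (_ * z) ^+ k)).1. Qed.

Let intble_Z1 j om : intble P (Z j om).
Proof. exact: (eq_intble (fun w => expr1 _) (intble_Z j om 1)). Qed.

Let square_integrable om := forall a b : nat, (a <= b)%N ->
  intble P (fun w => increment Y X a b om w ^+ block_power.*2) /\
  intble P (fun w => increment Y X a b om w ^+ 2).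

Let intble_walk om n : square_integrable om ->
  intble P (fun w => walk_sum Y X n om w ^+ 2).
Proof.
move=> /(_ 0%N n (leq0n n)) [_ h]; apply: eq_intble h => w.
by rewrite /increment /walk_sum (big_geq (leqnn 0)) subr0.
Qed.

Let intble_boundary om j : square_integrable om ->
  intble P (fun w => boundary Y P X j om w ^+ 2).
Proof.
move=> h; apply: intble_sqrB => //; first exact: intble_walk.
exact: (intble_site_sum iidY iidX X_gt0).
Qed.

Let intble_increment om a b : square_integrable om -> (a <= b)%N ->
  intble P (increment Y X a b om).
Proof. by move=> h ab; apply: intble_sqr_id => //; exact: (h a b ab).2. Qed.

Let Ex_norm_Z om j : Ex P (fun w => Z j om w ^+ 2) <= 6 -> Ex P (fun w => `|Z j om w|) <= 7.
Proof.
move=> Z2; have := Ex_norm_le_power ltr01 (isT : (0 < 1)%N) (intble_Z1 j om) (intble_Z j om 2) Z2.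
by rewrite expr1n divr1; move/le_trans; apply; lra.
Qed.

Lemma intble_normalized om n : square_integrable om -> intble P (normalized n om).
Proof.
move=> h; have iw : intble P (walk_sum Y X n om).
  by apply: intble_sqr_id => //; exact: intble_walk.
apply: (@eq_intble _ _ _ P (fun w => (Num.sqrt n%:R)^-1 *
  (walk_sum Y X n om w - Ex P (walk_sum Y X n om)))).
  by move=> w; rewrite mulrC.
by apply: intbleZ; apply: intbleB => //; exact: intble_cst.
Qed.

(** The constants 2 pay for centering the increment and the boundary term. Dividing by [sqrt n]
    instead of the root of the block start multiplies [Z] by [q <= 1], and 7 bounds its first
    absolute moment. The last term is the quenched mean of [Z]. *)
Lemma normalized_dist om j n : square_integrable om -> (block j <= n)%N ->
  Ex P (fun w => Z j om w ^+ 2) <= 6 ->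
  Ex P (fun w => `|normalized n om w - Z j om w|) <=
    2 * Ex P (fun w => `|increment Y X (block j) n om w / Num.sqrt (block j)%:R|) +
    2 * Ex P (fun w => `|boundary Y P X j om w / Num.sqrt (block j)%:R|) +
    7 * (1 - Num.sqrt (block j)%:R / Num.sqrt n%:R) + `|Ex P (Z j om)|.
Proof.
move=> h jn Z6.
pose s : R := Num.sqrt (block j)%:R; pose a : R := Num.sqrt n%:R.
have s0 : 0 < s by rewrite sqrtr_gt0 ltr0n block_gt0.
have sa : s <= a by rewrite ler_wsqrtr// ler_nat.
have a0 : 0 < a by exact: lt_le_trans sa.
pose D w := s^-1 * increment Y X (block j) n om w.
pose A w := s^-1 * boundary Y P X j om w.
have iD : intble P D by apply: intbleZ; exact: intble_increment.
have iA : intble P A.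
  apply: intbleZ; apply: intble_sqr_id; last exact: intble_boundary.
  exact: measurable_funB.
have iZ := intble_Z1 j om; have Z7 := Ex_norm_Z Z6.
have walkE w : walk_sum Y X n om w = s * D w + s * A w + s * Z j om w + drift j om.
  by rewrite (walk_sum_decomposition j) /D /A !mulVKf// gt_eqF.
have EW : Ex P (walk_sum Y X n om) =
    s * Ex P D + s * Ex P A + s * Ex P (Z j om) + drift j om.
  have j1 := intbleZ s iD; have j2 := intbleZ s iA; have j3 := intbleZ s iZ.
  have j12 := intbleD j1 j2; have j123 := intbleD j12 j3.
  rewrite (eq_Ex _ walkE) (ExD j123 (intble_cst P _)) Ex_cst (ExD j12 j3) (ExD j1 j2).
  by rewrite (ExZ s iD) (ExZ s iA) (ExZ s iZ).
pose q := s / a.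
have q0 : 0 <= q by rewrite divr_ge0// ltW.
have q1 : q <= 1 by rewrite ler_pdivrMr// mul1r.
have dE w : normalized n om w - Z j om w =
  q * (D w - Ex P D) + q * (A w - Ex P A) + (q - 1) * Z j om w - q * Ex P (Z j om).
  by rewrite /normalized walkE EW -/a /q; field; rewrite gt_eqF.
rewrite (eq_Ex _ (fun w => congr1 Num.norm (dE w))).
pose B w := (`|D w| + `|Ex P D|) + (`|A w| + `|Ex P A|) + (1 - q) * `|Z j om w| + `|Ex P (Z j om)|.
have iDn := intble_norm iD; have iAn := intble_norm iA; have iZn := intble_norm iZ.
have i1 : intble P (fun w => `|D w| + `|Ex P D|) by apply: intbleD => //; exact: intble_cst.
have i2 : intble P (fun w => `|A w| + `|Ex P A|) by apply: intbleD => //; exact: intble_cst.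
have i3 : intble P (fun w => (1 - q) * `|Z j om w|) by exact: intbleZ.
have i12 := intbleD i1 i2; have i123 := intbleD i12 i3.
have iB : intble P B by apply: intbleD => //; exact: intble_cst.
have EB : Ex P B = (Ex P (fun w => `|D w|) + `|Ex P D|) + (Ex P (fun w => `|A w|) + `|Ex P A|) +
    (1 - q) * Ex P (fun w => `|Z j om w|) + `|Ex P (Z j om)|.
  rewrite /B (ExD i123 (intble_cst P _)) (ExD i12 i3) (ExD i1 i2).
  by rewrite (ExD iDn (intble_cst P _)) (ExD iAn (intble_cst P _)) (ExZ (1 - q) iZn) !Ex_cst.
apply: (@le_trans _ _ (Ex P B)).
  apply: le_Ex => //.
    have j1 := intbleZ q (intbleB iD (intble_cst P (Ex P D))).
    have j2 := intbleZ q (intbleB iA (intble_cst P (Ex P A))).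
    have j3 := intbleD (intbleD j1 j2) (intbleZ (q - 1) iZ).
    exact: intble_norm (intbleB j3 (intble_cst P _)).
  have qle x : `|q * x| <= `|x| by rewrite normrM (ger0_norm q0) ler_piMl.
  move=> w; apply: le_trans (ler_normB _ _) _; apply: lerD; last exact: qle.
  apply: le_trans (ler_normD _ _) _; apply: lerD; last first.
    by rewrite normrM (_ : `|q - 1| = 1 - q)// distrC ger0_norm ?subr_ge0.
  apply: le_trans (ler_normD _ _) _.
  by apply: lerD; apply: le_trans (qle _) _; exact: ler_normB.
rewrite EB.
have eD : Ex P (fun w => `|increment Y X (block j) n om w / s|) = Ex P (fun w => `|D w|).
  by apply: eq_Ex => w; rewrite /D mulrC.
have eA : Ex P (fun w => `|boundary Y P X j om w / s|) = Ex P (fun w => `|A w|).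
  by apply: eq_Ex => w; rewrite /A mulrC.
rewrite -/s -/a -/q eD eA.
have nD : `|Ex P D| <= Ex P (fun w => `|D w|) by apply: norm_Ex_le.
have nA : `|Ex P A| <= Ex P (fun w => `|A w|) by apply: norm_Ex_le.
have nZ : (1 - q) * Ex P (fun w => `|Z j om w|) <= 7 * (1 - q).
  by rewrite mulrC ler_wpM2r// subr_ge0.
rewrite lerD2r; apply: lerD nZ.
by move: nD nA; move: `|Ex P D| `|Ex P A| (Ex P _) (Ex P _) => x y z t; lra.
Qed.

Lemma block_sqrt_ratio : (fun j => Num.sqrt (block j)%:R / Num.sqrt (block j.+1)%:R) @ \oo --> (1 : R).
Proof.
have E j : Num.sqrt (block j)%:R = j.+1%:R ^+ 24 :> R.
  by rewrite blockE -[48%N]/(24 * 2)%N exprM sqrtr_sqr ger0_norm// exprn_ge0.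
have -> : (fun j => Num.sqrt (block j)%:R / Num.sqrt (block j.+1)%:R) =
    (fun j => (1 - j.+2%:R^-1 : R) ^+ 24).
  apply/funext => j; rewrite !E -expr_div_n; congr (_ ^+ _).
  have -> : j.+1%:R = j.+2%:R - 1 :> R by rewrite -[j.+2%:R]natr1 addrK.
  by rewrite mulrBl mulfV ?pnatr_eq0// mul1r.
have h0 : (fun j => j.+2%:R^-1 : R) @ \oo --> (0 : R).
  by have := @cvg_harmonic R; rewrite -cvg_shiftS.
have h1 : (fun j => 1 - j.+2%:R^-1 : R) @ \oo --> (1 - 0 : R).
  by apply: cvgB => //; exact: cvg_cst.
have h2 : (fun j => (1 - j.+2%:R^-1 : R) ^+ 24) @ \oo --> ((1 - 0) ^+ 24 : R).
  by apply: (@cvg_comp _ _ _ _ (fun x : R => x ^+ 24) _ _ _ h1); exact: exprn_continuous.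
by move: h2; rewrite subr0 expr1n.
Qed.

Lemma block_close om : square_integrable om ->
  (fun j => Ex P (fun w => boundary Y P X j om w ^+ 2) / (block j)%:R) @ \oo --> (0 : R) ->
  (fun j => block_increment Y P X j om) @ \oo --> (0 : R) ->
  (fun j => Ex P (Z j om)) @ \oo --> (0 : R) ->
  (\forall j \near \oo, Ex P (fun w => Z j om w ^+ 2) <= 6) ->
  forall e : R, 0 < e -> \forall j \near \oo, forall n, (block j <= n < block j.+1)%N ->
    Ex P (fun w => `|normalized n om w - Z j om w|) <= e.
Proof.
move=> h hA hD hm h6 e e0.
(* The four terms of [normalized_dist] will be at most [4c + 4c + 7c + c = 16c]. *)
pose c := e / 16; have c0 : 0 < c by rewrite divr_gt0.
have cp k : 0 < c ^+ k by rewrite exprn_gt0.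
near=> j => n /andP[jn nj].
have b0 : 0 < (block j)%:R :> R by rewrite ltr0n block_gt0.
have s0 : 0 < Num.sqrt (block j)%:R :> R by rewrite sqrtr_gt0.
have s2 : Num.sqrt (block j)%:R ^+ 2 = (block j)%:R :> R by rewrite sqr_sqrtr// ltW.
have s2p p : Num.sqrt (block j)%:R ^+ p.*2 = (block j)%:R ^+ p :> R by rewrite -mul2n exprM s2.
have j6 : Ex P (fun w => Z j om w ^+ 2) <= 6 by near: j.
have jm : `|Ex P (Z j om)| <= c.
  by near: j; have /cvgrPdist_le/(_ c c0) := hm; apply: filterS => j; rewrite sub0r normrN.
have jA : Ex P (fun w => boundary Y P X j om w ^+ 2) / (block j)%:R <= c ^+ 2.
  by apply: ltW; near: j; exact: cvgr_lt hA _ (cp 2).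
have jD : block_increment Y P X j om <= c ^+ block_power.*2.
  by apply: ltW; near: j; exact: cvgr_lt hD _ (cp block_power.*2).
have jr : 1 - Num.sqrt (block j)%:R / Num.sqrt (block j.+1)%:R <= c.
  near: j; have /cvgrPdist_le/(_ c c0) := block_sqrt_ratio; apply: filterS => j.
  exact: le_trans (ler_norm _).
apply: le_trans (normalized_dist h jn j6) _.
have iAz : intble P (fun w => boundary Y P X j om w) .
  by apply: intble_sqr_id; [exact: measurable_funB|exact: intble_boundary].
have [iD98 _] := h _ _ jn; have iD := intble_increment h jn.
(* The threshold [c] in [Ex_norm_le_power] matches the moment bound [c^(2p)], so both of its terms
   equal [c]. The increment uses [p = block_power], the boundary term [p = 1]. *)
have small (f : Om' -> R) p : (0 < p)%N -> intble P f -> intble P (fun w => f w ^+ p.*2) ->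
    Ex P (fun w => f w ^+ p.*2) / (block j)%:R ^+ p <= c ^+ p.*2 ->
    Ex P (fun w => `|f w / Num.sqrt (block j)%:R|) <= 2 * c.
  move=> p0 fi fp fc; have -> : 2 * c = c + c ^+ p.*2 / c ^+ p.*2.-1.
    have -> : p.*2 = p.*2.-1.+1 by rewrite prednK// double_gt0.
    by rewrite /= exprS mulfK ?gt_eqF// mulr_natl mulr2n.
  have fE w : (Num.sqrt (block j)%:R ^+ p.*2)^-1 * f w ^+ p.*2 =
      (f w / Num.sqrt (block j)%:R) ^+ p.*2 by rewrite expr_div_n mulrC.
  apply: Ex_norm_le_power => //.
  - by apply: eq_intble (intbleZ (Num.sqrt (block j)%:R)^-1 fi) => w; rewrite mulrC.
  - exact: eq_intble fE (intbleZ _ fp).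
  by rewrite -(eq_Ex _ fE) (ExZ _ fp) s2p mulrC.
have e1 : Ex P (fun w => `|increment Y X (block j) n om w / Num.sqrt (block j)%:R|) <= 2 * c.
  (* The time [n] is among those summed in [block_increment], whose terms are nonnegative. *)
  apply: (small _ block_power) => //; apply: le_trans jD.
  have ni : (n - block j < block j.+1 - block j)%N by rewrite ltn_sub2r// (leq_ltn_trans jn).
  rewrite /block_increment (bigD1 (Ordinal ni))//= subnKC// lerDl.
  apply: sumr_ge0 => i _; rewrite divr_ge0 ?exprn_ge0 ?(ltW b0)//.
  by apply: Ex_ge0 => w; exact: increment_power_ge0.
have e2 : Ex P (fun w => `|boundary Y P X j om w / Num.sqrt (block j)%:R|) <= 2 * c.
  by apply: (small _ 1%N) => //; exact: intble_boundary.
have e3 : 1 - Num.sqrt (block j)%:R / Num.sqrt n%:R <= c.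
  apply: le_trans jr; rewrite lerD2l lerN2 ler_wpM2l ?(ltW s0)//.
  have n0 : 0 < Num.sqrt n%:R :> R by rewrite sqrtr_gt0 ltr0n (leq_trans (block_gt0 j)).
  rewrite lef_pV2 ?posrE// ?sqrtr_gt0 ?ltr0n ?block_gt0//.
  by rewrite ler_wsqrtr// ler_nat ltnW.
have -> : e = 16 * c by rewrite /c; field.
clearbody c; move: e1 e2 e3 jm; move: (Ex _ _) (Ex _ _) (1 - _) `|_| => x1 x2 x3 x4.
by lra.
Unshelve. all: by end_near.
Qed.

Lemma cvg_along_blocks (F g : nat -> R) (l : R) : g @ \oo --> l ->
  (forall e : R, 0 < e -> \forall j \near \oo, forall n, (block j <= n < block j.+1)%N ->
    `|F n - g j| <= e) ->
  F @ \oo --> l.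
Proof.
move=> gl FG; apply/cvgrPdist_le => e e0.
have e2 : 0 < e / 2 by rewrite divr_gt0.
have [J _ hJ] : \forall j \near \oo, `|l - g j| <= e / 2 /\
    forall n, (block j <= n < block j.+1)%N -> `|F n - g j| <= e / 2.
  have /cvgrPdist_le/(_ _ e2) h1 := gl; have h2 := FG _ e2.
  by apply: filterS2 h1 h2 => j.
exists (block J) => // n /= Jn; have [j [Jj jn]] := block_index Jn.
have [h1 h2] := hJ j Jj; have := h2 n jn; rewrite distrC => h3.
have -> : l - F n = (l - g j) + (g j - F n) by ring.
by apply: le_trans (ler_normD _ _) _; lra.
Qed.

Let v : R := 1 - (Ex P (fun w => (X 0 w)%:R))^-1.

(** The null set is fixed before [f]: it comes from countably many frequencies and times, and for a
    scenery outside it the rest of the argument involves the walk only. *)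
Theorem quenched_clt : {ae PP, forall om, forall f : R -> R, continuous f ->
  (exists M, forall x, `|f x| <= M) ->
  (fun n => Ex P (fun w => f (normalized n om w))) @ \oo -->
  Ex (@std_normal R) (fun x => f (Num.sqrt v * x))}.
Proof.
have q1 := ae_quenched_limits iidY symY momY varY iidX X_gt0 X_aperiodic X_intble X2_intble.
have q2 := ae_boundary iidY symY momY varY iidX X_gt0 X_intble X2_intble.
have q3 : {ae PP, forall om, square_integrable om /\
    (fun j => block_increment Y P X j om) @ \oo --> (0 : R)}.
  have h1 := ae_intble_increment iidY symY momY iidX X_gt0.
  have h2 := ae_block_increment iidY symY momY iidX X_gt0.
  by apply: filterS2 h1 h2 => om.
apply: filterS3 q1 q2 q3 => om [qc qs qm q6] qb [qi qD] f cf [M fM].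
have close := block_close qi qb qD qm q6.
have mN n : measurable_fun setT (normalized n om).
  by apply: measurable_funM => //; apply: measurable_funB.
have iN n := intble_normalized n qi.
have iD n j : intble P (fun w => normalized n om w - Z j om w).
  exact: intbleB (iN n) (intble_Z1 j om).
have [_ _ /andP[mu0 mu1] _] := mean_bounds X_gt0 X_intble.
have v0 : 0 <= v by rewrite subr_ge0.
(* Cosine and sine are 1-Lipschitz, so the characteristic functions at [n] and at the start of its
   block differ by at most [|t|] times a mean distance that [block_close] makes small; dividing by
   [|t| + 1] allows [t = 0]. *)
have transfer (g : R -> R) (t : R) : measurable_fun setT g -> (forall x, `|g x| <= 1) ->
    (forall x y, `|g x - g y| <= `|x - y|) -> forall e : R, 0 < e ->
    \forall j \near \oo, forall n, (block j <= n < block j.+1)%N ->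
    `|Ex P (fun w => g (t * normalized n om w)) -
      Ex P (fun w => g (t / Num.sqrt (block j)%:R * fluct Y P X (block j) om w))| <= e.
  move=> mg g1 gL e e0.
  have t0 : 0 < `|t| + 1 by rewrite ltr_wpDl.
  have et : 0 < e / (`|t| + 1) by rewrite divr_gt0.
  apply: filterS (close _ et) => j hj n jn; have := hj n jn; rewrite ler_pdivlMr// => {}hj.
  have ig (U : Om' -> R) : measurable_fun setT U -> intble P (fun w => g (t * U w)).
    move=> mU; apply: (@intble_bounded _ _ _ P _ 1) => //.
    by apply: (measurableT_comp mg); exact: measurable_funM.
  have gZ w : g (t / Num.sqrt (block j)%:R * fluct Y P X (block j) om w) = g (t * Z j om w).
    by rewrite /Z mulrA.
  have mZ := intble_measurable (intble_Z1 j om).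
  rewrite (eq_Ex _ gZ) -(ExB (ig _ (mN n)) (ig _ mZ)).
  have iDn := intble_norm (iD n j).
  apply: le_trans hj; rewrite mulrC -(ExZ _ iDn); apply: norm_Ex_le.
  - exact: intbleB (ig _ (mN n)) (ig _ mZ).
  - exact: intbleZ.
  move=> w; apply: le_trans (gL _ _) _; rewrite -mulrBr normrM ler_wpM2r//.
  by rewrite lerDl.
have normal_char (k a : nat) : Ex (@std_normal R) (fun x => cos (k%:R / a.+1%:R * (Num.sqrt v * x))) =
    gauss_char P X (k%:R / a.+1%:R).
  have := normal_cos (k%:R / a.+1%:R * Num.sqrt v).
  rewrite exprMn sqr_sqrtr// [_ * v]mulrC /gauss_char -/v => <-.
  by apply: eq_Ex => x; rewrite mulrA.
apply: (@levy_continuity _ _ _ P _ _ (@std_normal R) (fun n => normalized n om)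
  (fun x => Num.sqrt v * x) _ _ _ _ 8 _ _ _ f M) => //.
- exact: measurable_funM.
- by apply: intble_norm; apply: intbleZ; exact: intble_normal_id.
- by move=> n; exact: intble_norm.
(* The bound 8 is 7 for [Z] at the block start plus 1 for the distance to it. *)
- have [J _ hJ] : \forall j \near \oo, Ex P (fun w => Z j om w ^+ 2) <= 6 /\
      forall n, (block j <= n < block j.+1)%N -> Ex P (fun w => `|normalized n om w - Z j om w|) <= 1.
    by apply: filterS2 q6 (close _ ltr01) => j.
  exists (block J) => // n /= Jn; have [j [Jj jn]] := block_index Jn.
  have [h1 h2] := hJ j Jj; have {}h2 := h2 n jn; have h3 := Ex_norm_Z h1.
  have iDn := intble_norm (iD n j); have iZn := intble_norm (intble_Z1 j om).
  apply: (@le_trans _ _ (Ex P (fun w => `|normalized n om w - Z j om w| + `|Z j om w|))).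
    apply: le_Ex; [exact: intble_norm|exact: intbleD|move=> w].
    by have := ler_normD (normalized n om w - Z j om w) (Z j om w); rewrite subrK.
  by rewrite (ExD iDn iZn); lra.
- move=> k a; rewrite normal_char; apply: (cvg_along_blocks (qc k a)).
  apply: (transfer cos) => //; [|exact: cos_max|exact: norm_cosB_le].
  exact: continuous_measurable_fun (@continuous_cos R).
- move=> k a; rewrite (_ : Ex _ _ = 0); last first.
    rewrite -(normal_sin (k%:R / a.+1%:R * Num.sqrt v)); apply: eq_Ex => x.
    by rewrite mulrA.
  apply: (cvg_along_blocks (qs k a)).
  apply: (transfer sin) => //; [|exact: sin_max|exact: norm_sinB_le].
  exact: continuous_measurable_fun (@continuous_sin R).
Qed.

End central_limit.

(** * Steps positive almost surely, scenery on the integers *)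

Section positive_part.
Context (R : realType) d (T : measurableType d) (P : probability T R).
Context (X : nat -> T -> nat).
Hypothesis iidX : iid_N P X.
Hypothesis X_support : support_N P (X 0) `<=` [set k | (0 < k)%N].

(* The steps are assumed positive only almost surely. *)
Definition positive_steps (i : nat) (w : T) : nat := maxn (X i w) 1.

Lemma positive_steps_gt0 i w : (0 < positive_steps i w)%N.
Proof. by rewrite /positive_steps leq_max orbT. Qed.

Lemma measurable_preimage_nat i (B : set nat) : measurable (X i @^-1` B).
Proof.
have [mX _ _] := iidX.
have -> : X i @^-1` B = \bigcup_(k in B) (X i @^-1` [set k]).
  by apply/seteqP; split=> [w /= h|w [k /= h kx]]; [exists (X i w)|rewrite /preimage /= kx].
exact: bigcup_measurable.
Qed.

Lemma ae_X_gt0 : {ae P, forall w, forall i, (0 < X i w)%N}.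
Proof.
apply: ae_foralln => i; exists (X i @^-1` [set 0%N]); split.
- exact: measurable_preimage_nat.
- have [_ _ eX] := iidX; apply: etrans (eX i [set 0%N]) _; apply/eqP; rewrite -measure_le0 leNgt; apply/negP => p0.
  by have := X_support p0.
- by move=> w /= /negP; rewrite -eqn0Ngt => /eqP.
Qed.

Lemma ae_positive_steps : {ae P, forall w, forall i, positive_steps i w = X i w}.
Proof.
by apply: filterS ae_X_gt0 => w h i; rewrite /positive_steps; apply/maxn_idPl.
Qed.

Lemma iid_positive_steps : iid_N P positive_steps.
Proof.
have [mX indX eX] := iidX; split.
- by move=> i k; exact: (measurable_preimage_nat i ((maxn^~ 1) @^-1` [set k])).
- by move=> s B us; exact: (indX s (fun i => (maxn^~ 1) @^-1` B i) us).
- by move=> i B; exact: (eX i ((maxn^~ 1) @^-1` B)).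
Qed.

Lemma aperiodic_positive_steps : aperiodic (support_N P (X 0)) ->
  aperiodic (support_N P (positive_steps 0)).
Proof.
move=> aX p hp; apply: aX => k kX; apply: hp; have k0 := X_support kX.
apply: lt_le_trans kX _; apply: le_measure; rewrite ?inE.
- exact: measurable_preimage_nat.
- exact: (measurable_preimage_nat 0 ((maxn^~ 1) @^-1` [set k])).
by move=> w /= wk; rewrite /positive_steps wk; apply/maxn_idPl.
Qed.

Lemma intble_positive_steps (b : nat -> R) :
  intble P (fun w => b (X 0 w)) -> intble P (fun w => b (positive_steps 0 w)).
Proof.
move=> bX; have mb := measurable_natX iid_positive_steps b 0.
move: (bX) => /integrableP[mbX fin]; apply/integrableP; split; first exact/measurable_EFinP.
rewrite (@ae_eq_integral _ _ _ P _ (fun w => `|(b (X 0 w))%:E|)%E) //.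
- by apply/measurable_EFinP; exact: measurableT_comp.
- exact: measurableT_comp.
- by apply: filterS ae_positive_steps => w h _ /=; rewrite h.
Qed.

Lemma Ex_ae_eq (f g : T -> R) : measurable_fun setT f -> measurable_fun setT g ->
  {ae P, forall w, f w = g w} -> Ex P f = Ex P g.
Proof.
move=> mf mg fg; congr fine; apply: ae_eq_integral => //; try exact/measurable_EFinP.
by apply: filterS fg => w -> _.
Qed.

Lemma ae_walk_sum d' (Om : measurableType d') (Y : nat -> Om -> R) n om :
  {ae P, forall w, walk_sum Y X n om w = walk_sum Y positive_steps n om w}.
Proof.
apply: filterS ae_positive_steps => w h; apply: eq_bigr => k _.
by congr Y; apply: eq_bigr => i _; rewrite h.
Qed.

End positive_part.

Section integer_scenery.
Context (R : realType) d (Om : measurableType d) (PP : probability Om R).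

(** The walk sees only nonnegative sites; events indexed by natural numbers are extended to the
    integers through the absolute value. *)
Lemma iid_half_line (omega : int -> Om -> R) :
  iid_R PP omega 0 -> iid_R PP (fun x : nat => omega (Posz x)) 0%N.
Proof.
move=> [mo io eo]; split => [i|s B us mB|i B mB]; [exact: mo|move: s us mB|exact: eo].
have inj : injective Posz by move=> i j [].
move=> s us mB; have := io (map Posz s) (fun z => B `|z|%N).
rewrite map_inj_uniq// big_map => /(_ us) <-; last first.
  by move=> i /mapP[k ks ->]; exact: mB.
congr (PP _); apply/seteqP; split => [om h i /= /mapP[k ks ->]|om h k /= ks].
  exact: h.
by apply: (h (Posz k)); exact: map_f.
Qed.

Lemma scenery_sumE (omega : int -> Om -> R) d' (T : measurableType d') (X : nat -> T -> nat) n om :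
  scenery_sum omega X n om = walk_sum (fun x => omega (Posz x)) X n om.
Proof. by apply/funext => w; rewrite /walk_sum big_mkord. Qed.

End integer_scenery.

Theorem theorem1 (R : realType)
  (d : measure_display) (Omega : measurableType d) (PP : probability Omega R)
  (omega : int -> Omega -> R)
  (d' : measure_display) (Omega' : measurableType d') (P : probability Omega' R)
  (X : nat -> Omega' -> nat) :
  (* scenery: i.i.d., symmetric, all moments finite, unit variance *)
  iid_R PP omega 0 ->
  (forall B : set R, measurable B ->
     PP (omega 0 @^-1` B) = PP ((fun om => - omega 0 om) @^-1` B)) ->
  (forall k : nat, (1 <= k)%N ->
     PP.-integrable setT (fun om => (`|omega 0 om| ^+ k)%:E)) ->
  (\int[PP]_om (omega 0 om ^+ 2)%:E = 1)%E ->
  (* renewal increments: i.i.d., support an aperiodic subset of N*,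
     finite first and second moments *)
  iid_N P X ->
  support_N P (X 0) `<=` [set k | (0 < k)%N] ->
  aperiodic (support_N P (X 0)) ->
  P.-integrable setT (fun w => (X 0 w)%:R%:E) ->
  P.-integrable setT (fun w => ((X 0 w)%:R ^+ 2)%:E) ->
  let m : R := fine (\int[P]_w ((X 0 w)%:R)%:E)%E in
  {ae PP, forall om,
    cvg_law_to_gaussian P
      (fun n w => (scenery_sum omega X n om w
                   - fine (\int[P]_w' (scenery_sum omega X n om w')%:E)%E)
                  / Num.sqrt n%:R)
      (1 - m^-1)}.
Proof.
move=> iidO symO momO varO iidX X_support X_aper X_int X2_int m.
set Y := fun x : nat => omega (Posz x); set X' := positive_steps X.
have iidY : iid_R PP Y 0%N := iid_half_line iidO.
have iidX' : iid_N P X' := iid_positive_steps iidX.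
have eX := ae_positive_steps iidX X_support.
have X_int' : intble P (fun w => (X' 0%N w)%:R) :=
  intble_positive_steps iidX X_support (b := fun k => k%:R) X_int.
have X2_int' : intble P (fun w => (X' 0%N w)%:R ^+ 2) :=
  intble_positive_steps iidX X_support (b := fun k => k%:R ^+ 2) X2_int.
have mE : Ex P (fun w => (X' 0%N w)%:R) = m.
  apply: Ex_ae_eq; [exact: intble_measurable X_int'|exact: intble_measurable X_int|].
  by apply: filterS eX => w h; rewrite /X' h.
have := quenched_clt iidY symO momO varO iidX' (positive_steps_gt0 X)
  (aperiodic_positive_steps iidX X_support X_aper) X_int' X2_int'.
apply: filterS => om clt f cf fM.
have mW n : measurable_fun setT (walk_sum Y X n om).
  exact: (measurable_fun_pair2 om (measurable_walk_sum iidY iidX n)).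
have mW' n : measurable_fun setT (walk_sum Y X' n om).
  exact: (measurable_fun_pair2 om (measurable_walk_sum iidY iidX' n)).
have mf : measurable_fun setT f by exact: continuous_measurable_fun.
have WW' n := ae_walk_sum iidX X_support Y n om.
have EW n : Ex P (walk_sum Y X n om) = Ex P (walk_sum Y X' n om).
  exact: Ex_ae_eq.
have [M fM'] := fM.
have bounded d0 (S : measurableType d0) (Q : probability S R) (U : S -> R) :
    measurable_fun setT U -> intble Q (fun w => f (U w)).
  move=> mU; apply: (@intble_bounded _ _ _ Q _ M) => //.
  exact: (measurableT_comp mf mU).
have mN n : measurable_fun setT (normalized Y P X' n om).
  by apply: measurable_funM => //; apply: measurable_funB.
rewrite -[X in _ --> X]/(\int[@std_normal R]_x (f (Num.sqrt (1 - m^-1) * x))%:E)%E.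
rewrite Ex_EFin; last by apply: bounded; exact: measurable_funM.
rewrite -mE; have := clt f cf fM.
set l := Ex _ _; move=> fl.
(* The two walks agree almost surely, so the integrand changes only on a null set, and by [EW] the
   centering does not change. *)
suff -> : (fun n => \int[P]_w (f ((scenery_sum omega X n om w -
    fine (\int[P]_w' (scenery_sum omega X n om w')%:E)) / Num.sqrt n%:R))%:E)%E =
    (fun n => (Ex P (fun w => f (normalized Y P X' n om w)))%:E).
  by apply: cvg_EFin => //; exact: nearW.
apply/funext => n; rewrite -Ex_EFin; last exact: bounded.
rewrite scenery_sumE -/Y -/(Ex P (walk_sum Y X n om)) EW.
apply: ae_eq_integral => //.
- apply/measurable_EFinP; apply: (measurableT_comp mf).
  by apply: measurable_funM => //; exact: measurable_funB.
- by apply/measurable_EFinP; exact: (measurableT_comp mf).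
by apply: filterS (WW' n) => w -> _.
Qed.
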